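(* Let $C_0>0$ be given, and let $\xi$ be a real random variable of mean zero and variance one that is continuous with bounded density and satisfies the logarithmic Sobolev inequality with parameter $C_0$. Let $\xi_0,\xi_1,\dots$ be i.i.d. copies of $\xi$ and let $$F(x)=\sum_{j=0}^n\xi_j\frac{x^j}{\sqrt{j!}}$$ be the Weyl polynomial. Let $C_W>1$ be given, let $I=[\frac1{C_W}\sqrt n,\,C_W\sqrt n]$ or $I=[-C_W\sqrt n,\,-\frac1{C_W}\sqrt n]$, and let $N_I$ be the number of roots of $F$ in $I$. Then there exist positive constants $c,D_1,D_2$ (independent of $n$ and $\varepsilon$) such that for all sufficiently large $n$ and all $n^{-c}\le\varepsilon\le1$, $$\mathbb{P}\big(|N_I-\mathbb{E}N_I|\ge\varepsilon\sqrt n\big)\le e^{-(\varepsilon^{D_1}/\log^{D_2}n)\sqrt n}.$$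
   Context: Logarithmic Sobolev inequality with parameter $C_0$: for every smooth, bounded, compactly supported function $f$, $\mathrm{Ent}_\xi(f^2)\le C_0\,\mathbb{E}_\xi|\nabla f|^2$, where $\mathrm{Ent}_\xi(f)=\mathbb{E}_\xi(f\log f)-(\mathbb{E}_\xi f)(\log\mathbb{E}_\xi f)$. The quantities $C_W$ and the law of $\xi$ are fixed, and $n\to\infty$. *)

(* Defs.v *)
From HB Require Import structures.
From mathcomp Require Import all_boot all_order all_algebra finmap.
From mathcomp Require Import all_classical all_reals all_analysis.

Set Implicit Arguments.
Unset Strict Implicit.
Unset Printing Implicit Defensive.

Import Order.TTheory GRing.Theory Num.Theory.
Import numFieldNormedType.Exports.

Local Open Scope classical_set_scope.
Local Open Scope ring_scope.

Definition has_bounded_density (R : realType) (d : measure_display)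
    (T : measurableType d) (P : probability T R) (X : {RV P >-> R}) : Prop :=
  exists (p : R -> R) (K : R),
    [/\ measurable_fun setT p,
        (forall x, 0 <= p x <= K) &
        (forall A : set R, measurable A ->
           distribution P X A =
           (\int[@lebesgue_measure R]_(x in A) (p x)%:E)%E)].

Definition smooth (R : realType) (f : R -> R) : Prop :=
  forall (k : nat) (x : R), derivable (derive1n k f) x 1.

Definition compactly_supported (R : realType) (f : R -> R) : Prop :=
  compact (closure [set x | f x != 0]).

(* The convention 0 log 0 = 0 holds in both terms: [ln 0 = 0] in [R], and
   [lne 0 = -oo] with [0 * -oo = 0] in [\bar R]. *)
Definition entropy (R : realType) (d : measure_display)
    (T : measurableType d) (P : probability T R) (X : T -> R) : \bar R :=
  ('E_P[(fun w => X w * ln (X w))%R] - 'E_P[X] * lne 'E_P[X])%E.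

Definition log_sobolev (R : realType) (C0 : R) (d : measure_display)
    (T : measurableType d) (P : probability T R) (X : {RV P >-> R}) : Prop :=
  forall f : R -> R, smooth f -> bounded_fun f -> compactly_supported f ->
    (entropy P (fun w => (f (X w) ^+ 2)%R)
       <= C0%:E * 'E_P[(fun w => (derive1 f (X w) ^+ 2)%R)])%E.

Definition mutually_independent (R : realType) (d : measure_display)
    (T : measurableType d) (P : probability T R) (X : nat -> {RV P >-> R}) :
    Prop :=
  forall (J : {fset nat}) (A : nat -> set R),
    (forall j, j \in J -> measurable (A j)) ->
    P (\bigcap_(j in [set` J]) (X j @^-1` A j)) =
    (\prod_(j <- J) P (X j @^-1` A j))%E.

Definition iid_copies (R : realType)
    (d0 : measure_display) (T0 : measurableType d0) (P0 : probability T0 R)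
    (X0 : {RV P0 >-> R})
    (d : measure_display) (T : measurableType d) (P : probability T R)
    (X : nat -> {RV P >-> R}) : Prop :=
  mutually_independent X /\
  (forall (j : nat) (A : set R), measurable A ->
     distribution P (X j) A = distribution P0 X0 A).

Definition weyl_poly (R : realType) (n : nat) (a : nat -> R) : {poly R} :=
  \poly_(j < n.+1) (a j / Num.sqrt (j`!)%:R).

(* Roots are counted without multiplicity; since [fset_set] of an infinite set
   is empty, the count is 0 for the zero polynomial on a nondegenerate
   interval.  When the coefficients of [F] are independent with densities,
   multiple roots and [F = 0] (for which the count could be debated) are
   null events. *)
Definition num_roots (R : realType) (I : set R) (F : {poly R}) : nat :=
  #|` fset_set (I `&` [set x | root F x])|%fset.

Definition num_weyl_roots (R : realType) (d : measure_display)
    (T : measurableType d) (P : probability T R) (X : nat -> {RV P >-> R})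
    (n : nat) (I : set R) : T -> R :=
  fun w => (num_roots I (weyl_poly n (fun j => X j w)))%:R.

(* Main.v *)
Require Import Defs.
From HB Require Import structures.
From mathcomp Require Import all_boot all_order all_algebra finmap.
From mathcomp Require Import all_classical all_reals all_analysis.
From mathcomp Require Import measurable_realfun.
From mathcomp Require Import zify ring lra.

Set Implicit Arguments.
Unset Strict Implicit.
Unset Printing Implicit Defensive.

Import Order.TTheory GRing.Theory Num.Theory.
Import numFieldNormedType.Exports.

Local Open Scope classical_set_scope.
Local Open Scope ring_scope.

(** Put [y = exp u].  Near a given [u], only the coefficients in a window of
    length O(sqrt n log n) contribute to the Weyl polynomial, up to a relative
    error that is a large negative power of [n].  Cut the part of the interval
    below [sqrt n] into about [sqrt n] blocks of length about [1 / sqrt n] in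
    [u], and these into O(log n) classes such that the blocks of one class have
    disjoint windows.  On a block where the normalised polynomial is not tiny on
    a fine grid, the roots are the sign changes of the polynomial restricted to
    the window; these counts are O(log n) and independent within a class, so
    Hoeffding's inequality applies to them.  A block where the polynomial is as
    small as [exp (- s)] somewhere has O(s) roots, by the interpolation
    remainder for exponential sums, and the bounded density gives a joint
    small-ball estimate for several blocks, so Chernoff's bound controls the
    total contribution of such blocks.  Beyond [sqrt n] the leading term
    dominates and O(log n) intervals with few roots remain.  The logarithmic
    Sobolev inequality enters only through the exponential tails of the
    coefficients, obtained by testing it on smooth bumps.  Finally the number of
    roots is at most [n], so concentration around some number implies
    concentration around the mean. *)

(** * Outer probability and independence *)

(** The count is neither a sum of independent terms nor stable under small changes of the
    coefficients: where [F] is tiny, a single block may contain up to [n] zeros. In the variable [u]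
    the dominant index is about [exp (2 u)] and moves at speed of order [n], so a step of order
    [1 / sqrt n] moves it by order [sqrt n], the width of the Gaussian profile of the weights. All
    error levels are powers of [exp La], where [La] is a natural number at least [ln n], and the
    multiples of [La] form one budget. A weight outside the window is at most [exp (- 27 La)], the
    discarded sum at most [exp (- 24 La)], so values above that level keep their sign. A mesh of
    [exp (- 14 La)] times the block length resolves this level; the union over the grid costs at
    most [exp (15 La)], which a small-ball estimate at level [exp (- 24 La)] can afford. Small
    values in several blocks are handled by linear algebra: the pivots of the blocks of one class
    lie outside each other's windows, so the matrix of their coefficients is nearly the identity. *)

Section outer_probability.
Context (R : realType) (d : measure_display) (T : measurableType d)
  (P : probability T R).

(* Being an outer probability, [pr] needs no measurability in union bounds. *)
Definition pr (A : set T) : R := fine (mu_ext P A).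

Lemma mu_ext_le1 A : (mu_ext P A <= 1)%E.
Proof.
rewrite -(probability_setT P) -(measurable_mu_extE P measurableT).
exact: le_mu_ext.
Qed.

Lemma mu_ext_fin_num A : mu_ext P A \is a fin_num.
Proof.
rewrite ge0_fin_numE ?(le_lt_trans (mu_ext_le1 A)) ?ltry//.
exact: mu_ext_ge0.
Qed.

Lemma prEext A : (pr A)%:E = mu_ext P A.
Proof. by rewrite /pr fineK ?mu_ext_fin_num. Qed.

Lemma prE A : measurable A -> (pr A)%:E = P A.
Proof. by move=> mA; rewrite prEext measurable_mu_extE. Qed.

Lemma pr_ge0 A : 0 <= pr A.
Proof. by rewrite -lee_fin prEext mu_ext_ge0. Qed.

Lemma pr_le1 A : pr A <= 1.
Proof. by rewrite -lee_fin prEext mu_ext_le1. Qed.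

Lemma pr_le A B : A `<=` B -> pr A <= pr B.
Proof. by move=> AB; rewrite -lee_fin !prEext le_mu_ext. Qed.

Lemma pr_set0 : pr set0 = 0.
Proof. by rewrite /pr mu_ext0. Qed.

Lemma pr_setT : pr setT = 1.
Proof. by apply: EFin_inj; rewrite prE// probability_setT. Qed.

Lemma prU A B : pr (A `|` B) <= pr A + pr B.
Proof.
rewrite -lee_fin EFinD !prEext.
by apply: outer_measureU2.
Qed.

Lemma pr_bigU (I : Type) (s : seq I) (Q : pred I) (A : I -> set T) :
  pr (\big[setU/set0]_(i <- s | Q i) A i) <= \sum_(i <- s | Q i) pr (A i).
Proof.
elim/big_rec2: _ => [|i x B _ IH]; first by rewrite pr_set0.
by rewrite (le_trans (prU _ _))// lerD2l.
Qed.

Lemma pr_exists (I : finType) (Q : pred I) (A : I -> set T) :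
  pr [set w | exists2 i, Q i & A i w] <= \sum_(i | Q i) pr (A i).
Proof.
apply: le_trans (pr_bigU _ _ _); apply: pr_le => w /= [i Qi Ai].
by rewrite -bigcup_seq_cond; exists i => //=; rewrite mem_index_enum.
Qed.

End outer_probability.

(** * Sigma-algebras of disjoint sets of coordinates *)

Section independence.
Context (R : realType) (d : measure_display) (T : measurableType d)
  (P : probability T R) (X : nat -> T -> R).

Definition indep_seq := forall (J : {fset nat}) (A : nat -> set R),
  (forall j, j \in J -> measurable (A j)) ->
  P (\bigcap_(j in [set` J]) (X j @^-1` A j)) =
  (\prod_(j <- J) P (X j @^-1` A j))%E.

(** Only a finite [D] inside [J] is constrained: [J] may be infinite, such as the complement of one
    index, and rectangles remain closed under intersection. *)
Definition coord_rect (J : set nat) : set (set T) :=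
  [set E | exists (D : {fset nat}) (A : nat -> set R),
    (forall j, j \in D -> J j) /\ (forall j, measurable (A j)) /\
    E = \bigcap_(j in [set` D]) (X j @^-1` A j)].

Definition coord_sig (J : set nat) : set (set T) := <<s coord_rect J >>.

Hypothesis mX : forall j, measurable_fun setT (X j).
Hypothesis iX : indep_seq.

Lemma coord_rectI J : setI_closed (coord_rect J).
Proof.
move=> _ _ [D [A [DJ [mA ->]]]] [D' [A' [DJ' [mA' ->]]]].
exists (D `|` D')%fset, (fun j => (if j \in D then A j else setT) `&`
  (if j \in D' then A' j else setT)); split.
  by move=> j; rewrite in_fsetU => /orP[/DJ|/DJ'].
split; first by move=> j; apply: measurableI; case: ifP.
rewrite eqEsubset; split => w /=.
  move=> [h h'] j /= _; split; case: ifPn => // jD; [exact: h|exact: h'].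
move=> h; split => j /= jD.
- by have := h j; rewrite /= in_fsetU jD => /(_ isT)[].
- by have := h j; rewrite /= in_fsetU jD orbT => /(_ isT)[].
Qed.

Lemma coord_rect_measurable J : coord_rect J `<=` measurable.
Proof.
move=> _ [D [A [_ [mA ->]]]]; apply: bigcap_measurableType => // j _.
by rewrite -[_ @^-1` _]setTI; exact: mX.
Qed.

Lemma coord_rectT J : coord_rect J setT.
Proof.
exists fset0, (fun=> setT); split => //; split => //.
by rewrite eqEsubset; split => w.
Qed.

Lemma coord_sig_measurable J : coord_sig J `<=` measurable.
Proof.
apply: smallest_sub; first exact: sigma_algebra_measurable.
exact: coord_rect_measurable.
Qed.

Lemma coord_sigS J J' : J `<=` J' -> coord_sig J `<=` coord_sig J'.
Proof.
move=> JJ'; apply: sub_sigma_algebra2 => E [D [A [DJ h]]].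
by exists D, A; split => // j /DJ/JJ'.
Qed.

Lemma coord_sig_preimage (J : set nat) j A :
  J j -> measurable A -> coord_sig J (X j @^-1` A).
Proof.
move=> Jj mA; apply: sub_sigma_algebra.
exists [fset j]%fset, (fun=> A); split.
  by move=> i; rewrite in_fset1 => /eqP ->.
split=> //; rewrite eqEsubset; split => w /=.
  by move=> Aw i /= /fset1P ->.
by apply => /=; rewrite fset11.
Qed.

Lemma coord_rect_indep J J' A B : J `&` J' = set0 ->
  coord_rect J A -> coord_rect J' B -> P (A `&` B) = (P A * P B)%E.
Proof.
move=> JJ' [D [F [DJ [mF ->]]]] [D' [F' [DJ' [mF' ->]]]].
pose G j := if j \in D then F j else F' j.
have dis j : j \in D -> j \notin D'.
  move=> jD; apply/negP => jD'; have : (J `&` J') j by split; [exact: DJ|exact: DJ'].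
  by rewrite JJ'.
have -> : \bigcap_(j in [set` D]) (X j @^-1` F j) `&`
    \bigcap_(j in [set` D']) (X j @^-1` F' j) =
    \bigcap_(j in [set` (D `|` D')%fset]) (X j @^-1` G j).
  rewrite eqEsubset; split => w /=.
    move=> [h h'] j /=; rewrite in_fsetU /G => /orP[jD|jD'].
      by rewrite jD; exact: h.
    by case: ifPn => [|_]; [exact: h|exact: h'].
  move=> h; split => j /= jD; have := h j; rewrite /= in_fsetU jD ?orbT /G;
    move=> /(_ isT); first by rewrite jD.
  by case: ifPn => // /dis; rewrite jD.
rewrite iX; last by move=> j _; rewrite /G; case: ifP.
rewrite (big_fsetID _ (mem D))/=.
have -> : [fset x in (D `|` D')%fset | x \in D]%fset = D.
  by apply/fsetP => x; rewrite !inE/=; case: (x \in D); rewrite ?andbF.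
have -> : [fset x in (D `|` D')%fset | x \notin D]%fset = D'.
  apply/fsetP => x; rewrite !inE/=; have := @dis x; case: (x \in D) => //=.
    by move=> /(_ isT)/negbTE ->.
  by rewrite andbT.
rewrite !iX; [|by move=> j _; exact: mF'|by move=> j _; exact: mF].
congr (_ * _)%E; apply: eq_big_seq => j jD; rewrite /G ?jD//.
by case: ifPn => // /dis; rewrite jD.
Qed.

(** Both sides are finite measures in [F], the restriction of [P] to [E] and a multiple of [P]. They
    agree on a pi-system containing the whole space, hence on the sigma-algebra that it
    generates. *)
Lemma rect_mrestr_unique J E : measurable E ->
  (forall F, coord_rect J F -> P (E `&` F) = (P E * P F)%E) ->
  forall F, coord_sig J F -> P (E `&` F) = (P E * P F)%E.
Proof.
move=> mE h F sF.
have PEfin : P E \is a fin_num by exact: fin_num_measure.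
have PEge0 : 0 <= fine (P E) by exact: fine_ge0.
have e1 G : P (E `&` G) = mrestr P mE G by rewrite /mrestr setIC.
have e2 G : (P E * P G)%E = mscale (NngNum PEge0) P G.
  by rewrite /mscale /= fineK.
rewrite e1 e2; apply: (@g_sigma_algebra_measure_unique _ _ _ (coord_rect J)
    (@coord_rect_measurable J) (fun=> setT) (fun=> coord_rectT J)) sF.
- by rewrite bigcup_const.
- exact: coord_rectI.
- by move=> G rG; have := h G rG; rewrite e1 e2.
- by move=> _; rewrite -[X in (X < _)%E]/(P (setT `&` E)) setTI ltey_eq PEfin.
Qed.

Lemma coord_sig_indep J J' A B : J `&` J' = set0 ->
  coord_sig J A -> coord_sig J' B -> P (A `&` B) = (P A * P B)%E.
Proof.
move=> JJ' sA sB.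
have mB : measurable B by exact: (coord_sig_measurable sB).
rewrite setIC muleC; apply: (rect_mrestr_unique mB _ sA) => E rE.
have mE := coord_rect_measurable rE.
rewrite setIC muleC; apply: (rect_mrestr_unique mE _ sB) => F rF.
exact: (@coord_rect_indep J J').
Qed.

Lemma pr_coord_sig_indep J J' A B : J `&` J' = set0 ->
  coord_sig J A -> coord_sig J' B -> pr P (A `&` B) = pr P A * pr P B.
Proof.
move=> JJ' sA sB.
have mB : measurable B by exact: (coord_sig_measurable sB).
have mA : measurable A by exact: (coord_sig_measurable sA).
apply: EFin_inj; rewrite EFinM !prE//; last exact: measurableI.
exact: coord_sig_indep JJ' sA sB.
Qed.

End independence.

(** * Joint small-ball estimates *)

Section small_ball.
Context (R : realType) (d : measure_display) (T : measurableType d)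
  (P : probability T R) (X : nat -> T -> R).

Definition coord_fun (J : set nat) (V : T -> R) :=
  measurable_fun (setT : set (g_sigma_algebraType (coord_rect X J))) V.

Definition lin_form (n : nat) (f : nat -> R) (w : T) : R :=
  \sum_(j < n.+1) f j * X j w.

Lemma coord_fun_lin (J : set nat) n f : (forall j, ~ J j -> f j = 0) ->
  coord_fun J (lin_form n f).
Proof.
move=> f0; rewrite /coord_fun /lin_form.
apply: (@measurable_sum _ (g_sigma_algebraType (coord_rect X J))) => j.
have [Jj|nJj] := pselect (J j).
- apply: measurable_funM => // _ B mB; rewrite setTI.
  exact: coord_sig_preimage Jj mB.
- have -> : (fun w => f j * X j w) = cst 0.
    by apply/funext => w; rewrite f0// mul0r.
  exact: measurable_cst.
Qed.

Lemma coord_fun_preimage J V (B : set R) : coord_fun J V -> measurable B ->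
  coord_sig X J (V @^-1` B).
Proof. by move=> mV mB; have := mV measurableT B mB; rewrite setTI. Qed.

Lemma coord_sigI J A B : coord_sig X J A -> coord_sig X J B ->
  coord_sig X J (A `&` B).
Proof. exact: (@measurableI _ (g_sigma_algebraType (coord_rect X J))). Qed.

Lemma coord_sigT J : coord_sig X J setT.
Proof. exact: (@measurableT _ (g_sigma_algebraType (coord_rect X J))). Qed.

Lemma coord_sig_all (I : eqType) (s : seq I) (A : I -> set T) J :
  (forall i, i \in s -> coord_sig X J (A i)) ->
  coord_sig X J [set w | forall i, i \in s -> A i w].
Proof.
elim: s => [|i s IH] h.
  by rewrite (_ : [set w | _] = setT); [exact: coord_sigT|apply/seteqP; split].
rewrite (_ : [set w | _] = A i `&` [set w | forall i, i \in s -> A i w]).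
  apply: coord_sigI; first by apply: h; rewrite mem_head.
  by apply: IH => k ks; apply: h; rewrite in_cons ks orbT.
apply/seteqP; split => w /=.
  move=> H; split; first by apply: H; rewrite mem_head.
  by move=> k ks; apply: H; rewrite in_cons ks orbT.
by move=> [Ai H] k; rewrite in_cons => /orP[/eqP ->|/H].
Qed.

Hypothesis mX : forall j, measurable_fun setT (X j).
Hypothesis iX : indep_seq P X.
Variable K : R.
Hypothesis sb : forall j a b, a <= b ->
  pr P [set w | a <= X j w <= b] <= K * (b - a).

(** Conditioning on the other coordinates by hand: on the shell where the modulus of [V] lies in [[q
    * t, (q + 1) * t[], the event forces [X i] into two intervals of length [3 * t] over the modulus
    of [a], which gives the 6. The shell is independent of [X i], and the shells partition [E]. *)
Lemma cond_small_ball i E V a t : 0 < t -> a != 0 ->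
  coord_sig X (~` [set i]) E -> coord_fun (~` [set i]) V ->
  pr P (E `&` [set w | `|a * X i w + V w| <= t]) <= pr P E * (6 * K * t / `|a|).
Proof.
move=> t0 a0 sE mV.
have an0 : 0 < `|a| by rewrite normr_gt0.
pose c := 6 * K * t / `|a|.
pose C q := E `&` (V @^-1` [set x | q%:R * t <= `|x| < q.+1%:R * t]).
have sC q : coord_sig X (~` [set i]) (C q).
  apply: coord_sigI => //; apply: coord_fun_preimage mV _.
  rewrite (_ : [set x | _] = (@Num.norm R R) @^-1` `[q%:R * t, q.+1%:R * t[%classic).
    by rewrite -[_ @^-1` _]setTI; exact: normr_measurable.
  by apply/seteqP; split => x /=; rewrite in_itv.
pose lo q : R := (q%:R - 1) * t / `|a|.
pose hi q : R := (q%:R + 2) * t / `|a|.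
pose S q := (X i @^-1` `[lo q, hi q]%classic) `|`
            (X i @^-1` `[- hi q, - lo q]%classic).
have mS q : coord_sig X [set i] (S q).
  apply: (@measurableU _ (g_sigma_algebraType (coord_rect X [set i])));
  exact: coord_sig_preimage.
have lohi q : hi q - lo q = 3 * t / `|a| by rewrite /hi /lo; field; exact: lt0r_neq0.
have le_lohi q : lo q <= hi q.
  by rewrite -subr_ge0 lohi divr_ge0// ?mulr_ge0// ltW.
have prS q : pr P (S q) <= c.
  apply: le_trans (prU _ _ _) _.
  have -> : c = K * (hi q - lo q) + K * (- lo q - (- hi q)).
    have -> : - lo q - - hi q = hi q - lo q by rewrite opprK addrC.
    by rewrite lohi /c; field; exact: lt0r_neq0.
  have pre a' b' : X i @^-1` `[a', b']%classic = [set w | a' <= X i w <= b'].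
    by apply/seteqP; split => x /=; rewrite in_itv.
  by apply: lerD; rewrite pre sb// lerN2.
have sub : E `&` [set w | `|a * X i w + V w| <= t] `<=`
    \bigcup_q (C q `&` S q).
  move=> w [Ew /= h].
  exists (Num.truncn (`|V w| / t)) => //.
  have /andP[q1 q2] := truncn_itv (divr_ge0 (normr_ge0 (V w)) (ltW t0)).
  set q := Num.truncn _ in q1 q2 *.
  rewrite ler_pdivlMr// in q1; rewrite ltr_pdivrMr// in q2.
  split; first by split => //=; rewrite q1 q2.
  have [h1 h2] : (q%:R - 1) * t <= `|a| * `|X i w| /\
     `|a| * `|X i w| <= (q%:R + 2) * t.
    rewrite -normrM; move: q2; rewrite -natr1 => q2.
    have h3 := ler_normD (a * X i w + V w) (- V w).
    have h4 := ler_normD (a * X i w + V w) (- (a * X i w)).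
    have e1 : a * X i w + V w + - V w = a * X i w by ring.
    have e2 : a * X i w + V w + - (a * X i w) = V w by ring.
    by move: h3 h4; rewrite e1 e2 !normrN => h3 h4; split; lra.
  have {}h1 : lo q <= `|X i w| by rewrite /lo ler_pdivrMr// [_ * `|a|]mulrC.
  have {}h2 : `|X i w| <= hi q by rewrite /hi ler_pdivlMr// [_ * `|a|]mulrC.
  rewrite /S /=; move: h1 h2; have [x0|x0] := ger0P (X i w) => h1 h2.
    by left; rewrite in_itv/= h1.
  by right; rewrite in_itv/= lerNl h2 lerNr.
rewrite -/c -lee_fin EFinM.
apply: le_trans (_ : (pr P (\bigcup_q (C q `&` S q)))%:E <= _)%E.
  by rewrite lee_fin; exact: pr_le.
rewrite prEext; apply: le_trans (outer_measure_sigma_subadditive (mu_ext P) _) _.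
have mC q : measurable (C q) by exact: (coord_sig_measurable mX (sC q)).
have PE : P E = (\sum_(q <oo) P (C q))%E.
  rewrite -measure_semi_bigcup//.
  - congr (P _); apply/seteqP; split => w; last by case=> q _ [].
    move=> Ew; exists (Num.truncn (`|V w| / t)) => //; split => //=.
    have /andP[q1 q2] := truncn_itv (divr_ge0 (normr_ge0 (V w)) (ltW t0)).
    by rewrite -ler_pdivlMr// q1 -ltr_pdivrMr.
  - move=> q q' _ _ [w [[_ /= /andP[h1 h2]] [_ /= /andP[h3 h4]]]].
    have := le_lt_trans h1 h4; have := le_lt_trans h3 h2.
    by rewrite !ltr_pM2r// !ltr_nat !ltnS => ? ?; apply/eqP; rewrite eqn_leq; apply/andP.
  - exact: bigcup_measurable.
have c0 : 0 <= c by exact: le_trans (pr_ge0 _ _) (prS 0%N).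
rewrite prE; last exact: (coord_sig_measurable mX sE).
rewrite PE muleC -nneseriesZl//.
apply: lee_nneseries => [q _ _|q _]; first exact: mu_ext_ge0.
rewrite -[X in (X <= _)%E]/(mu_ext P (C q `&` S q)) -prEext (@pr_coord_sig_indep _ _ _ _ _ mX iX (~` [set i]) [set i])//.
  by rewrite -prE// -EFinM lee_fin mulrC ler_wpM2r// pr_ge0.
by rewrite setICl.
Qed.

Lemma lin_formZD n (f g : nat -> R) c w :
  lin_form n (fun j => f j - c * g j) w = lin_form n f w - c * lin_form n g w.
Proof.
rewrite /lin_form mulr_sumr -sumrB; apply: eq_bigr => j _.
by rewrite mulrBl mulrA.
Qed.

(* Gaussian elimination, pivoting first on the form with the smallest
   threshold: the rows that remain then change by at most a fixed factor of
   their own threshold, and no longer involve the pivot variable. *)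
Lemma joint_small_ball (n N : nat) (eta : R) (I : eqType) (piv : I -> nat)
    (s : seq I) (f : I -> nat -> R) (t : I -> R) :
  0 <= eta -> 8 * N%:R ^+ 2 * eta <= 1 -> (0 < N)%N -> (size s <= N)%N ->
  uniq s -> sorted (fun k l => t k <= t l) s ->
  {in s, forall k, 0 < t k} -> {in s, forall k, (piv k <= n)%N} ->
  {in s, forall k, 2^-1 + (size s)%:R * eta <= `|f k (piv k)|} ->
  {in s &, forall k l, k != l ->
     `|f k (piv l)| <= (2 * N%:R - (size s)%:R) * eta} ->
  pr P [set w | forall k, k \in s -> `|lin_form n (f k) w| <= t k] <=
  \prod_(k <- s) (12 * K * (1 + (2 * N%:R)^-1) ^+ size s * t k).
Proof.
move=> eta0 Neta N0.
have K0 : 0 <= K.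
  have := sb 0 (@ler01 R); rewrite subr0 mulr1; apply: le_trans; exact: pr_ge0.
have N1 : 1 <= N%:R :> R by rewrite ler1n.
(* The size of the list is the number of pivots to come. One elimination costs [eta] in the margin
   of the diagonal and [eta] in the off-diagonal bound, and at most [N] of them occur. *)
elim: s f t => [|k0 s IH] f t /=.
  by move=> *; rewrite big_nil pr_le1.
move=> sN /andP[k0s us] st tpos pivn diag off.
have k0in : k0 \in k0 :: s by rewrite mem_head.
have sin k : k \in s -> k \in k0 :: s by rewrite inE orbC => ->.
have ksne k : k \in s -> k != k0 by apply: contraTneq => ->.
set r : R := (size s)%:R.
have rE : (size s).+1%:R = r + 1 :> R by rewrite -natr1.
have r0 : 0 <= r by exact: ler0n.
have rN : r + 1 <= N%:R by rewrite -rE ler_nat.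
pose e := (2 * N%:R - (r + 1)) * eta.
have e0 : 0 <= e by rewrite mulr_ge0//; lra.
have eN : e <= 2 * N%:R * eta by rewrite ler_wpM2r//; lra.
have e2 : 2 * e ^+ 2 <= eta.
  have h : e ^+ 2 <= (2 * N%:R * eta) ^+ 2 by rewrite ler_sqr ?nnegrE// (le_trans e0).
  have : (8 * N%:R ^+ 2 * eta) * eta <= 1 * eta by rewrite ler_wpM2r.
  by move: h; rewrite exprMn exprMn; lra.
have e3 : 2 * e <= (2 * N%:R)^-1.
  rewrite -[leRHS]mul1r ler_pdivlMr; last by lra.
  have : (2 * e) * (2 * N%:R) <= (2 * (2 * N%:R * eta)) * (2 * N%:R).
    by rewrite ler_wpM2r//; lra.
  by move: Neta; rewrite expr2; lra.
have a0 : 2^-1 <= `|f k0 (piv k0)|.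
  have := diag _ k0in; have : 0 <= (size s).+1%:R * eta by rewrite mulr_ge0.
  by lra.
have a00 : f k0 (piv k0) != 0 by rewrite -normr_gt0; lra.
pose c l := f l (piv k0) / f k0 (piv k0).
have cle l : l \in s -> `|c l| <= 2 * e.
  move=> ls; rewrite normrM normfV ler_pdivrMr ?normr_gt0//.
  have := off _ _ (sin _ ls) k0in (ksne _ ls); rewrite rE -/e => h.
  apply: le_trans h _; rewrite mulrAC -[leLHS]mul1r ler_wpM2r//; lra.
pose f' l j := f l j - c l * f k0 j.
pose th : R := 1 + (2 * N%:R)^-1.
have th1 : 1 <= th by rewrite lerDl invr_ge0; lra.
pose t' l := th * t l.
have t0 : 0 < t k0 by exact: tpos.
have t0le l : l \in s -> t k0 <= t l.
  move=> ls; have := order_path_min _ st => /(_ _)/allP; apply => //.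
  by move=> x y z; exact: le_trans.
have sub : [set w | forall k, k \in k0 :: s -> `|lin_form n (f k) w| <= t k]
    `<=` [set w | forall k, k \in s -> `|lin_form n (f' k) w| <= t' k] `&`
    [set w | `|f k0 (piv k0) * X (piv k0) w +
       lin_form n (fun j => if j == piv k0 then 0 else f k0 j) w| <= t k0].
  move=> w /= h; split => /=.
    move=> k ks; rewrite lin_formZD; apply: le_trans (ler_normB _ _) _.
    rewrite normrM /t' /th mulrDl mul1r; apply: lerD; first exact: h (sin _ ks).
    apply: ler_pM => //; first exact: le_trans (cle _ ks) e3.
    by apply: le_trans (t0le _ ks); exact: h.
  apply: le_trans (h _ k0in); rewrite le_eqVlt; apply/orP; left; apply/eqP.
  congr (`| _ |); rewrite /lin_form.
  have pk : (piv k0 < n.+1)%N by rewrite ltnS; exact: pivn.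
  rewrite (bigD1 (Ordinal pk))//= [RHS](bigD1 (Ordinal pk))//= eqxx mul0r add0r.
  congr (_ + _); apply: eq_bigr => j jk; rewrite ifN//.
apply: le_trans (pr_le _ sub) _.
rewrite big_cons.
apply: le_trans (@cond_small_ball (piv k0) _ _ _ _ t0 a00 _ _) _.
- apply: coord_sig_all => k ks.
  rewrite [Z in coord_sig _ _ Z](_ : _ = (lin_form n (f' k)) @^-1` `[- t' k, t' k]%classic).
    apply: coord_fun_preimage => //; apply: coord_fun_lin => j /contrapT /= ->.
    by rewrite /f' /c mulfVK// subrr.
  by apply/seteqP; split => w /=; rewrite in_itv/= ler_norml.
- by apply: coord_fun_lin => j /contrapT /= ->; rewrite eqxx.
rewrite mulrC; apply: ler_pM; rewrite ?pr_ge0//.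
- by rewrite divr_ge0// mulr_ge0// ?(ltW t0)//; lra.
(* The pivot entry is at least 1/2 in modulus, which turns the 6 of the conditional estimate into
   12. *)
- rewrite ler_pdivrMr ?normr_gt0//.
  have h1 : 1 <= th ^+ (size s).+1 by exact: exprn_ege1.
  have h2 : 0 <= K * t k0 by rewrite mulr_ge0// ltW.
  have h3 : 1 <= 2 * th ^+ (size s).+1 * `|f k0 (piv k0)|.
    rewrite -[leLHS](@mulfV _ 2)// -mulrA ler_pM2l//.
    by rewrite -[leLHS]mul1r ler_pM.
  have := ler_wpM2l h2 h3; rewrite -/th; lra.
have -> : \prod_(k <- s) (12 * K * th ^+ (size s).+1 * t k) =
    \prod_(k <- s) (12 * K * th ^+ size s * t' k).
  by apply: eq_bigr => k _; rewrite exprSr /t' !mulrA.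
apply: IH => //.
- exact: ltnW.
- have := path_sorted st; rewrite !sorted_pairwise; last 2 first.
  + by move=> x y z; exact: le_trans.
  + by move=> x y z; exact: le_trans.
  by apply: sub_pairwise => x y; rewrite /t' ler_pM2l//; lra.
- by move=> k ks; rewrite /t' mulr_gt0 ?tpos ?sin//; lra.
- by move=> k ks; exact: pivn (sin _ ks).
- move=> k ks; have := diag _ (sin _ ks); rewrite rE.
  have h1 := ler_normB (f' k (piv k)) (- (c k * f k0 (piv k))).
  have eE : f' k (piv k) - - (c k * f k0 (piv k)) = f k (piv k).
    by rewrite /f' opprK subrK.
  rewrite eE normrN normrM in h1.
  have h2 : `|c k| * `|f k0 (piv k)| <= 2 * e * e.
    apply: ler_pM => //; first exact: cle.
    have := off _ _ k0in (sin _ ks); rewrite rE -/e; apply.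
    by rewrite eq_sym ksne.
  by move: e2; rewrite expr2 -/r; lra.
- move=> k l ks ls kl.
  apply: le_trans (ler_normB _ _) _; rewrite normrM.
  have h1 := off _ _ (sin _ ks) (sin _ ls) kl; rewrite rE -/e in h1.
  have h2 : `|c k| * `|f k0 (piv l)| <= 2 * e * e.
    apply: ler_pM => //; first exact: cle.
    have := off _ _ k0in (sin _ ls); rewrite rE -/e; apply.
    by rewrite eq_sym ksne.
  have : (2 * N%:R - r) * eta = e + eta by rewrite /e; ring.
  by move: e2; rewrite expr2 -/r => e2 ->; lra.
Qed.

End small_ball.

(** * Chernoff and Hoeffding bounds *)

Section chernoff.
Context (R : realType) (d : measure_display) (T : measurableType d)
  (P : probability T R).

(* The product bound on the joint law replaces independence. *)
Lemma discrete_chernoff (q b : nat) (Y : 'I_q -> T -> nat)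
    (c phi : 'I_q -> nat -> R) (M : R) :
  (forall i w, (Y i w <= b)%N) -> (forall i v, 0 <= c i v) ->
  (forall v : {ffun 'I_q -> 'I_b.+1},
     pr P [set w | forall i, Y i w = v i] <= \prod_i c i (v i)) ->
  pr P [set w | M <= \sum_i phi i (Y i w)] <=
    expR (- M) * \prod_i \sum_(v < b.+1) c i v * expR (phi i v).
Proof.
move=> Yb c0 hc.
pose Q (v : {ffun 'I_q -> 'I_b.+1}) := M <= \sum_i phi i (v i).
apply: (@le_trans _ _ (\sum_(v | Q v) pr P [set w | forall i, Y i w = v i])).
  apply: le_trans (pr_exists _ _ _); apply: pr_le => w /= hM.
  exists [ffun i => Ordinal (Yb i w : (Y i w < b.+1)%N)]; last by move=> i; rewrite ffunE.
  rewrite /Q (le_trans hM)// le_eqVlt; apply/orP; left; apply/eqP.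
  by apply: eq_bigr => i _; rewrite ffunE.
rewrite bigA_distr_bigA/= mulr_sumr.
rewrite big_mkcond/=; apply: ler_sum => v _.
have h : \prod_i (c i (v i) * expR (phi i (v i))) =
    \prod_i c i (v i) * expR (\sum_i phi i (v i)).
  by rewrite expR_sum -big_split.
rewrite h; case: ifPn => [Qv|_]; last first.
  by rewrite mulr_ge0 ?expR_ge0// mulr_ge0 ?expR_ge0// prodr_ge0.
apply: le_trans (hc v) _.
rewrite mulrCA -expRD -[leLHS]mulr1 ler_wpM2l ?prodr_ge0//.
by rewrite -expR0 ler_expR addrC subr_ge0.
Qed.

(** Since [1 - x <= expR (- x)], it suffices that the right-hand side times [1 - x] is at least
    1. *)
Lemma expR_le_quad (x : R) : x <= 2^-1 -> expR x <= 1 + x + 2 * x ^+ 2.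
Proof.
move=> x2.
have h : 1 - x <= expR (- x) by exact: expR_ge1Dx.
have x1 : 0 < 1 - x by lra.
have h2 : expR x * expR (- x) = 1 by rewrite -expRD subrr expR0.
have : expR x * (1 - x) <= 1 by rewrite -[leRHS]h2; apply: ler_wpM2l => //; exact: expR_ge0.
have : (1 + x + 2 * x ^+ 2) * (1 - x) = 1 + x ^+ 2 * (1 - 2 * x) by ring.
have : 0 <= x ^+ 2 * (1 - 2 * x) by rewrite mulr_ge0 ?sqr_ge0//; lra.
move=> h3 h4 h5; rewrite -(ler_pM2r x1); lra.
Qed.

(** Centring kills the linear term of the quadratic bound, and [v - mu] has modulus at most [b]. *)
Lemma centered_mgf (b : nat) (c : nat -> R) (l : R) :
  (forall v, 0 <= c v) -> \sum_(v < b.+1) c v = 1 ->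
  `|l| * b%:R <= 2^-1 ->
  \sum_(v < b.+1) c v * expR (l * (v%:R - \sum_(v < b.+1) c v * v%:R)) <=
    expR (2 * l ^+ 2 * b%:R ^+ 2).
Proof.
move=> c0 c1 lb; set mu := \sum_(v < b.+1) c v * v%:R.
have mu0 : 0 <= mu by apply: sumr_ge0 => i _; rewrite mulr_ge0.
have mub : mu <= b%:R.
  rewrite -[leRHS]mul1r -[Z in Z * b%:R]c1 mulr_suml; apply: ler_sum => i _.
  by apply: ler_wpM2l => //; rewrite ler_nat -ltnS.
have vb (v : 'I_b.+1) : `|l * (v%:R - mu)| <= `|l| * b%:R.
  rewrite normrM ler_wpM2l// ler_norml.
  have : (v%:R : R) <= b%:R by rewrite ler_nat -ltnS.
  have : (0 : R) <= v%:R by [].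
  by move=> ? ?; apply/andP; split; lra.
apply: (@le_trans _ _ (\sum_(v < b.+1)
   c v * (1 + l * (v%:R - mu) + 2 * (l ^+ 2 * b%:R ^+ 2)))).
  apply: ler_sum => v _; rewrite ler_wpM2l//.
  apply: le_trans (expR_le_quad _) _.
    by apply: le_trans (ler_norm _) _; apply: le_trans (vb v) _.
  have h : (l * (v%:R - mu)) ^+ 2 <= (`|l| * b%:R) ^+ 2.
    by rewrite -[leLHS]real_normK ?num_real// ler_sqr ?nnegrE// mulr_ge0.
  by move: h; rewrite [leRHS]exprMn real_normK ?num_real// => h; lra.
have -> : \sum_(v < b.+1) c v * (1 + l * (v%:R - mu) + 2 * (l ^+ 2 * b%:R ^+ 2))
   = (\sum_(v < b.+1) c v) * (1 - l * mu + 2 * (l ^+ 2 * b%:R ^+ 2)) + l * mu.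
  have e : l * mu = \sum_(v < b.+1) l * (c v * v%:R) by rewrite /mu mulr_sumr.
  rewrite [X in _ + X]e mulr_suml -big_split; apply: eq_bigr => v _ /=; ring.
rewrite c1 mul1r; apply: le_trans (expR_ge1Dx _); lra.
Qed.

Lemma hoeffding (q b : nat) (Z : 'I_q -> T -> nat) (l M : R) :
  let c i v := pr P [set w | Z i w = v] in
  let mu i := \sum_(v < b.+1) c i v * v%:R in
  (forall i w, (Z i w <= b)%N) -> (forall i, \sum_(v < b.+1) c i v = 1) ->
  (forall v : 'I_q -> nat,
     pr P [set w | forall i, Z i w = v i] <= \prod_i c i (v i)) ->
  0 <= l -> l * b%:R <= 2^-1 ->
  pr P [set w | M <= `|\sum_i ((Z i w)%:R - mu i)|] <=
    2 * expR (- (l * M) + q%:R * (2 * l ^+ 2 * b%:R ^+ 2)).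
Proof.
move=> c mu Zb c1 hc l0 lb.
have c0 i v : 0 <= c i v by exact: pr_ge0.
have one_side (x : R) : `|x| = l ->
    pr P [set w | l * M <= \sum_i (x * ((Z i w)%:R - mu i))] <=
    expR (- (l * M) + q%:R * (2 * l ^+ 2 * b%:R ^+ 2)).
  move=> xl.
  apply: le_trans (@discrete_chernoff _ b Z c (fun i v => x * (v%:R - mu i)) _ _ _ _) _ => //.
  rewrite expRD ler_wpM2l ?expR_ge0//.
  apply: (@le_trans _ _ (\prod_(i < q) expR (2 * l ^+ 2 * b%:R ^+ 2))).
    apply: ler_prod => i _; apply/andP; split.
      by apply: sumr_ge0 => v _; rewrite mulr_ge0 ?expR_ge0.
    have -> : l ^+ 2 = x ^+ 2 by rewrite -xl real_normK ?num_real.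
    by apply: centered_mgf => //; rewrite xl.
  by rewrite prodr_const card_ord -expRM_natl.
apply: (@le_trans _ _ (pr P ([set w | l * M <= \sum_i (l * ((Z i w)%:R - mu i))] `|`
   [set w | l * M <= \sum_i (- l * ((Z i w)%:R - mu i))]))).
  apply: pr_le => w /=; rewrite -!mulr_sumr; set S := \sum_i _ => h.
  have := ler_wpM2l l0 h; have [S0|S0] := ger0P S => h2; first by left.
  by right; rewrite mulNr -mulrN.
apply: le_trans (prU _ _ _) _.
rewrite mulr_natl mulr2n; apply: lerD; apply: one_side.
  by rewrite ger0_norm.
by rewrite normrN ger0_norm.
Qed.

End chernoff.

(** * Zeros of exponential sums *)

Section exponential_sums.
Context (R : realType).
Implicit Types (F : nat -> R -> R) (c be : nat -> R) (n m : nat).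

Lemma derivable_within_continuous1 (f df : R -> R) (a b : R) :
  (forall x : R, is_derive x (1 : R) f (df x)) -> {within `[a, b], continuous f}.
Proof.
move=> h; apply: derivable_within_continuous => x _.
by have [] := h x.
Qed.

Lemma rolle_path (f df : R -> R) (b x : R) (s : seq R) :
  (forall x : R, is_derive x (1 : R) f (df x)) -> path <%R x s -> all (<= b) s ->
  f x = 0 -> all (fun y => f y == 0) s ->
  exists s', [/\ size s' = size s, path <%R x s', all (<= b) s' &
    all (fun y => df y == 0) s'].
Proof.
move=> hf; elim: s x => [|y s IH] x /=; first by exists [::].
move=> /andP[xy ps] /andP[yb sb] fx /andP[/eqP fy fs].
have [s' [ss ps' sb' fs']] := IH y ps sb fy fs.
have drv t : t \in `]x, y[%R -> derivable f t 1 by have [] := hf t.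
have [z] := Rolle xy drv (derivable_within_continuous1 hf) (etrans fx (esym fy)).
rewrite in_itv/= => /andP[xz zy] dz.
exists (z :: s'); split => /=.
- by rewrite ss.
- rewrite xz/=; apply: path_le ps' => //; exact: lt_trans.
- by rewrite sb' andbT (le_trans _ yb)// ltW.
- rewrite fs' andbT.
  have [_ <-] := hf z; have [_ ->] := dz; exact: eqxx.
Qed.

Lemma rolle_iter F (b : R) m x (s : seq R) :
  (forall i (x : R), is_derive x (1 : R) (F i) (F i.+1 x)) ->
  size s = m -> path <%R x s -> all (<= b) s -> x <= b ->
  F 0%N x = 0 -> all (fun y => F 0%N y == 0) s ->
  exists2 z, x <= z <= b & F m z = 0.
Proof.
elim: m F x s => [|m IH] F x s hF.
  by move=> _ _ _ xb F0 _; exists x; rewrite ?lexx.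
move=> ss ps sb xb F0 Fs.
have [s' []] := rolle_path (hF 0%N) ps sb F0 Fs.
case: s' => [|y s']; first by rewrite ss.
move=> /=; rewrite ss => -[ss'] /andP[xy ps'] /andP[yb sb'] /andP[/eqP F1 Fs'].
have [z /andP[yz zb] Fz] := IH (fun i => F i.+1) y s' (fun i => hF i.+1) ss' ps' sb' yb F1 Fs'.
by exists z => //; rewrite zb (le_trans _ yz)// ltW.
Qed.

Lemma is_derive_scalel (k : R) (f : R -> R) (x df : R) :
  is_derive x (1 : R) f df -> is_derive x (1 : R) (fun y => k * f y) (k * df).
Proof. by move=> h; exact: (@is_deriveZ R R R f k x 1 df h). Qed.

(** The index [i] is the order of differentiation, so the family is closed under it. *)
Definition expsum n c be (i : nat) (x : R) : R :=
  \sum_(j < n.+1) c j * be j ^+ i * expR (be j * x).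

Lemma is_derive_expsum n c be i x :
  is_derive x (1 : R) (expsum n c be i) (expsum n c be i.+1 x).
Proof.
have -> : expsum n c be i =
    \sum_(j < n.+1) (fun x => c j * be j ^+ i * expR (be j * x)).
  by apply/funext => y; rewrite fct_sumE.
apply: is_derive_sum => j.
have h : is_derive x (1 : R) (fun x => expR (be j * x)) (be j * expR (be j * x)).
  have h0 : is_derive x (1 : R) (fun x => be j * x) (be j).
    by apply: trigger_derive (@is_derive_scalel (be j) id x 1 _) _; rewrite mulr1.
  rewrite mulrC.
  exact: (@is_derive1_comp R expR (fun x => be j * x) x _ _ (is_derive_expR _) h0).
apply: trigger_derive (is_derive_scalel (c j * be j ^+ i) h) _.
by rewrite exprSr !mulrA.
Qed.

Lemma expR_ge_Xn (x : R) m : 0 <= x -> x ^+ m / m`!%:R <= expR x.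
Proof.
move=> x0; case: m => [|m].
  by rewrite expr0 fact0 divr1 -expR0 ler_expR.
by apply: le_trans (expR_ge1Dxn m x0); rewrite lerDr.
Qed.

(** A Cauchy estimate by real means: one term of the exponential series bounds the [i]-th power of
    [kap] times the frequency by a factorial times an exponential. Here [kap] plays the radius of
    the disc. *)
Lemma expsum_le n c be i (kap l z : R) : 0 < kap -> 0 <= z <= l ->
  `|expsum n c be i z| / i`!%:R <= (kap ^+ i)^-1 *
    \sum_(j < n.+1) `|c j| * expR ((kap + l) * `|be j|).
Proof.
move=> k0 /andP[z0 zl].
rewrite ler_pdivrMr ?ltr0n ?fact_gt0// -mulrA mulrC ler_pdivlMr ?exprn_gt0//.
rewrite mulr_suml; apply: (@le_trans _ _ (\sum_(j < n.+1)
  `|c j * be j ^+ i * expR (be j * z)| * kap ^+ i)).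
  by rewrite -mulr_suml ler_wpM2r ?exprn_ge0 ?ler_norm_sum// ltW.
apply: ler_sum => j _.
rewrite !normrM normrX (ger0_norm (expR_ge0 _)).
have h1 := @expR_ge_Xn (kap * `|be j|) i (mulr_ge0 (ltW k0) (normr_ge0 _)).
rewrite ler_pdivrMr ?ltr0n ?fact_gt0// exprMn in h1.
have h2 : expR (be j * z) <= expR (l * `|be j|).
  rewrite ler_expR; apply: le_trans (ler_norm _) _.
  by rewrite normrM mulrC (ger0_norm z0) ler_wpM2r.
rewrite mulrDl expRD.
have h3 := ler_pM (mulr_ge0 (exprn_ge0 i (ltW k0)) (exprn_ge0 i (normr_ge0 _)))
  (expR_ge0 _) h1 h2.
have := ler_wpM2l (normr_ge0 (c j)) h3; lra.
Qed.

Lemma horner_derivn_prodXsub (s : seq R) (x : R) :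
  (\prod_(r <- s) ('X - r%:P))^`(size s).[x] = (size s)`!%:R.
Proof.
set p := \prod_(r <- s) _.
have sp : size p = (size s).+1 by rewrite size_prod_XsubC.
have mp : p \is monic by exact: monic_prod_XsubC.
have -> : p^`(size s) = (size s)`!%:R%:P.
  apply/polyP => -[|i]; rewrite coef_derivn coefC /= ?addn0.
    by rewrite ffactnn; move/monicP: mp; rewrite /lead_coef sp /= => ->.
  by rewrite nth_default ?mul0rn// sp addnS ltnS leq_addr.
by rewrite hornerC.
Qed.

(* Lagrange's interpolation remainder for [m] zeros in [0, l]. *)
Lemma expsum_zeros n c be (kap l : R) (s : seq R) : 0 < kap -> 0 <= l ->
  uniq s -> {in s, forall r, 0 <= r <= l /\ expsum n c be 0 r = 0} ->
  `|expsum n c be 0 0| <= (l / kap) ^+ size s *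
    \sum_(j < n.+1) `|c j| * expR ((kap + l) * `|be j|).
Proof.
move=> k0 l0 us hs.
set B := \sum_(j < _) _.
have B0 : 0 <= B by apply: sumr_ge0 => j _; rewrite mulr_ge0 ?expR_ge0.
have lk0 : 0 <= l / kap by rewrite divr_ge0// ltW.
have [s0|s0] := boolP (0 \in s).
  by have [_ ->] := hs _ s0; rewrite normr0 mulr_ge0 ?exprn_ge0.
pose w := \prod_(r <- s) ('X - r%:P).
have w0 : w.[0] != 0.
  by rewrite -[_ == 0]/(root w 0) root_prod_XsubC.
(* With this multiple of [w] the difference [F 0] vanishes at 0 as well as on [s], so its derivative
   of order [size s] vanishes somewhere in [[0, l]]. *)
pose la := expsum n c be 0 0 / w.[0].
pose F i x := expsum n c be i x - la * (w^`(i)).[x].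
have hF i (x : R) : is_derive x (1 : R) (F i) (F i.+1 x).
  have h := is_derive_scalel la (@is_derive_poly R (w^`(i)) x).
  rewrite /F derivnS.
  exact: (@is_deriveB R R R _ _ x 1 _ _ (is_derive_expsum n c be i x) h).
pose s' := sort <=%R s.
have ss' : size s' = size s by rewrite size_sort.
have hs' r : r \in s' -> 0 < r <= l /\ expsum n c be 0 r = 0.
  rewrite mem_sort => rs; have [/andP[h1 ->] ->] := hs _ rs; split => //.
  by rewrite andbT lt_neqAle h1 andbT; apply: contraNneq s0 => ->.
have ps : path <%R 0 s'.
  have -> : path <%R 0 s' = sorted <%R (0 :: s') by [].
  rewrite lt_sorted_uniq_le /= sort_uniq us andbT; apply/andP; split.
    by rewrite mem_sort.
  rewrite path_sortedE; last exact: le_trans.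
  rewrite sort_le_sorted andbT; apply/allP => r /hs'[/andP[h _] _]; exact: ltW.
have [z] : exists2 z, 0 <= z <= l & F (size s) z = 0.
  apply: (rolle_iter hF ss' ps _ l0).
  - by apply/allP => r /hs'[/andP[]].
  - by rewrite /F /la derivn0 divfK// subrr.
  - apply/allP => r rs; have [_ e] := hs' _ rs; rewrite /F derivn0 e.
    have -> : w.[r] = 0.
      by apply/eqP; rewrite -[_ == 0]/(root w r) root_prod_XsubC -(mem_sort <=%R).
    by rewrite mulr0 subrr.
move=> zl /eqP; rewrite /F horner_derivn_prodXsub subr_eq0 => /eqP ez.
have := @expsum_le n c be (size s) kap l z k0 zl.
rewrite ez normrM [X in _ * X / _]ger0_norm ?ler0n// mulfK ?pnatr_eq0 -?lt0n ?fact_gt0//.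
rewrite -/B /la normrM normfV ler_pdivrMr ?normr_gt0// => h.
have hw : forall t : seq R, {subset t <= s} ->
    \prod_(i <- t) `|('X - i%:P).[0]| <= l ^+ size t.
  elim=> [|r t IH] ts; first by rewrite big_nil expr0.
  rewrite big_cons /= exprS ler_pM ?prodr_ge0//.
    have [/andP[h1 h2] _] := hs _ (ts _ (mem_head _ _)).
    by rewrite !hornerE normrN ger0_norm.
  by apply: IH => x xt; apply: ts; rewrite inE xt orbT.
have {}hw : `|w.[0]| <= l ^+ size s by rewrite horner_prod normr_prod hw.
have K0 : 0 <= (kap ^+ size s)^-1 * B.
  by rewrite mulr_ge0// invr_ge0 exprn_ge0// ltW.
apply: le_trans h _; have := ler_wpM2l K0 hw.
by rewrite exprMn exprVn; lra.
Qed.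

End exponential_sums.

(** * Weights of the Weyl polynomial *)

Section weights.
Context (R : realType).
Implicit Types (u : R) (x : nat -> R) (n j m : nat).

Definition wt u j : R := expR (j%:R * u) / Num.sqrt j`!%:R.

(* The index of the dominant term at [exp u]: the weights [wt u] increase as
   long as [j < exp (2 u)]. *)
Definition pivot n u : nat := minn n (Num.truncn (expR (2 * u))).

Definition rho n u j : R := wt u j / wt u (pivot n u).

Definition pdist n u j : R := `|j%:R - (pivot n u)%:R|.

(* The Weyl polynomial at [exp u], and its normalisation by the dominant
   weight. *)
Definition gw n x u : R := \sum_(j < n.+1) x j * wt u j.

Definition gh n x u : R := \sum_(j < n.+1) x j * rho n u j.

Lemma wt_gt0 u j : 0 < wt u j.
Proof. by rewrite divr_gt0 ?expR_gt0// sqrtr_gt0 ltr0n fact_gt0. Qed.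

Lemma rho_ge0 n u j : 0 <= rho n u j.
Proof. by rewrite divr_ge0 ?ltW ?wt_gt0. Qed.

Lemma rho_pivot n u : rho n u (pivot n u) = 1.
Proof. by rewrite /rho divff// gt_eqF ?wt_gt0. Qed.

Lemma pivot_le n u : (pivot n u <= n)%N.
Proof. exact: geq_minl. Qed.

Lemma ghE n x u : gh n x u = gw n x u / wt u (pivot n u).
Proof. by rewrite /gh /gw mulr_suml; apply: eq_bigr => j _; rewrite mulrA. Qed.

Lemma gw_eq0 n x u : (gw n x u == 0) = (gh n x u == 0).
Proof. by rewrite ghE mulf_eq0 invr_eq0 [in RHS](gt_eqF (wt_gt0 _ _)) orbF. Qed.

Lemma wtS u j : wt u j.+1 * Num.sqrt j.+1%:R = wt u j * expR u.
Proof.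
have s0 k : (0 < k)%N -> Num.sqrt (k%:R : R) != 0.
  by move=> k0; rewrite gt_eqF// sqrtr_gt0 ltr0n.
rewrite /wt factS natrM sqrtrM ?ler0n// -natr1 mulrDl mul1r expRD.
by field; rewrite ?s0 ?fact_gt0 // natr1 s0.
Qed.

Lemma pivot_expR n u : (pivot n u)%:R <= expR (2 * u).
Proof.
apply: le_trans (_ : (Num.truncn (expR (2 * u)))%:R <= _).
  by rewrite ler_nat geq_minr.
by rewrite truncn_le ?expR_ge0.
Qed.

Lemma expR_pivot n u : (pivot n u < n)%N -> expR (2 * u) < (pivot n u).+1%:R.
Proof.
move=> h; have -> : pivot n u = Num.truncn (expR (2 * u)).
  by move: h; rewrite /pivot /minn; case: ifP => //; rewrite ltnn.
exact: truncnS_gt.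
Qed.

Lemma expR2 u : expR (2 * u) = expR u ^+ 2.
Proof. by rewrite -expRM_natl. Qed.

Lemma div_le_expRN (a m N : R) : 0 <= m -> 0 < a -> a <= N ->
  (a - m) / a <= expR (- (m / N)).
Proof.
move=> m0 a0 aN.
have -> : (a - m) / a = 1 + - (m / a) by field; rewrite gt_eqF.
apply: le_trans (expR_ge1Dx _) _.
by rewrite ler_expR lerN2 ler_wpM2l// lef_pV2// posrE (lt_le_trans a0).
Qed.

(** At distance [m] past the pivot [J], the square of the next ratio of weights is at most
    [(J + 1) / (J + m + 1)], because [exp (2 u) < J + 1]. Each ratio is thus at most
    [exp (- m / (2 n))], and these exponents add up to [(m ^ 2 - m) / (4 n)]. *)
Lemma wt_up n u m : (pivot n u + m <= n)%N -> (0 < n)%N ->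
  wt u (pivot n u + m) <=
  wt u (pivot n u) * expR (- ((m%:R ^+ 2 - m%:R) / (4 * n%:R))).
Proof.
move=> + n0; set J := pivot n u; elim: m => [|m IH] h.
  by rewrite addn0 expr0n /= subrr mul0r oppr0 expR0 mulr1.
have n0' : 0 < n%:R :> R by rewrite ltr0n.
have Jn : (J < n)%N by lia.
have {}IH := IH (ltnW (leq_trans _ h)); rewrite addnS ltnS leqnn in IH.
have {}IH := IH isT.
have e := wtS u (J + m); rewrite addnS.
have s0 : 0 < Num.sqrt ((J + m).+1%:R : R) by rewrite sqrtr_gt0 ltr0n.
have -> : wt u (J + m).+1 = wt u (J + m) * (expR u / Num.sqrt (J + m).+1%:R).
  by rewrite mulrA -e mulfK// gt_eqF.
have q : expR u / Num.sqrt (J + m).+1%:R <= expR (- (m%:R / (2 * n%:R))).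
  rewrite -ler_sqr; last 2 first.
  - by rewrite nnegrE divr_ge0 ?expR_ge0// ltW.
  - by rewrite nnegrE expR_ge0.
  rewrite exprMn exprVn sqr_sqrtr ?ler0n// -expR2 -expRM_natl.
  have -> : 2%:R * - (m%:R / (2 * n%:R)) = - (m%:R / n%:R) :> R.
    by field; rewrite gt_eqF.
  apply: le_trans (_ : ((J + m).+1%:R - m%:R) / (J + m).+1%:R <= _).
    rewrite ler_wpM2r ?invr_ge0//.
    have := expR_pivot Jn; rewrite -/J -addSn natrD addrK; exact: ltW.
  apply: div_le_expRN => //.
  by rewrite ler_nat; lia.
apply: le_trans (ler_pM (ltW (wt_gt0 _ _)) (divr_ge0 (expR_ge0 u) (ltW s0)) IH q) _.
rewrite -mulrA -expRD ler_wpM2l ?(ltW (wt_gt0 _ _))// ler_expR.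
rewrite -natr1 le_eqVlt; apply/orP; left; apply/eqP.
by field; rewrite gt_eqF.
Qed.

Lemma wt_down n u m : (m <= pivot n u)%N -> (0 < n)%N ->
  wt u (pivot n u - m) <=
  wt u (pivot n u) * expR (- ((m%:R ^+ 2 - m%:R) / (4 * n%:R))).
Proof.
move=> + n0; set J := pivot n u; elim: m => [|m IH] h.
  by rewrite subn0 expr0n /= subrr mul0r oppr0 expR0 mulr1.
have n0' : 0 < n%:R :> R by rewrite ltr0n.
have {}IH := IH (ltnW h).
have Jm : (J - m)%N = (J - m.+1).+1 by lia.
have e := wtS u (J - m.+1); rewrite -Jm in e.
have eu0 := expR_gt0 u.
have -> : wt u (J - m.+1) = wt u (J - m) * (Num.sqrt (J - m)%:R / expR u).
  by rewrite mulrA e mulfK// gt_eqF.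
have q : Num.sqrt (J - m)%:R / expR u <= expR (- (m%:R / (2 * n%:R))).
  rewrite -ler_sqr; last 2 first.
  - by rewrite nnegrE divr_ge0 ?sqrtr_ge0 ?ltW.
  - by rewrite nnegrE expR_ge0.
  rewrite exprMn exprVn sqr_sqrtr ?ler0n// -expR2 -expRM_natl.
  have -> : 2%:R * - (m%:R / (2 * n%:R)) = - (m%:R / n%:R) :> R.
    by field; rewrite gt_eqF.
  have J0 : 0 < J%:R :> R by rewrite ltr0n; lia.
  apply: le_trans (_ : (J%:R - m%:R) / J%:R <= _).
    rewrite natrB ?(ltnW h)// ler_wpM2l//.
      by rewrite subr_ge0 ler_nat ltnW.
    by rewrite lef_pV2 ?posrE ?expR_gt0//; exact: pivot_expR.
  by apply: div_le_expRN => //; rewrite ler_nat pivot_le.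
apply: le_trans (ler_pM (ltW (wt_gt0 _ _)) (divr_ge0 (sqrtr_ge0 _) (ltW eu0)) IH q) _.
rewrite -mulrA -expRD ler_wpM2l ?(ltW (wt_gt0 _ _))// ler_expR.
rewrite -[m.+1%:R]natr1 le_eqVlt; apply/orP; left; apply/eqP.
by field; rewrite gt_eqF.
Qed.

Lemma rho_le n u j : (0 < n)%N -> (j <= n)%N ->
  rho n u j <= expR (- ((pdist n u j ^+ 2 - pdist n u j) / (4 * n%:R))).
Proof.
move=> n0 jn; rewrite /rho ler_pdivrMr ?wt_gt0// mulrC /pdist.
have [h|h] := leqP (pivot n u) j.
  have [m e] : {m | j = (pivot n u + m)%N} by exists (j - pivot n u)%N; lia.
  rewrite e natrD addrAC subrr add0r ger0_norm//.
  by apply: wt_up => //; rewrite -e.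
have [m [e hm]] : {m | j = (pivot n u - m)%N /\ (m <= pivot n u)%N}.
  by exists (pivot n u - j)%N; lia.
rewrite e natrB// addrAC subrr add0r normrN ger0_norm//.
exact: wt_down.
Qed.

(** In the unit [sqrt n] the weights decay like a Gaussian, and completing the square absorbs an
    exponential of rate [a]. Moving [u] by [O(1 / sqrt n)] therefore costs only a constant
    factor. *)
Lemma rho_growth n u j (a : R) : (0 < n)%N -> (j <= n)%N -> 0 <= a ->
  rho n u j * expR (a / Num.sqrt n%:R * pdist n u j) <= expR ((a + 1) ^+ 2).
Proof.
move=> n0 jn a0.
have s1 : 1 <= Num.sqrt (n%:R : R) by rewrite -[leLHS]sqrtr1 ler_sqrt ?ltr0n// ler1n.
set q := Num.sqrt n%:R in s1 *.
have qn : n%:R = q ^+ 2 :> R by rewrite sqr_sqrtr ?ler0n.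
apply: (@le_trans _ _ (expR (- ((pdist n u j ^+ 2 - pdist n u j) / (4 * n%:R))) *
   expR (a / q * pdist n u j))).
  by rewrite ler_wpM2r ?expR_ge0// rho_le.
rewrite -expRD ler_expR.
have p0 : 0 <= pdist n u j by exact: normr_ge0.
set p := pdist n u j in p0 *.
pose y := p / q.
have q0 : q != 0 by rewrite gt_eqF//; lra.
have -> : - ((p ^+ 2 - p) / (4 * n%:R)) + a / q * p =
   - (y ^+ 2 / 4) + y / q / 4 + a * y by rewrite qn /y; field.
have y0 : 0 <= y by rewrite divr_ge0//; lra.
have yq : y / q <= y by rewrite ler_pdivrMr ?ler_peMr//; lra.
have := sqr_ge0 (y / 2 - (a + 1)); nra.
Qed.

Lemma rho_tail n u j (W : R) : (0 < n)%N -> (j <= n)%N -> 2 <= W ->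
  W <= pdist n u j -> rho n u j <= expR (- (W ^+ 2 / (8 * n%:R))).
Proof.
move=> n0 jn W2 Wp; apply: le_trans (rho_le u n0 jn) _.
have n0' : 0 < n%:R :> R by rewrite ltr0n.
rewrite ler_expR lerN2; set p := pdist n u j in Wp *.
have -> : (p ^+ 2 - p) / (4 * n%:R) = (2 * (p ^+ 2 - p)) / (8 * n%:R).
  by field; rewrite gt_eqF.
rewrite ler_wpM2r ?invr_ge0 ?mulr_ge0// ?(ltW n0')//.
nra.
Qed.

(** Through [expsum_le], this sum controls all derivatives of the normalised polynomial near [u]. *)
Definition gbound n x u (a : R) : R :=
  \sum_(j < n.+1) `|x j| * rho n u j * expR (a * pdist n u j).

(** Taking out the positive dominant exponential keeps zeros and signs, and recentres the
    frequencies at the pivot: those that matter are then of order [sqrt n] instead of [n]. *)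
Lemma gw_expsum n x u s :
  gw n x (u + s) = wt u (pivot n u) * expR ((pivot n u)%:R * s) *
  expsum n (fun j => x j * rho n u j) (fun j => j%:R - (pivot n u)%:R) 0 s.
Proof.
rewrite /gw /expsum mulr_sumr; apply: eq_bigr => j _.
rewrite expr0 mulr1 mulrBl expRB /rho /wt mulrDr expRD.
field; rewrite !gt_eqF ?expR_gt0 ?sqrtr_gt0 ?ltr0n ?fact_gt0//.
Qed.

Lemma gh_expsum n x u : gh n x u =
  expsum n (fun j => x j * rho n u j) (fun j => j%:R - (pivot n u)%:R) 0 0.
Proof.
rewrite /gh /expsum; apply: eq_bigr => j _.
by rewrite expr0 mulr1 mulr0 expR0 mulr1.
Qed.

Lemma gboundE n x u (a : R) :
  \sum_(j < n.+1) `|x j * rho n u j| * expR (a * `|j%:R - (pivot n u)%:R|) =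
  gbound n x u a.
Proof.
by apply: eq_bigr => j _; rewrite normrM (ger0_norm (rho_ge0 _ _ _)).
Qed.

Lemma gh_zeros n x u (kap l : R) (s : seq R) : 0 < kap -> 0 <= l -> uniq s ->
  {in s, forall r, u <= r <= u + l /\ gw n x r = 0} ->
  `|gh n x u| <= (l / kap) ^+ size s * gbound n x u (kap + l).
Proof.
move=> k0 l0 us hs; rewrite gh_expsum -gboundE -(size_map (fun r => r - u)).
apply: expsum_zeros => //; first by rewrite map_inj_uniq//; exact: addIr.
move=> _ /mapP[r rs ->]; have [/andP[h1 h2] h] := hs _ rs; split.
  by rewrite subr_ge0 h1 lerBlDl.
have := gw_expsum n x u (r - u); rewrite addrC subrK h => /esym/eqP.
have p := mulr_gt0 (wt_gt0 u (pivot n u)) (expR_gt0 ((pivot n u)%:R * (r - u))).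
by rewrite mulf_eq0 (gt_eqF p) => /eqP.
Qed.

End weights.

(** * Counting zeros *)

Section zero_counting.
Context (R : realType).
Implicit Types (f df : R -> R) (c be x : nat -> R).

Lemma ivt_zero f df (a b : R) : (forall t : R, is_derive t (1 : R) f (df t)) ->
  a <= b -> f a * f b <= 0 -> exists2 t, a <= t <= b & f t = 0.
Proof.
move=> hf ab fab.
have [|t] := @IVT R f a b 0 ab (derivable_within_continuous1 hf).
  rewrite ge_min le_max.
  apply/andP; split; apply/orP.
    have [h|h] := leP (f a) 0; [by left|right].
    by rewrite leNgt; apply/negP => h'; have := mulr_gt0 h h'; lra.
  have [h|h] := leP 0 (f a); [by left|right].
  by rewrite leNgt; apply/negP => h'; have := mulr_gt0 (_ : 0 < - f a) (_ : 0 < - f b); rewrite ?oppr_gt0 mulrNN => /(_ h h'); lra.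
by rewrite in_itv/= => h e; exists t.
Qed.

Lemma mvt_le f df (a b K : R) : (forall t : R, is_derive t (1 : R) f (df t)) ->
  (forall t, a <= t <= b -> `|df t| <= K) ->
  forall t t', a <= t <= b -> a <= t' <= b -> `|f t - f t'| <= K * (b - a).
Proof.
move=> hf hK.
have K0 t : a <= t <= b -> 0 <= K by move=> /hK; apply: le_trans.
suff H t t' : a <= t <= b -> a <= t' <= b -> t <= t' -> `|f t' - f t| <= K * (b - a).
  move=> t t' ht ht'; have [tt'|/ltW tt'] := leP t t'; last exact: H.
  by rewrite distrC; exact: H.
move=> ht ht' tt'.
have drv z : z \in `]t, t'[%R -> is_derive z (1 : R) f (df z) by move=> _.
have [z + ->] := MVT_segment tt' drv (derivable_within_continuous1 hf).
rewrite in_itv/= => /andP[z1 z2].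
rewrite normrM (ger0_norm (_ : 0 <= t' - t)); last by rewrite subr_ge0.
case/andP: ht => ht1 ht2; case/andP: ht' => ht1' ht2'.
apply: ler_pM => //; first by rewrite subr_ge0.
  by apply: hK; rewrite (le_trans ht1 z1) (le_trans z2 ht2').
lra.
Qed.

Section cell.
Variables (n : nat) (c be : nat -> R) (s kap : R).
Let G := expsum n c be 0.
Let B := \sum_(j < n.+1) `|c j| * expR ((kap + s) * `|be j|).
Hypothesis s0 : 0 < s.
Hypothesis kap0 : 0 < kap.
Hypothesis big : s ^+ 2 * (2 * (kap ^+ 2)^-1 * B) < `|G 0|.

Let hd i (t : R) : is_derive t (1 : R) (expsum n c be i) (expsum n c be i.+1 t).
Proof. exact: is_derive_expsum. Qed.

(** Were the derivative to vanish too, two applications of the mean value theorem would bound [G 0]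
    by [s ^+ 2] times the supremum of the second derivative, against [big]. *)
Lemma cell_derive_neq0 r z : 0 <= r <= s -> G r = 0 -> 0 <= z <= s ->
  expsum n c be 1 z != 0.
Proof.
move=> hr Gr hz; apply/eqP => Gz.
have S2 t : 0 <= t <= s -> `|expsum n c be 2 t| <= 2 * (kap ^+ 2)^-1 * B.
  move=> ht; have := @expsum_le R n c be 2 kap s t kap0 ht.
  rewrite ler_pdivrMr ?ltr0n ?fact_gt0// => h; apply: le_trans h _.
  by rewrite le_eqVlt -/B; apply/orP; left; apply/eqP; rewrite (_ : 2`! = 2)%N//; ring.
have S1 t : 0 <= t <= s -> `|expsum n c be 1 t| <= 2 * (kap ^+ 2)^-1 * B * s.
  move=> ht; have := mvt_le (hd 1) S2 ht hz; rewrite Gz !subr0; exact.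
have h0 : (0 : R) <= 0 <= s by rewrite lexx ltW.
have := mvt_le (hd 0) S1 h0 hr; rewrite -/G Gr !subr0 => h.
by move: big; apply/negP; rewrite -leNgt (le_trans h)//; nra.
Qed.

Lemma cell_unique r r' : 0 <= r <= s -> 0 <= r' <= s -> G r = 0 -> G r' = 0 ->
  r = r'.
Proof.
suff H r1 r2 : 0 <= r1 <= s -> 0 <= r2 <= s -> G r1 = 0 -> G r2 = 0 -> r1 < r2 -> False.
  move=> hr hr' Gr Gr'; case: (ltgtP r r') => // h.
    by case: (H _ _ hr hr' Gr Gr' h).
  by case: (H _ _ hr' hr Gr' Gr h).
move=> hr1 hr2 G1 G2 r12.
have drv t : t \in `]r1, r2[%R -> derivable G t 1 by have [] := hd 0 t.
have [z] := Rolle r12 drv (derivable_within_continuous1 (hd 0)) (etrans G1 (esym G2)).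
rewrite in_itv/= => /andP[z1 z2] dz.
have hz : 0 <= z <= s.
  case/andP: hr1 => a1 a2; case/andP: hr2 => a3 a4.
  by rewrite (le_trans a1 (ltW z1)) (le_trans (ltW z2) a4).
apply/negP: (@cell_derive_neq0 r1 z hr1 G1 hz); rewrite negbK; apply/eqP.
by have [_ <-] := hd 0 z; have [_ ->] := dz.
Qed.

(** A zero without a sign change would give mean slopes of opposite signs on its two sides, hence a
    zero of the derivative inside the cell. *)
Lemma cell_sign : G s != 0 -> (exists2 r, 0 <= r <= s & G r = 0) <-> G 0 * G s < 0.
Proof.
move=> Gs; split; last first.
  by move=> h; exact: (ivt_zero (hd 0) (ltW s0) (ltW h)).
move=> [r hr Gr].
have G0 : G 0 != 0.
  rewrite -normr_gt0; apply: le_lt_trans big.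
  rewrite mulr_ge0 ?sqr_ge0// !mulr_ge0 ?invr_ge0 ?exprn_ge0 ?(ltW kap0)//.
  by apply: sumr_ge0 => j _; rewrite mulr_ge0 ?expR_ge0.
rewrite lt_neqAle mulf_neq0//= leNgt; apply/negP => h.
have r0 : 0 < r.
  case/andP: hr => h1 h2; rewrite lt_neqAle h1 andbT.
  by apply: contraNneq G0 => e; move: Gr; rewrite -e => ->.
have rs : r < s.
  case/andP: hr => h1 h2; rewrite lt_neqAle h2 andbT.
  by apply: contraNneq Gs => e; rewrite -e Gr.
have d1 z : z \in `]0, r[%R -> is_derive z (1 : R) G (expsum n c be 1 z) by move=> _; exact: (hd 0).
have d2 z : z \in `]r, s[%R -> is_derive z (1 : R) G (expsum n c be 1 z) by move=> _; exact: (hd 0).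
have [z1 hz1 e1] := MVT r0 d1 (derivable_within_continuous1 (hd 0)).
have [z2 hz2 e2] := MVT rs d2 (derivable_within_continuous1 (hd 0)).
move: hz1 hz2 e1 e2; rewrite !in_itv/= => /andP[a1 a2] /andP[a3 a4].
rewrite Gr sub0r !subr0 => e1 e2.
have z12 : z1 <= z2 by rewrite ltW// (lt_trans a2).
have neg : expsum n c be 1 z1 * expsum n c be 1 z2 <= 0.
  rewrite leNgt; apply/negP => pos.
  have : G 0 * G s = - (expsum n c be 1 z1 * expsum n c be 1 z2 * (r * (s - r))).
    by rewrite e2 -[G 0]opprK e1; ring.
  have : 0 < r * (s - r) by rewrite mulr_gt0// subr_gt0.
  by move=> p1 p2; have := mulr_gt0 pos p1; lra.
have [z /andP[b1 b2] Gz] := ivt_zero (hd 1) z12 neg.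
have := @cell_derive_neq0 r z hr Gr; rewrite Gz eqxx.
have hz : 0 <= z <= s by rewrite (le_trans (ltW a1) b1) (le_trans b2 (ltW a4)).
by move=> /(_ hz).
Qed.

End cell.

(** An infinite zero set counts as 0, as in [num_roots]; additivity over intervals therefore asks
    for finiteness. *)
Definition nz (A : set R) f : nat := #|` fset_set (A `&` [set u | f u = 0])|.

Lemma fset_set_infinite (A : set R) : ~ finite_set A -> fset_set A = fset0.
Proof. by rewrite /fset_set; case: pselect. Qed.

Lemma nz_le (A : set R) f m :
  (forall s : seq R, uniq s -> {in s, forall r, A r /\ f r = 0} -> (size s <= m)%N) ->
  (nz A f <= m)%N.
Proof.
move=> h; rewrite /nz; have [fin|inf] := pselect (finite_set (A `&` [set u | f u = 0])).
  apply: h => [|r]; first exact: fset_uniq.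
  by rewrite in_fset_set// inE.
by rewrite fset_set_infinite// cardfs0.
Qed.

Lemma nz_witness (A : set R) f : exists s : seq R,
  [/\ uniq s, {in s, forall r, A r /\ f r = 0} & size s = nz A f].
Proof.
have [fin|inf] := pselect (finite_set (A `&` [set u | f u = 0])).
  exists (fset_set (A `&` [set u | f u = 0])); split => //.
    exact: fset_uniq.
  by move=> r; rewrite in_fset_set// inE.
by exists [::]; split => //; rewrite /nz fset_set_infinite.
Qed.

Lemma finite_zeros n x : (exists2 j, (j <= n)%N & x j != 0) ->
  finite_set [set u | gw n x u = 0] /\
  (forall s : seq R, uniq s -> {in s, forall r, gw n x r = 0} -> (size s <= n)%N).
Proof.
move=> [j jn xj].
pose p := \poly_(j < n.+1) (x j / Num.sqrt j`!%:R).
have p0 : p != 0.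
  apply/eqP => /polyP/(_ j); rewrite coef_poly ltnS jn coef0 => /eqP.
  by rewrite mulf_eq0 (negbTE xj) invr_eq0 gt_eqF// sqrtr_gt0 ltr0n fact_gt0.
have h (s : seq R) : uniq s -> {in s, forall r, gw n x r = 0} -> (size s <= n)%N.
  move=> us hs; have := @max_poly_roots _ p (map expR s) p0.
  rewrite size_map map_inj_uniq//; last exact: expR_inj.
  have -> : all (root p) (map expR s).
    apply/allP => _ /mapP[r rs ->]; rewrite /root.
    have -> : p.[expR r] = gw n x r.
      rewrite horner_poly /gw; apply: eq_bigr => i _.
      by rewrite /wt mulrA mulrAC -expRM_natl.
    by rewrite hs.
  by move=> /(_ isT us) h; rewrite -ltnS (leq_trans h)// size_poly.
split=> //; apply: contrapT => /(infinite_set_fset n.+1)[B BA Bn].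
have := h B (fset_uniq _) (fun r rB => BA r rB).
by rewrite leqNgt -ltnS ltnS (leq_trans _ Bn).
Qed.

Lemma nz_setU (A B : set R) f : finite_set [set u | f u = 0] ->
  A `&` B = set0 -> nz (A `|` B) f = (nz A f + nz B f)%N.
Proof.
move=> fin AB; rewrite /nz setIUl fset_setU; try exact: finite_setIr.
rewrite cardfsU [X in (_ - X)%N](_ : _ = 0%N) ?subn0//.
apply/eqP; rewrite cardfs_eq0 -fset_setI; try exact: finite_setIr.
by rewrite setIACA AB set0I fset_set0.
Qed.

Lemma nz_itv_cat f (a b c : R) : finite_set [set u | f u = 0] -> a <= b -> b <= c ->
  nz `[a, c[ f = (nz `[a, b[ f + nz `[b, c[ f)%N.
Proof.
move=> fin ab bc; rewrite -nz_setU//; last first.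
  rewrite -subset0 => t /=; rewrite !in_itv/= => -[/andP[_ h1] /andP[h2 _]].
  by have := lt_le_trans h1 h2; rewrite ltxx.
congr nz; apply/seteqP; split => t /=; rewrite !in_itv/=.
  move=> /andP[h1 h2]; have [h|h] := ltP t b; [left|right]; first by rewrite h1.
  by rewrite h2.
move=> [|] /andP[h1 h2]; first by rewrite h1 (lt_le_trans h2).
by rewrite h2 (le_trans ab).
Qed.

Lemma nz_itv_sum f (a h : R) m : finite_set [set u | f u = 0] -> 0 <= h ->
  nz `[a, a + m%:R * h[ f = (\sum_(i < m) nz `[(a + i%:R * h)%R, (a + i.+1%:R * h)%R[ f)%N.
Proof.
move=> fin h0; elim: m => [|m IH].
  rewrite big_ord0 mul0r addr0 set_itvco0 /nz set0I fset_set0 cardfs0//.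
rewrite big_ord_recr /= -IH; apply: nz_itv_cat => //.
  by rewrite lerDl mulr_ge0.
by rewrite lerD2l ler_wpM2r// ler_nat.
Qed.

End zero_counting.

(** * One block: zeros as sign changes on a grid *)

Section blocks.
Context (R : realType).
Variables (n La : nat).
Implicit Types (u v : R) (x : nat -> R).

Definition coef_bounded x := forall j, (j <= n)%N -> `|x j| <= n%:R.

Hypothesis n0 : (0 < n)%N.
Hypothesis La40 : (40 <= La)%N.
Hypothesis nLa : n%:R <= expR La%:R :> R.

Let sq : R := Num.sqrt n%:R.

Lemma La_ge40 : 40 <= La%:R :> R.
Proof. by rewrite ler_nat. Qed.

Lemma sq_ge1 : 1 <= sq.
Proof. by rewrite -[leLHS]sqrtr1 ler_sqrt ?ltr0n// ler1n. Qed.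

Lemma sqE : sq ^+ 2 = n%:R.
Proof. by rewrite sqr_sqrtr ?ler0n. Qed.

Lemma expR1_ge2 : 2 <= expR 1 :> R.
Proof. by apply: le_trans (expR_ge1Dx 1); lra. Qed.

(** The 36 is the constant [(5 + 1) ^+ 2] of [rho_growth]. It is absorbed because
    [2 * La + 37 <= 3 * La]. *)
Lemma poly_bound : (n.+1 * n)%:R * expR 36 <= expR (3 * La%:R) :> R.
Proof.
have L := La_ge40.
have h1 : (n.+1)%:R <= expR (La%:R + 1) :> R.
  rewrite expRD; have := expR1_ge2; rewrite -natr1.
  have : 1 <= expR La%:R :> R by rewrite -[leLHS]expR0 ler_expR.
  by move: nLa; nra.
rewrite natrM; apply: (@le_trans _ _ (expR (La%:R + 1) * expR La%:R * expR 36)).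
  by rewrite ler_wpM2r ?expR_ge0// ler_pM.
by rewrite -!expRD ler_expR; lra.
Qed.

Lemma poly_bound' : (n.+1 * n)%:R <= expR (3 * La%:R) :> R.
Proof.
apply: le_trans poly_bound; rewrite ler_peMr// -[leLHS]expR0 ler_expR; lra.
Qed.

Lemma gbound_le x u (a : R) : coef_bounded x -> 0 <= a -> a <= 5 / sq ->
  gbound n x u a <= expR (3 * La%:R).
Proof.
move=> hx a0 a4; apply: le_trans poly_bound; rewrite /gbound.
apply: (@le_trans _ _ (\sum_(j < n.+1) n%:R * expR 36)).
  apply: ler_sum => j _; rewrite -mulrA; apply: ler_pM => //.
  - by rewrite mulr_ge0 ?rho_ge0 ?expR_ge0.
  - by apply: hx; rewrite -ltnS.
  have jn : (j <= n)%N by rewrite -ltnS.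
  have := @rho_growth R n u j 5 n0 jn (ler0n _ _).
  rewrite (_ : (5 + 1) ^+ 2 = 36 :> R); last by ring.
  apply: le_trans; rewrite ler_wpM2l ?rho_ge0// ler_expR.
  by rewrite ler_wpM2r// normr_ge0.
by rewrite sumr_const card_ord -[leLHS]mulr_natl mulrA -natrM.
Qed.

Lemma expR1_le4 : expR 1 <= 4 :> R.
Proof.
have h : 2^-1 <= expR (- 2^-1) :> R by apply: le_trans (expR_ge1Dx _); lra.
have e : expR 1 * expR (- 2^-1) ^+ 2 = 1 :> R.
  by rewrite -expRM_natl -expRD -[RHS]expR0; congr expR; field.
have : expR 1 * 2^-1 ^+ 2 <= 1 :> R.
  by rewrite -[leRHS]e ler_wpM2l ?expR_ge0// lerXn2r ?nnegrE ?expR_ge0//; lra.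
by rewrite expr2; lra.
Qed.

Lemma nz_block x u (l a : R) (A : set R) : coef_bounded x -> 0 < l ->
  A `<=` [set t | u <= t <= u + l] ->
  gbound n x u (5 * l) <= expR (3 * La%:R) ->
  expR (- a) < `|gh n x u| -> (nz A (gw n x))%:R <= a + 3 * La%:R.
Proof.
move=> hx l0 hA hB ha.
have [s [us hs <-]] := nz_witness A (gw n x).
(* With radius [expR 1 * l] each zero costs a factor [expR (- 1)], and radius plus length is at most
   [5 * l]. *)
have k0 : 0 < expR 1 * l by rewrite mulr_gt0 ?expR_gt0.
have hs' : {in s, forall r, u <= r <= u + l /\ gw n x r = 0}.
  by move=> r /hs[/hA].
have := gh_zeros k0 (ltW l0) us hs'.
rewrite invfM mulrCA divff ?gt_eqF// mulr1 -expRN.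
have -> : expR (- 1) ^+ size s = expR (- (size s)%:R) :> R.
  by rewrite -expRM_natl mulrN1.
move=> h.
have {}hB : gbound n x u (expR 1 * l + l) <= expR (3 * La%:R).
  apply: le_trans hB; apply: ler_sum => j _.
  apply: ler_wpM2l; first by rewrite mulr_ge0 ?rho_ge0.
  rewrite ler_expR; apply: ler_wpM2r; first exact: normr_ge0.
  by have := expR1_le4; nra.
have : expR (- a) < expR (- (size s)%:R) * expR (3 * La%:R) :> R.
  apply: lt_le_trans ha _; apply: le_trans h _.
  by rewrite ler_wpM2l ?expR_ge0.
rewrite -expRD ltr_expR; lra.
Qed.

Definition sign_changes (x : nat -> R) u (s : R) (G : nat) : nat :=
  \sum_(i < G) (gw n x (u + i%:R * s) * gw n x (u + i.+1%:R * s) < 0)%R.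

Lemma nonzero_coef x u : gh n x u != 0 -> exists2 j, (j <= n)%N & x j != 0.
Proof.
move=> h; apply: contrapT => H; move/eqP: h; apply; apply: big1 => j _.
have [->|xj] := eqVneq (x j) 0; first by rewrite mul0r.
by case: H; exists j => //; rewrite -ltnS.
Qed.

(** The cell lemmas at radius [sq^-1]: the inverse square of the radius is the factor [n], and
    [gbound] contributes [expR (3 * La)]. *)
Lemma nz_cell x v (s : R) : coef_bounded x -> 0 < s -> s <= sq^-1 ->
  s ^+ 2 * (2 * n%:R * expR (3 * La%:R)) < `|gh n x v| -> gw n x (v + s) != 0 ->
  nz `[v, (v + s)%R[ (gw n x) = (gw n x v * gw n x (v + s) < 0)%R.
Proof.
move=> hx s0 ssq big gs.
have sq1 := sq_ge1.
pose c j := x j * rho n v j; pose be (j : nat) : R := j%:R - (pivot n v)%:R.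
have k0 : 0 < sq^-1 by rewrite invr_gt0; lra.
have big' : s ^+ 2 * (2 * ((sq^-1) ^+ 2)^-1 *
   \sum_(j < n.+1) `|c j| * expR ((sq^-1 + s) * `|be j|)) < `|expsum n c be 0 0|.
  rewrite gboundE -gh_expsum; apply: le_lt_trans big.
  rewrite ler_wpM2l ?sqr_ge0// exprVn invrK sqE ler_wpM2l ?mulr_ge0//.
  apply: gbound_le => //; first by rewrite addr_ge0// ltW.
  by have : 0 <= sq^-1 by [exact: ltW]; lra.
have gwE t : gw n x (v + t) = 0 <-> expsum n c be 0 t = 0.
  have p := mulr_gt0 (wt_gt0 v (pivot n v)) (expR_gt0 ((pivot n v)%:R * t)).
  rewrite gw_expsum; split=> [/eqP|->]; last by rewrite mulr0.
  by rewrite mulf_eq0 (gt_eqF p) => /eqP.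
have sgn : (gw n x v * gw n x (v + s) < 0) = (expsum n c be 0 0 * expsum n c be 0 s < 0).
  have p := mulr_gt0 (wt_gt0 v (pivot n v)) (expR_gt0 ((pivot n v)%:R * s)).
  have p0 := mulr_gt0 (wt_gt0 v (pivot n v)) (expR_gt0 ((pivot n v)%:R * 0)).
  rewrite -[v in gw n x v]addr0 !gw_expsum -/c -/be.
  by rewrite mulrACA pmulr_rlt0// mulr_gt0.
have es : expsum n c be 0 s != 0 by apply: contraNneq gs => /gwE ->.
have sigP := @cell_sign R n c be s sq^-1 s0 k0 big' es.
rewrite sgn; case: (ltP (expsum n c be 0 0 * expsum n c be 0 s) 0) => hs.
  have [r hr er] := sigP.2 hs.
  rewrite /nz (_ : _ `&` _ = [set v + r]).
    by rewrite fset_set1 cardfs1.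
  apply/seteqP; split => t /=.
    rewrite in_itv/= => -[/andP[t1 t2] gt].
    have et : expsum n c be 0 (t - v) = 0 by apply/gwE; rewrite addrC subrK.
    have ht : 0 <= t - v <= s by apply/andP; split; lra.
    by rewrite (@cell_unique R n c be s sq^-1 s0 k0 big' r (t - v))//; ring.
  move=> ->; rewrite in_itv/=; split; last exact/gwE.
  have rs : r != s by apply: contraNneq es => <-; rewrite er.
  case/andP: hr => r1 r2; have rs' : r < s by rewrite lt_neqAle rs.
  by apply/andP; split; lra.
rewrite /nz (_ : _ `&` _ = set0) ?fset_set0 ?cardfs0//.
rewrite -subset0 => t /=; rewrite in_itv/= => -[/andP[t1 t2] gt].
have et : expsum n c be 0 (t - v) = 0 by apply/gwE; rewrite addrC subrK.
have : expsum n c be 0 0 * expsum n c be 0 s < 0.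
  by apply/sigP; exists (t - v) => //; apply/andP; split; lra.
by rewrite ltNge hs.
Qed.

Lemma nz_sign_changes x u (s : R) (G : nat) : coef_bounded x -> 0 < s -> s <= sq^-1 ->
  (forall i, (i <= G)%N ->
     s ^+ 2 * (2 * n%:R * expR (3 * La%:R)) < `|gh n x (u + i%:R * s)|) ->
  nz `[u, (u + G%:R * s)%R[ (gw n x) = sign_changes x u s G.
Proof.
move=> hx s0 ssq big.
have th0 : 0 <= s ^+ 2 * (2 * n%:R * expR (3 * La%:R)).
  by rewrite mulr_ge0 ?sqr_ge0// mulr_ge0 ?expR_ge0// mulr_ge0.
have gn0 i : (i <= G)%N -> gh n x (u + i%:R * s) != 0.
  by move=> iG; rewrite -normr_gt0 (le_lt_trans th0)// big.
have [fin _] := finite_zeros (nonzero_coef (gn0 0%N (leq0n _))).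
rewrite nz_itv_sum// ?ltW//; apply: eq_bigr => i _.
have e : u + i.+1%:R * s = u + i%:R * s + s by rewrite -natr1; ring.
rewrite e nz_cell//; first by apply: big; exact: ltnW.
by rewrite -e gw_eq0 gn0.
Qed.

(** The discarded terms sum to at most [expR (3 * La - 27 * La)], which is less than the modulus of
    the value. *)
Lemma truncated_sign x (W : pred nat) u :
  coef_bounded x ->
  (forall j, (j <= n)%N -> ~~ W j -> rho n u j <= expR (- (27 * La%:R))) ->
  expR (- (24 * La%:R)) < `|gh n x u| ->
  let x' j := if W j then x j else 0 in
  Num.sg (gw n x' u) = Num.sg (gw n x u).
Proof.
move=> hx hW big x'.
have sgE y : Num.sg (gw n y u) = Num.sg (gh n y u).
  by rewrite ghE sgrM [Num.sg _^-1]gtr0_sg ?mulr1// invr_gt0 wt_gt0.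
rewrite !sgE.
have h : `|gh n x u - gh n x' u| <= expR (- (24 * La%:R)).
  rewrite /gh -sumrB; apply: le_trans (ler_norm_sum _ _ _) _.
  apply: (@le_trans _ _ (\sum_(j < n.+1) n%:R * expR (- (27 * La%:R)))).
    apply: ler_sum => j _; rewrite -mulrBl normrM (ger0_norm (rho_ge0 _ _ _)) /x'.
    have jn : (j <= n)%N by rewrite -ltnS.
    case: ifPn => [_|Wj]; first by rewrite subrr normr0 mul0r mulr_ge0 ?expR_ge0.
    by rewrite subr0; apply: ler_pM; rewrite ?rho_ge0 ?hx// hW.
  rewrite sumr_const card_ord -[leLHS]mulr_natl mulrA -natrM.
  apply: le_trans (_ : expR (3 * La%:R) * expR (- (27 * La%:R)) <= _).
    by rewrite ler_wpM2r ?expR_ge0 ?poly_bound'.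
  by rewrite -expRD ler_expR; lra.
have {h big} : `|gh n x u - gh n x' u| < `|gh n x u| by exact: le_lt_trans big.
case: (ltrgt0P (gh n x u)) => [a0|a0|->].
- by rewrite ltr_norml => /andP[_ h]; rewrite !gtr0_sg//; lra.
- by rewrite ltr_norml => /andP[h _]; rewrite !ltr0_sg//; lra.
- by rewrite ltNge normr_ge0.
Qed.

End blocks.

(** * Windows of indices and the error on one block *)

Section block_errors.
Context (R : realType).
Variables (n La : nat).
Implicit Types (u v : R) (x : nat -> R).
Hypothesis n0 : (0 < n)%N.
Hypothesis La40 : (40 <= La)%N.
Hypothesis nLa : n%:R <= expR La%:R :> R.
Let sq : R := Num.sqrt n%:R.

(** The pivots of the block lie near [exp (2 v)] for [v] in [[u, u + l]]. Of the margin
    [14 * La * sq], one unit [La * sq] pays for the rounding in [pivot]; every excluded index is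
    thus at distance at least [13 * La * sq] from each pivot. *)
Definition win u (l : R) : pred nat := fun j =>
  (expR (2 * u) - 14 * La%:R * sq <= j%:R) &&
  (j%:R <= expR (2 * (u + l)) + 14 * La%:R * sq).

Lemma pivot_itv u : expR (2 * u) <= n%:R ->
  expR (2 * u) - 1 <= (pivot n u)%:R <= expR (2 * u).
Proof.
move=> un; rewrite pivot_expR andbT lerBlDr natr1.
have [h|h] := leqP n (pivot n u); last exact/ltW/expR_pivot.
by apply: (le_trans un); rewrite ler_nat leqW.
Qed.

Lemma La_sq_ge : 40 <= La%:R * sq.
Proof.
have := La_ge40 R La40; have := sq_ge1 R n0; rewrite -/sq; nra.
Qed.

Lemma expR2_mono u v : u <= v -> expR (2 * u) <= expR (2 * v).
Proof. by move=> uv; rewrite ler_expR ler_pM2l. Qed.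

Lemma pivot_win u (l : R) v : u <= v <= u + l -> expR (2 * v) <= n%:R ->
  win u l (pivot n v).
Proof.
move=> /andP[h1 h2] vn; have /andP[h3 h4] := pivot_itv vn.
have := expR2_mono h1; have := expR2_mono h2; have := La_sq_ge.
by rewrite /win => *; apply/andP; split; lra.
Qed.

Lemma rho_off_win u (l : R) v j : u <= v <= u + l -> expR (2 * v) <= n%:R ->
  (j <= n)%N -> ~~ win u l j -> rho n v j <= expR (- (27 * La%:R)).
Proof.
move=> /andP[h1 h2] vn jn hj; have /andP[h3 h4] := pivot_itv vn.
have e1 := expR2_mono h1; have e2 := expR2_mono h2; have L := La_sq_ge.
have hp : 13 * (La%:R * sq) <= pdist n v j.
  move: hj; rewrite /win negb_and -!ltNge => /orP[h|h].
    by rewrite /pdist distrC; apply: le_trans (ler_norm _); lra.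
  by rewrite /pdist; apply: le_trans (ler_norm _); lra.
apply: le_trans (rho_tail n0 jn _ hp) _; first by lra.
rewrite ler_expR lerN2.
have n0' : 0 < n%:R :> R by rewrite ltr0n.
rewrite ler_pdivlMr ?mulr_gt0// !exprMn sqE.
have := La_ge40 R La40; set a : R := La%:R => a40.
rewrite [leRHS](_ : _ = (169 * a ^+ 2) * n%:R); last by ring.
rewrite mulrA ler_wpM2r// ?ltW//; nra.
Qed.

Lemma win_disjoint u v (l : R) j :
  expR (2 * (u + l)) + 28 * La%:R * sq < expR (2 * v) ->
  win u l j -> win v l j -> False.
Proof. by rewrite /win => h /andP[_ h1] /andP[h2 _]; lra. Qed.

Lemma expR_half_ln : expR (2 * (ln n%:R / 2)) = n%:R :> R.
Proof.
have -> : 2 * (ln n%:R / 2) = ln n%:R :> R by field.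
by rewrite lnK// posrE ltr0n.
Qed.

Lemma pivot_outer v : 0 <= v -> pivot n (ln n%:R / 2 + v) = n.
Proof.
move=> v0; rewrite /pivot; apply/minn_idPl.
rewrite truncn_ge_nat ?expR_ge0// mulrDr expRD expR_half_ln.
by rewrite ler_peMr// -[leLHS]expR0 ler_expR mulr_ge0.
Qed.

(** Here [exp u] is [sqrt n * exp v], so a step down from [n] multiplies the weight by at most
    [exp (- v)]: the decay is geometric, with no Gaussian factor needed. *)
Lemma wt_outer v i : (i <= n)%N ->
  wt (ln n%:R / 2 + v) (n - i) <= wt (ln n%:R / 2 + v) n * expR (- (i%:R * v)).
Proof.
set u := ln n%:R / 2 + v; elim: i => [|i IH] h.
  by rewrite subn0 mul0r oppr0 expR0 mulr1.
have {}IH := IH (ltnW h).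
have Ji : (n - i)%N = (n - i.+1).+1 by lia.
have e := wtS u (n - i.+1); rewrite -Ji in e.
have eu0 := expR_gt0 u.
have -> : wt u (n - i.+1) = wt u (n - i) * (Num.sqrt (n - i)%:R / expR u).
  by rewrite mulrA e mulfK// gt_eqF.
have q : Num.sqrt (n - i)%:R / expR u <= expR (- v).
  rewrite ler_pdivrMr// -expRD /u addrC addrK.
  have -> : expR (ln n%:R / 2) = sq.
    by rewrite -[LHS](ger0_norm (expR_ge0 _)) -sqrtr_sqr -expRM_natl expR_half_ln.
  by rewrite ler_sqrt// ler_nat leq_subr.
apply: le_trans (ler_pM (ltW (wt_gt0 _ _)) (divr_ge0 (sqrtr_ge0 _) (ltW eu0)) IH q) _.
rewrite -mulrA -expRD ler_wpM2l ?(ltW (wt_gt0 _ _))// ler_expR.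
by rewrite -[i.+1%:R]natr1; lra.
Qed.

(** The geometric decay of rate [v] cancels an exponential growth of any rate up to [v], so the
    admissible length of an interval grows with its distance from [ln n / 2]. *)
Lemma gbound_outer x v (a : R) : coef_bounded n x -> 0 <= v -> a <= v ->
  gbound n x (ln n%:R / 2 + v) a <= expR (3 * La%:R).
Proof.
move=> hx v0 av; apply: le_trans (poly_bound' La40 nLa).
rewrite /gbound; apply: (@le_trans _ _ (\sum_(j < n.+1) n%:R)); last first.
  by rewrite sumr_const card_ord -[leLHS]mulr_natl -natrM.
apply: ler_sum => j _; have jn : (j <= n)%N by rewrite -ltnS.
rewrite -mulrA -[leRHS]mulr1; apply: ler_pM; [exact: normr_ge0| |exact: hx|].
  by apply: mulr_ge0; [exact: rho_ge0|exact: expR_ge0].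
rewrite /rho /pdist pivot_outer//.
have [i [e ie]] : exists i, j = (n - i)%N :> nat /\ (i <= n)%N.
  by exists (n - j)%N; lia.
have -> : `|j%:R - n%:R| = i%:R :> R.
  by rewrite e natrB// addrAC subrr add0r normrN ger0_norm.
rewrite mulrAC ler_pdivrMr ?wt_gt0// mul1r e.
apply: le_trans (ler_wpM2r (expR_ge0 _) (wt_outer v ie)) _.
rewrite -mulrA -expRD -[leRHS]mulr1 ler_wpM2l ?(ltW (wt_gt0 _ _))//.
rewrite -[leRHS]expR0 ler_expR addrC mulrC -mulrBr.
by rewrite mulr_ge0_le0// subr_le0.
Qed.

(** The integer part of minus the logarithm of the least modulus on the grid, clipped to [[0, n]].
    The cap leaves finitely many levels for a union bound and loses nothing, since a nonzero
    polynomial has at most [n] zeros. *)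
Definition ydeg x u (s : R) (G : nat) : nat :=
  \max_(v < n.+1 | [exists i : 'I_G.+1, `|gh n x (u + i%:R * s)| <= expR (- v%:R)]) v.

(* Below the level [24 La] the sign changes on the grid count the zeros
   exactly. *)
Definition ybad x u (s : R) (G : nat) : nat :=
  if (24 * La <= ydeg x u s G)%N then ydeg x u s G else 0%N.

Lemma ydeg_le x u (s : R) G : (ydeg x u s G <= n)%N.
Proof. by apply/bigmax_leqP => v _; rewrite -ltnS. Qed.

Lemma ydeg_attained x u (s : R) G : (0 < ydeg x u s G)%N ->
  exists i : 'I_G.+1, `|gh n x (u + i%:R * s)| <= expR (- (ydeg x u s G)%:R).
Proof.
have := @eq_bigmax_cond _ [pred v : 'I_n.+1 | [exists i : 'I_G.+1,
   `|gh n x (u + i%:R * s)| <= expR (- v%:R)]] (@nat_of_ord n.+1).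
move=> h y0.
have [|w + yE] := h _.
  by case: posnP => // /card0_eq h0; move: y0; rewrite /ydeg big_pred0.
rewrite inE => /existsP[i hi]; exists i.
by rewrite /ydeg yE.
Qed.

Lemma ydeg_gt x u (s : R) G (v i : nat) : (ydeg x u s G < v)%N -> (v <= n)%N -> (i <= G)%N ->
  expR (- v%:R) < `|gh n x (u + i%:R * s)|.
Proof.
move=> hv vn iG; rewrite ltNge; apply/negP => h.
have vn' : (v < n.+1)%N by rewrite ltnS.
have iG' : (i < G.+1)%N by rewrite ltnS.
have : (Ordinal vn' <= ydeg x u s G)%N.
  apply: (@leq_bigmax_cond _ _ (@nat_of_ord n.+1) (Ordinal vn')).
  by apply/existsP; exists (Ordinal iG').
by rewrite /= leqNgt hv.
Qed.

(* Depends only on the coefficients in [W]: blocks with disjoint windows have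
   independent counts. *)
Definition zcount x (W : pred nat) u (s : R) (G : nat) : nat :=
  minn (27 * La) (sign_changes n (fun j => if W j then x j else 0) u s G).

(** At a level [y >= 24 * La] the zeros number at most [y + 1 + 3 * La] (or [n], if [y = n]) and the
    capped count at most [27 * La]; both are below [2 * y]. Below that level there are at most
    [24 * La + 3 * La] zeros, so the cap is inactive and the two counts agree. *)
Lemma block_error x (W : pred nat) u (s : R) (G : nat) :
  coef_bounded n x -> (exists2 j, (j <= n)%N & x j != 0) ->
  (24 * La < n)%N -> (0 < G)%N ->
  0 < s -> G%:R * s <= sq^-1 ->
  s ^+ 2 * (2 * n%:R * expR (3 * La%:R)) <= expR (- (24 * La%:R)) ->
  (forall i j, (i <= G)%N -> (j <= n)%N -> ~~ W j ->
      rho n (u + i%:R * s) j <= expR (- (27 * La%:R))) ->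
  `|(nz `[u, (u + G%:R * s)%R[ (gw n x))%:R - (zcount x W u s G)%:R| <=
    2 * (ybad x u s G)%:R :> R.
Proof.
move=> hx x0 Lan G0 s0 Gs small hW.
set N := nz _ _; set y := ydeg x u s G.
have l0 : 0 < G%:R * s by rewrite mulr_gt0// ltr0n.
have sub : `[u, (u + G%:R * s)%R[ `<=` [set t | u <= t <= u + G%:R * s].
  by move=> t /=; rewrite in_itv/= => /andP[-> /ltW ->].
have hB : gbound n x u (5 * (G%:R * s)) <= expR (3 * La%:R).
  by apply: gbound_le => //; [rewrite mulr_ge0// ltW|rewrite ler_pM2l].
have Nn : (N <= n)%N.
  have [_ h] := finite_zeros x0; by apply: nz_le => t ut ht; apply: h => // r /ht[].
have ssq : s <= sq^-1.
  by apply: le_trans Gs; rewrite ler_peMl ?ler1n// ltW.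
have Nv (v : nat) : (y < v)%N -> (v <= n)%N -> N%:R <= v%:R + 3 * La%:R :> R.
  move=> yv vn; apply: (nz_block hx l0 sub hB).
  by have := @ydeg_gt x u s G v 0 yv vn (leq0n _); rewrite mul0r addr0.
rewrite /ybad -/y; case: (leqP (24 * La) y) => [yge|ylt].
  have Z27 : (zcount x W u s G <= 27 * La)%N by exact: geq_minl.
  have N2 : N%:R <= 2 * y%:R :> R.
    have [yn|yn] := ltnP y n; last first.
      by rewrite -natrM ler_nat; apply: leq_trans Nn _; lia.
    apply: le_trans (Nv y.+1 (ltnSn _) yn) _.
    rewrite -!natrM -natrD ler_nat; lia.
  have Z2 : (zcount x W u s G)%:R <= 2 * y%:R :> R.
    by rewrite -natrM ler_nat; lia.
  have : 0 <= N%:R :> R by [].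
  have : 0 <= (zcount x W u s G)%:R :> R by [].
  by rewrite ler_norml => *; apply/andP; split; lra.
rewrite mulr0.
have big i : (i <= G)%N -> expR (- (24 * La%:R)) < `|gh n x (u + i%:R * s)|.
  by move=> iG; have := ydeg_gt ylt (ltnW Lan) iG; rewrite natrM.
have NE : N = sign_changes n x u s G.
  rewrite /N; apply: (@nz_sign_changes R n La) => // i iG.
  exact: le_lt_trans small (big i iG).
have scE : sign_changes n (fun j => if W j then x j else 0) u s G =
    sign_changes n x u s G.
  have sgn i : (i <= G)%N -> Num.sg (gw n (fun j => if W j then x j else 0) (u + i%:R * s))
      = Num.sg (gw n x (u + i%:R * s)).
    move=> iG; apply: (@truncated_sign R n La) => //; last exact: big.
    by move=> j jn Wj; exact: hW.
  apply: eq_bigr => i _; congr (nat_of_bool _).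
  have iG : (i <= G)%N by exact: ltnW.
  by rewrite -[LHS]sgr_lt0 -[RHS]sgr_lt0 !sgrM (sgn i iG) (sgn i.+1 (ltn_ord i)).
have N27 : (N <= 27 * La)%N.
  have := Nv (24 * La)%N ylt (ltnW Lan).
  by rewrite -natrM -natrD ler_nat; lia.
by rewrite /zcount scE -NE (minn_idPr N27) subrr normr0.
Qed.

End block_errors.

(** * Independence over disjoint windows *)

Section independent_events.
Context (R : realType) (d : measure_display) (T : measurableType d)
  (P : probability T R) (X : nat -> T -> R).

Lemma coord_sig_pattern J (m : nat) (A : 'I_m -> set T)
    (Q : pred {ffun 'I_m -> bool}) :
  (forall i, coord_sig X J (A i)) ->
  coord_sig X J [set w | Q [ffun i => `[< A i w >]]].
Proof.
move=> hA.
pose B (p : {ffun 'I_m -> bool}) (i : 'I_m) := if p i then A i else ~` A i.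
pose E p := if Q p then [set w | forall i, i \in enum 'I_m -> B p i w] else set0.
rewrite (_ : [set w | _] = \big[setU/set0]_(p : {ffun 'I_m -> bool}) E p).
  apply: (@bigsetU_measurable _ (g_sigma_algebraType (coord_rect X J))) => p _.
  rewrite /E; case: ifP => _; last first.
    exact: (@measurable0 _ (g_sigma_algebraType (coord_rect X J))).
  apply: coord_sig_all => i _; rewrite /B; case: ifP => _; first exact: hA.
  by apply: (@measurableC _ (g_sigma_algebraType (coord_rect X J))); exact: hA.
rewrite -bigcup_seq_cond; apply/seteqP; split => w /=.
  move=> Qw; exists [ffun i => `[< A i w >]].
    by rewrite /= mem_index_enum.
  by rewrite /E Qw => i _; rewrite /B ffunE; case: asboolP.
move=> [p _]; rewrite /E; case: ifP => // Qp h.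
suff -> : [ffun i => `[< A i w >]] = p by [].
apply/ffunP => i; rewrite ffunE; have := h i; rewrite mem_enum /B => /(_ isT).
by case: (p i) => hi; [apply/asboolP|apply/asboolPn].
Qed.

Hypothesis mX : forall j, measurable_fun setT (X j).
Hypothesis iX : indep_seq P X.

Lemma pr_indep_all (I : eqType) (s : seq I) (W : I -> set nat) (A : I -> set T) :
  uniq s -> {in s, forall i, coord_sig X (W i) (A i)} ->
  {in s &, forall i k, i != k -> W i `&` W k = set0} ->
  pr P [set w | forall i, i \in s -> A i w] = \prod_(i <- s) pr P (A i).
Proof.
elim: s => [|i s IH] /=.
  move=> _ _ _; rewrite big_nil (_ : [set w | _] = setT) ?pr_setT//.
  by apply/seteqP; split.
move=> /andP[is' us] hA hW; rewrite big_cons -IH//; last 2 first.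
- by move=> k ks; apply: hA; rewrite inE ks orbT.
- by move=> k k' ks ks'; apply: hW; rewrite inE ?ks ?ks' orbT.
pose J' := [set j | exists2 k, k \in s & W k j].
rewrite (_ : [set w | _] = A i `&` [set w | forall i, i \in s -> A i w]).
  apply: (@pr_coord_sig_indep _ _ _ _ _ mX iX (W i) J').
  - rewrite -subset0 => j [Wj [k ks Wk]].
    have : (W i `&` W k) j by [].
    rewrite hW ?inE ?eqxx ?ks ?orbT//.
    by apply: contraNneq is' => ->.
  - by apply: hA; rewrite mem_head.
  - apply: coord_sig_all => k ks; apply: (@coord_sigS _ _ _ X (W k)).
      by move=> j Wj; exists k.
    by apply: hA; rewrite inE ks orbT.
apply/seteqP; split => w /=.
  move=> H; split; first by apply: H; rewrite mem_head.
  by move=> k ks; apply: H; rewrite in_cons ks orbT.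
by move=> [Ai H] k; rewrite in_cons => /orP[/eqP ->|/H].
Qed.

Lemma pr_partition (Z : T -> nat) (b : nat) :
  (forall w, (Z w <= b)%N) -> (forall v, measurable [set w | Z w = v]) ->
  \sum_(v < b.+1) pr P [set w | Z w = v] = 1.
Proof.
move=> Zb mZ; apply: EFin_inj; rewrite -sumEFin.
under eq_bigr do rewrite prE//.
transitivity (P (\big[setU/set0]_(v < b.+1) [set w | Z w = v])).
  rewrite (@measure_bigsetU _ _ _ P (fun v : nat => [set w | Z w = v]))//.
  by move=> v v' _ _ [w [/= <- <-]].
rewrite -[RHS](@probability_setT _ _ _ P); congr (P _).
apply/seteqP; split => w // _.
rewrite -(bigcup_mkord b.+1 (fun v => [set w | Z w = v])).
by exists (Z w) => //=; rewrite ltnS.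
Qed.

End independent_events.

(** * The estimate at fixed degree *)

Section fixed_degree.
Context (R : realType) (d : measure_display) (T : measurableType d)
  (P : probability T R) (X : nat -> T -> R).
Hypothesis mX : forall j, measurable_fun setT (X j).
Hypothesis iX : indep_seq P X.
Variable K : R.
Hypothesis sb : forall j a b, a <= b ->
  pr P [set w | a <= X j w <= b] <= K * (b - a).
(** The interval [[ln n / 2 - ln C, ln n / 2]] is cut into [Lb * q] blocks: [Lb] classes of [q]
    blocks each, consecutive blocks of a class being [Lb] apart. A block carries [G] cells, and
    [Q + 1] intervals cover the part beyond [ln n / 2]. *)
Variables (n La q Lb G Q : nat) (C tau : R).
Hypothesis n0 : (0 < n)%N.
Hypothesis La40 : (40 <= La)%N.
Hypothesis nLa : n%:R <= expR La%:R :> R.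
Hypothesis Lan : (24 * La < n)%N.
Hypothesis q0 : (0 < q)%N.
Hypothesis Lb0 : (0 < Lb)%N.
Hypothesis C1 : 1 < C.
Let sq : R := Num.sqrt n%:R.
Let l : R := ln C / (Lb * q)%:R.
Hypothesis hl1 : l <= sq^-1.
Hypothesis hl2 : (2 * sq)^-1 <= l.
Hypothesis hLb : 28 * La%:R * C ^+ 2 < Lb%:R - 1.
Hypothesis hG1 : expR (14 * La%:R) <= G%:R :> R.
Hypothesis hG2 : G.+1%:R <= expR (15 * La%:R) :> R.
Hypothesis hq : 24 * K * q%:R <= expR La%:R.
Hypothesis hq1 : q%:R <= expR La%:R :> R.
Hypothesis hQ : ln C * sq <= (6 / 5) ^+ Q.
Hypothesis htau : forall j, pr P [set w | n%:R < `|X j w|] <= tau.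

Let s : R := l / G%:R.
Let umin : R := ln n%:R / 2 - ln C.
Let blk (k : nat) : R := umin + k%:R * l.
Let cls (r i : nat) : nat := (r + i * Lb)%N.
Let x (w : T) : nat -> R := fun j => X j w.
Let pt (k i : nat) : R := blk k + i%:R * s.

Let K0 : 0 <= K.
Proof.
have := sb 0 (@ler01 R); rewrite subr0 mulr1; apply: le_trans; exact: pr_ge0.
Qed.

Let lnC0 : 0 < ln C. Proof. exact: ln_gt0. Qed.
Let l0 : 0 < l.
Proof. by rewrite divr_gt0// ltr0n muln_gt0 Lb0. Qed.
Let sq1 : 1 <= sq. Proof. exact: sq_ge1. Qed.
Let sq_gt0 : 0 < sq. Proof. exact: lt_le_trans ltr01 sq1. Qed.
Let La_40 : 40 <= La%:R :> R. Proof. exact: La_ge40. Qed.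
Let Gr0 : 0 < G%:R :> R.
Proof. exact: lt_le_trans (expR_gt0 _) hG1. Qed.
Let G0 : (0 < G)%N. Proof. by have := Gr0; rewrite ltr0n. Qed.
Let s0 : 0 < s. Proof. by rewrite divr_gt0. Qed.
Let Gs : G%:R * s = l. Proof. by rewrite /s mulrC divfK// gt_eqF. Qed.

Lemma blk_end : blk (Lb * q) = ln n%:R / 2.
Proof.
rewrite /blk /l mulrCA divff ?mulr1 /umin ?subrK//.
by rewrite pnatr_eq0 -lt0n muln_gt0 Lb0.
Qed.

Lemma blk_mono k k' : (k <= k')%N -> blk k <= blk k'.
Proof. by move=> kk; rewrite lerD2l ler_wpM2r ?ler_nat// ltW. Qed.

Lemma blkS k : blk k.+1 = blk k + l.
Proof. by rewrite /blk -natr1; ring. Qed.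

Lemma pt_itv k i : (i <= G)%N -> blk k <= pt k i <= blk k + l.
Proof.
move=> iG; rewrite /pt lerDl mulr_ge0 ?(ltW s0)//= lerD2l -Gs.
by rewrite ler_wpM2r ?ler_nat ?(ltW s0).
Qed.

Lemma pt_le k i : (k < Lb * q)%N -> (i <= G)%N -> expR (2 * pt k i) <= n%:R.
Proof.
move=> kp iG; rewrite -(expR_half_ln R n0) ler_expR ler_pM2l//.
have /andP[_ h] := pt_itv k iG; apply: le_trans h _.
by rewrite -blkS -blk_end; exact: blk_mono.
Qed.

(** The origin of the 14 in [hG1]: squaring the mesh gains [exp (- 28 La)], which pays for the
    derivative bound [exp (3 La)], the factor 2 and the level [exp (- 24 La)]. *)
Lemma small_step : s ^+ 2 * (2 * n%:R * expR (3 * La%:R)) <= expR (- (24 * La%:R)).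
Proof.
have L40 := La_40.
have h : s ^+ 2 * n%:R <= (G%:R ^+ 2)^-1.
  rewrite /s expr_div_n mulrAC ler_pdivrMr ?exprn_gt0// mulVf; last first.
    by rewrite gt_eqF// exprn_gt0.
  have : l ^+ 2 <= (sq^-1) ^+ 2 by rewrite ler_sqr ?nnegrE ?invr_ge0 ?(ltW l0)// ltW.
  rewrite exprVn (sqE R n) => h; have := ler_wpM2r (ler0n R n) h.
  by rewrite mulVf// pnatr_eq0 -lt0n.
have hG : (G%:R ^+ 2)^-1 <= expR (- (28 * La%:R)) :> R.
  rewrite expRN lef_pV2 ?posrE ?expR_gt0 ?exprn_gt0//.
  apply: le_trans (_ : expR (14 * La%:R) ^+ 2 <= _).
    by rewrite -expRM_natl ler_expR; lra.
  by rewrite ler_sqr ?nnegrE ?expR_ge0// ltW.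
rewrite (_ : s ^+ 2 * _ = 2 * (s ^+ 2 * n%:R) * expR (3 * La%:R)); last by ring.
apply: le_trans (_ : expR 1 * expR (- (28 * La%:R)) * expR (3 * La%:R) <= _).
  rewrite ler_wpM2r ?expR_ge0// ler_pM ?expR1_ge2//.
    by rewrite mulr_ge0 ?sqr_ge0.
  exact: le_trans h hG.
by rewrite -!expRD ler_expR; lra.
Qed.

(** On this range [exp (2 u)] is at least [n / C ^ 2], and the blocks are at least
    [(Lb - 1) / (2 sqrt n)] apart. The pivots thus differ by at least [sqrt n * (Lb - 1) / C ^ 2],
    which by [hLb] exceeds twice the margin of a window. *)
Lemma win_class k k' j : (k + Lb <= k')%N ->
  win n La (blk k) l j -> win n La (blk k') l j -> False.
Proof.
move=> kk; apply: win_disjoint.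
set b := blk k + l.
have hb : blk k' - b = (k'%:R - k%:R - 1) * l by rewrite /b /blk; ring.
have hk : Lb%:R - 1 <= k'%:R - k%:R - 1 :> R.
  by rewrite lerD2r lerBrDl -natrD ler_nat.
have hb1 : (Lb%:R - 1) * l <= blk k' - b by rewrite hb ler_wpM2r// ltW.
have C0 : 0 < C by exact: lt_trans ltr01 C1.
have e1 : n%:R / C ^+ 2 <= expR (2 * b).
  have -> : n%:R / C ^+ 2 = expR (2 * umin).
    rewrite /umin mulrBr expRB expR_half_ln//; congr (_ / _).
    by rewrite expRM_natl lnK.
  rewrite ler_expR ler_pM2l// /b /blk -addrA lerDl addr_ge0 ?(ltW l0)//.
  by rewrite mulr_ge0// ltW.
have e2 : expR (2 * b) * (1 + 2 * (blk k' - b)) <= expR (2 * blk k').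
  rewrite (_ : 2 * blk k' = 2 * b + 2 * (blk k' - b)); last by ring.
  by rewrite expRD ler_wpM2l ?expR_ge0// expR_ge1Dx.
have L0 : 0 < Lb%:R - 1 :> R.
  by apply: le_lt_trans hLb; rewrite mulr_ge0 ?sqr_ge0// mulr_ge0.
have l2 : sq^-1 <= 2 * l.
  by have := hl2; rewrite invfM; lra.
have e3 : (Lb%:R - 1) / sq <= 2 * (blk k' - b).
  apply: le_trans (_ : (Lb%:R - 1) * (2 * l) <= _); last by lra.
  by rewrite ler_wpM2l// ltW.
have e4 : 28 * La%:R * sq < n%:R / C ^+ 2 * ((Lb%:R - 1) / sq).
  have -> : n%:R / C ^+ 2 * ((Lb%:R - 1) / sq) = sq * (Lb%:R - 1) / C ^+ 2.
    by rewrite -(sqE R n) -/sq; field; rewrite !gt_eqF.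
  rewrite ltr_pdivlMr ?exprn_gt0//.
  have -> : 28 * La%:R * sq * C ^+ 2 = sq * (28 * La%:R * C ^+ 2) by ring.
  by rewrite ltr_pM2l.
have e5 : n%:R / C ^+ 2 * ((Lb%:R - 1) / sq) <= expR (2 * b) * (2 * (blk k' - b)).
  apply: ler_pM => //; first by rewrite divr_ge0// sqr_ge0.
  by rewrite divr_ge0 ?(ltW L0)// ltW.
have e6 := lt_le_trans e4 e5.
rewrite mulrDr mulr1 in e2.
by apply: lt_le_trans e2; rewrite ltrD2l.
Qed.

Lemma cls_lt r i : (r < Lb)%N -> (i < q)%N -> (cls r i < Lb * q)%N.
Proof.
move=> rL iq; rewrite /cls [X in (_ < X)%N]mulnC.
by apply: (@leq_trans (i.+1 * Lb)); [rewrite mulSn ltn_add2r|rewrite leq_mul2r iq orbT].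
Qed.

Lemma cls_step r i i' : (i < i')%N -> (cls r i + Lb <= cls r i')%N.
Proof.
move=> ii; rewrite /cls -addnA leq_add2l addnC -mulSn.
by rewrite leq_mul2r ii orbT.
Qed.

Lemma win_disj r (i i' : 'I_q) : i != i' ->
  [set j | win n La (blk (cls r i)) l j] `&`
  [set j | win n La (blk (cls r i')) l j] = set0.
Proof.
move=> ii; rewrite -subset0 => j [h h'].
have [h1|h1|/val_inj e] := ltngtP i i'.
- exact: (win_class (cls_step r h1) h h').
- exact: (win_class (cls_step r h1) h' h).
- by rewrite e eqxx in ii.
Qed.

Lemma gh_lin w u : gh n (x w) u = lin_form X n (rho n u) w.
Proof. by rewrite /gh /lin_form; apply: eq_bigr => j _; rewrite mulrC. Qed.

(** In the columns of the pivots the forms have diagonal 1 and, the windows being disjoint,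
    off-diagonal entries at most [exp (- 27 La)]. The 12 of [joint_small_ball] becomes 24 because
    the accumulated factor [(1 + (2 * q)^-1) ^+ size ss] is at most 2. *)
Lemma joint_small_gh r (S : pred 'I_q) (g : 'I_q -> 'I_G.+1) (t : 'I_q -> R) :
  (r < Lb)%N -> (forall i, 0 < t i) ->
  pr P [set w | forall i, S i -> `|gh n (x w) (pt (cls r i) (g i))| <= t i] <=
  \prod_(i | S i) (24 * K * t i).
Proof.
move=> rL t0.
pose leT := fun i k : 'I_q => t i <= t k.
pose ss := sort leT (enum S).
have memss i : (i \in ss) = S i by rewrite mem_sort mem_enum.
have sz : (size ss <= q)%N.
  by rewrite size_sort -cardE -[leqRHS](card_ord q) max_card.
pose u (i : 'I_q) := pt (cls r i) (g i).
pose eta := expR (- (27 * La%:R)) : R.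
have gG (i : 'I_q) : (g i <= G)%N by rewrite -ltnS.
have q1 : 1 <= q%:R :> R by rewrite ler1n.
have eta0 : 0 <= eta by exact: expR_ge0.
have L40 := La_40.
have szr : (size ss)%:R <= q%:R :> R by rewrite ler_nat.
have eta1 : 8 * q%:R ^+ 2 * eta <= 1.
  have h : q%:R ^+ 2 <= expR (2 * La%:R) :> R.
    by rewrite expRM_natl lerXn2r ?nnegrE ?expR_ge0.
  have h8 : 8 <= expR 8 :> R by apply: le_trans (expR_ge1Dx _); lra.
  apply: (@le_trans _ _ (expR 8 * expR (2 * La%:R) * eta)).
    by rewrite ler_wpM2r// ler_pM// exprn_ge0.
  by rewrite /eta -!expRD -[leRHS]expR0 ler_expR; lra.
have th0 : 0 <= 1 + (2 * q%:R)^-1 :> R by rewrite addr_ge0// invr_ge0 mulr_ge0.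
have wpiv (i : 'I_q) : win n La (blk (cls r i)) l (pivot n (u i)).
  by apply: pivot_win => //; [exact: pt_itv|apply: pt_le => //; exact: cls_lt].
apply: (@le_trans _ _ (\prod_(i <- ss) (24 * K * t i))); last first.
  by rewrite (perm_big (enum S)) ?perm_sort// big_enum_cond/=
    le_eqVlt; apply/orP; left; apply/eqP; apply: eq_bigl => i; rewrite andbT.
apply: (@le_trans _ _ (\prod_(k <- ss)
    (12 * K * (1 + (2 * q%:R)^-1) ^+ size ss * t k))); last first.
  apply: ler_prod => i _; apply/andP; split.
    apply: mulr_ge0; last exact: ltW.
    by apply: mulr_ge0; [exact: mulr_ge0|exact: exprn_ge0].
  rewrite ler_wpM2r ?(ltW (t0 _))//.
  have h : (1 + (2 * q%:R)^-1) ^+ size ss <= 2 :> R.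
    apply: (@le_trans _ _ (expR ((2 * q%:R)^-1) ^+ size ss)).
      by rewrite lerXn2r ?nnegrE ?expR_ge0 ?expR_ge1Dx.
    rewrite -expRM_natl; apply: (@le_trans _ _ (expR 2^-1)).
      rewrite ler_expR invfM mulrCA -[leRHS]mulr1 ler_wpM2l// ler_pdivrMr//; lra.
    by apply: le_trans (expR_le_quad _) _; lra.
  have : 0 <= 12 * K by rewrite mulr_ge0.
  by move=> h12; have := ler_wpM2l h12 h; lra.
apply: (le_trans (pr_le P (B := [set w | forall k, k \in ss ->
    `|lin_form X n (rho n (u k)) w| <= t k]) _)).
  by move=> w /= h k; rewrite memss => Sk; rewrite -gh_lin; exact: h.
apply: (@joint_small_ball R d T P X mX iX K sb n q eta _ (fun k => pivot n (u k))) => //.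
- by rewrite sort_uniq enum_uniq.
- by apply: sort_sorted => a b; exact: le_total.
- by move=> k _; exact: pivot_le.
- move=> k _; rewrite rho_pivot normr1.
  have : (size ss)%:R * eta <= q%:R * eta by rewrite ler_wpM2r.
  have : q%:R * eta <= q%:R ^+ 2 * eta by rewrite ler_wpM2r// expr2 ler_peMr//; lra.
  by move: eta1; lra.
- move=> k k' _ _ kk.
  rewrite ger0_norm ?rho_ge0//.
  apply: (@le_trans _ _ eta); last first.
    by rewrite ler_peMl//; lra.
  apply: (rho_off_win n0 La40 (u := blk (cls r k)) (l := l)).
  - exact: pt_itv.
  - by apply: pt_le => //; exact: cls_lt.
  - exact: pivot_le.
  - apply/negP => h.
    have : ([set j | win n La (blk (cls r k)) l j] `&`
      [set j | win n La (blk (cls r k')) l j]) (pivot n (u k')).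
      by split => //; exact: wpiv.
    by rewrite win_disj.
Qed.

Let ycount (r i : nat) (w : T) : nat := ybad n La (x w) (blk (cls r i)) s G.

(** A majorant, not a probability law: level 0 imposes nothing, levels strictly between 0 and
    [24 * La] never occur for [ybad], and a higher level pays for the union over the [G + 1] grid
    points. *)
Let cy (v : nat) : R := if v == 0%N then 1 else
  if (24 * La <= v)%N then G.+1%:R * (24 * K * expR (- v%:R)) else 0.

Let cy_ge0 v : 0 <= cy v.
Proof.
rewrite /cy; case: ifP => // _; case: ifP => // _.
by rewrite mulr_ge0// mulr_ge0 ?expR_ge0// mulr_ge0.
Qed.

Lemma ycount_joint r (v : {ffun 'I_q -> 'I_n.+1}) : (r < Lb)%N ->
  pr P [set w | forall i : 'I_q, ycount r i w = v i] <= \prod_i cy (v i).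
Proof.
move=> rL.
have [/forallP hv|] := boolP [forall i, (v i == 0%N :> nat) || (24 * La <= v i)%N]; last first.
  rewrite negb_forall => /existsP[i]; rewrite negb_or => /andP[v0 vL].
  rewrite (_ : [set w | _] = set0) ?pr_set0 ?prodr_ge0//.
  rewrite -subset0 => w /= h; have := h i; rewrite /ycount /ybad.
  by case: ifPn => [yL e|_ e]; [move: vL; rewrite -e yL|move: v0; rewrite -e].
pose S := fun i : 'I_q => v i != 0%N :> nat.
(* One grid point is chosen for each constrained block. Freezing the choice elsewhere makes the
   number of choices a power of [G + 1] that factors into the weights [cy]. *)
pose F := pfamily (ord0 : 'I_G.+1) S (fun=> predT).
pose A (g : {ffun 'I_q -> 'I_G.+1}) := [set w | forall i : 'I_q, S i ->
   `|gh n (x w) (pt (cls r i) (g i))| <= expR (- (v i)%:R)].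
apply: (@le_trans _ _ (\sum_(g in F) pr P (A g))).
  apply: le_trans (pr_exists _ _ _); apply: pr_le => w /= h.
  have hg i : exists k : 'I_G.+1, S i ->
      `|gh n (x w) (pt (cls r i) k)| <= expR (- (v i)%:R).
    have [Si|] := boolP (S i); last by exists ord0.
    have := h i; rewrite /ycount /ybad; case: ifP => [yL e|_ e]; last first.
      by move: Si; rewrite /S -e.
    have y0 : (0 < ydeg n (x w) (blk (cls r i)) s G)%N by rewrite e lt0n.
    by have [k hk] := ydeg_attained y0; exists k => _; rewrite -e.
  have [gf hgf] := choice hg.
  pose g := [ffun i : 'I_q => if S i then gf i else ord0].
  exists g.
    apply/pfamilyP; split => //; apply/fintype.subsetP => i.
    by rewrite inE /g ffunE -topredE /=; case: ifP => //; rewrite eqxx.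
  by move=> i Si; rewrite /g ffunE Si; exact: hgf.
apply: (@le_trans _ _ (\sum_(g in F) \prod_(i | S i) (24 * K * expR (- (v i)%:R)))).
  by apply: ler_sum => g _; apply: joint_small_gh => // i; exact: expR_gt0.
rewrite -(big_distr_big_dep ord0 S (fun=> predT)
   (fun i _ => 24 * K * expR (- (v i)%:R))).
rewrite big_mkcond /=; apply: ler_prod => i _; rewrite /S /cy.
case: ifPn => [v0|].
  rewrite (negbTE v0); have := hv i; rewrite (negbTE v0) /= => ->.
  rewrite sumr_const card_ord -[_ *+ G.+1]mulr_natl lexx andbT.
  by rewrite mulr_ge0// mulr_ge0 ?expR_ge0// mulr_ge0.
by rewrite negbK => ->; rewrite ler01 lexx.
Qed.

Let n1_le : n.+1%:R <= expR (2 * La%:R) :> R.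
Proof.
have L40 := La_40.
apply: (@le_trans _ _ (expR 1 * expR La%:R)).
  have h := expR1_ge2 R; have h1 : 1 <= n%:R :> R by rewrite ler1n.
  have e0 := expR_ge0 (La%:R : R); rewrite -natr1; move: nLa => nL.
  have := ler_wpM2r e0 h; lra.
by rewrite -expRD ler_expR; lra.
Qed.

(** For [v >= 24 * La] the tilt by [v / 4] still leaves [exp (- 18 La)]. Against it stand
    [exp (15 La)] for the grid, [exp (2 La)] for the levels and [exp La] for [24 * K * q]. The
    excess [q^-1] keeps the product over the [q] blocks below [exp 1]. *)
Lemma ycount_mgf : \sum_(v < n.+1) cy v * expR (v%:R / 4) <= 1 + q%:R^-1.
Proof.
have L40 := La_40.
rewrite big_ord_recl /= {1}/cy eqxx mul1r mul0r expR0 lerD2l.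
pose B := G.+1%:R * (24 * K * expR (- (18 * La%:R))) : R.
have B0 : 0 <= B by rewrite mulr_ge0// mulr_ge0 ?expR_ge0// mulr_ge0.
apply: (@le_trans _ _ (\sum_(i < n) B)).
  apply: ler_sum => i _; rewrite /cy /=; case: ifP => [vL|]; last by rewrite mul0r.
  rewrite -mulrA ler_wpM2l// -mulrA ler_wpM2l ?mulr_ge0//.
  rewrite -expRD ler_expR.
  have : 24 * La%:R <= (bump 0 i)%:R :> R by rewrite -natrM ler_nat.
  by set z := (bump 0 i)%:R; lra.
rewrite sumr_const card_ord -[_ *+ n]mulr_natl.
have q0' : 0 < q%:R :> R by rewrite ltr0n.
rewrite -[leRHS]mul1r ler_pdivlMr//.
apply: (@le_trans _ _ (expR (2 * La%:R) * (expR (15 * La%:R) *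
   (24 * K * expR (- (18 * La%:R)))) * q%:R)).
  rewrite ler_wpM2r// ler_pM//.
    by apply: le_trans n1_le; rewrite ler_nat.
  by rewrite ler_wpM2r// mulr_ge0 ?expR_ge0// mulr_ge0.
rewrite (_ : _ * q%:R = expR (2 * La%:R) * expR (15 * La%:R) *
   expR (- (18 * La%:R)) * (24 * K * q%:R)); last by ring.
rewrite -!expRD (_ : _ + _ = - La%:R); last by ring.
apply: (@le_trans _ _ (expR (- La%:R) * expR La%:R)).
  by rewrite ler_wpM2l ?expR_ge0.
by rewrite -expRD addrC subrr expR0.
Qed.

Lemma ycount_tail r (M : R) : (r < Lb)%N ->
  pr P [set w | M <= \sum_(i < q) (ycount r i w)%:R] <= 4 * expR (- (M / 4)).
Proof.
move=> rL.
apply: le_trans (_ : pr P [set w | M / 4 <= \sum_(i < q) (ycount r i w)%:R / 4] <= _).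
  by apply: pr_le => w /=; rewrite -mulr_suml ler_pM2r ?invr_gt0.
apply: le_trans (@discrete_chernoff R d T P q n (fun i => ycount r i)
  (fun=> cy) (fun _ v => v%:R / 4) (M / 4) _ _ _) _ => //.
- move=> i w; rewrite /ycount /ybad; case: ifP => // _; exact: ydeg_le.
- by move=> v; exact: ycount_joint.
rewrite mulrC ler_wpM2r ?expR_ge0//.
apply: (@le_trans _ _ (\prod_(i < q) (1 + q%:R^-1))).
  apply: ler_prod => i _; rewrite ycount_mgf andbT.
  by apply: sumr_ge0 => v _; rewrite mulr_ge0 ?expR_ge0.
rewrite prodr_const card_ord; apply: le_trans (expR1_le4 R).
apply: (@le_trans _ _ (expR (q%:R^-1) ^+ q)).
  by rewrite lerXn2r ?nnegrE ?expR_ge0 ?expR_ge1Dx// addr_ge0// invr_ge0.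
by rewrite -expRM_natl mulfV// pnatr_eq0 -lt0n.
Qed.

Let zc (r i : nat) (w : T) : nat :=
  zcount n La (x w) (win n La (blk (cls r i)) l) (blk (cls r i)) s G.

Let mu (r i : nat) : R :=
  \sum_(v < (27 * La).+1) pr P [set w | zc r i w = v] * v%:R.

Lemma zc_le r i w : (zc r i w <= 27 * La)%N.
Proof. exact: geq_minl. Qed.

Lemma zc_coord_sig r i v :
  coord_sig X [set j | win n La (blk (cls r i)) l j] [set w | zc r i w = v].
Proof.
set W := win _ _ _ _; set b := blk (cls r i).
pose gx w u := gw n (fun j => if W j then x w j else 0) u.
pose A (k : 'I_G) := [set w | gx w (b + k%:R * s) * gx w (b + k.+1%:R * s) < 0].
have hgx u : coord_fun X [set j | W j] (fun w => gx w u).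
  have -> : (fun w => gx w u) = lin_form X n (fun j => if W j then wt u j else 0).
    apply/funext => w; rewrite /gx /gw /lin_form; apply: eq_bigr => j _.
    by case: ifP => _; rewrite ?mul0r// mulrC.
  by apply: coord_fun_lin => j /=; case: ifP.
have hA k : coord_sig X [set j | W j] (A k).
  rewrite (_ : A k = (fun w => gx w (b + k%:R * s) * gx w (b + k.+1%:R * s)) @^-1`
     `]-oo, 0[%classic).
    apply: coord_fun_preimage => //.
    by apply: measurable_funM; exact: hgx.
  by apply/seteqP; split => w; rewrite /A /= in_itv.
pose QQ (p : {ffun 'I_G -> bool}) := minn (27 * La) (\sum_(k < G) p k) == v.
rewrite (_ : [set w | _] = [set w | QQ [ffun k => `[< A k w >]]]).
  exact: coord_sig_pattern.
have e w : zc r i w = minn (27 * La) (\sum_(k < G) [ffun k => `[< A k w >]] k).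
  rewrite /zc /zcount; congr minn; apply: eq_bigr => k _; rewrite ffunE.
  by congr nat_of_bool; apply/idP/asboolP.
by apply/seteqP; split => w /=; rewrite e /QQ; [move/eqP|move/eqP].
Qed.

Lemma zc_tail r (la M : R) : (r < Lb)%N -> 0 <= la -> la * (27 * La)%:R <= 2^-1 ->
  pr P [set w | M <= `|\sum_(i < q) ((zc r i w)%:R - mu r i)|] <=
  2 * expR (- (la * M) + q%:R * (2 * la ^+ 2 * (27 * La)%:R ^+ 2)).
Proof.
move=> rL la0 la1.
apply: (@hoeffding R d T P q (27 * La) (fun i => zc r i)) => //.
- by move=> i w; exact: zc_le.
- move=> i; apply: pr_partition; first exact: zc_le.
  move=> v; have h := @zc_coord_sig r i v; have := coord_sig_measurable mX h; exact.
- move=> v.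
  have := @pr_indep_all R d T P X mX iX _ (enum 'I_q)
     (fun i : 'I_q => [set j | win n La (blk (cls r i)) l j])
     (fun i : 'I_q => [set w | zc r i w = v i]) (enum_uniq _) _ _.
  rewrite big_enum /= => <-.
  + by apply: pr_le => w /= h i _; exact: h.
  + by move=> i _; exact: zc_coord_sig.
  + by move=> i i' _ _ ii; exact: win_disj.
Qed.

(** A single form, with [N = 1] and [eta = 0]: the 18 is [12 * (1 + 1/2)]. *)
Lemma one_point u (t : R) : 0 < t -> pr P [set w | `|gh n (x w) u| <= t] <= 18 * K * t.
Proof.
move=> t0.
have := @joint_small_ball R d T P X mX iX K sb n 1 0 _ (fun=> pivot n u) [:: tt]
  (fun=> rho n u) (fun=> t).
rewrite big_seq1 /= expr1 mulr1 => h.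
apply: (@le_trans _ _ (12 * K * (1 + 2^-1) * t)); last by lra.
apply: (@le_trans _ _ (pr P [set w | forall k, k \in [:: tt] ->
    `|lin_form X n (rho n u) w| <= t])).
  by apply: pr_le => w /= hw k _; rewrite -gh_lin.
apply: h => //.
- by move=> k _; exact: pivot_le.
- by move=> k _; rewrite rho_pivot normr1 mulr0 addr0 invf_le1// ler1n.
Qed.

(* Beyond [ln n / 2] the polynomial is governed by its leading term, and
   intervals of geometrically growing length suffice. *)
Let opt (a : nat) : R :=
  ln n%:R / 2 + (if a is a'.+1 then (6 / 5) ^+ a' / sq else 0).

(** One fifth of the distance from [ln n / 2], because [nz_block] needs [gbound] at five times the
    length and [gbound_outer] allows a rate up to the distance; hence the ratio 6/5. The first
    interval has the length [sq^-1] that [gbound_le] permits. *)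
Let olen (a : nat) : R := if a is a'.+1 then (6 / 5) ^+ a' / sq / 5 else sq^-1.

Let optS a : opt a.+1 = opt a + olen a.
Proof.
rewrite /opt /olen; case: a => [|a]; first by rewrite expr0 mul1r addr0.
by rewrite exprS; field; rewrite gt_eqF.
Qed.

Let olen_gt0 a : 0 < olen a.
Proof.
rewrite /olen; case: a => [|a]; first by rewrite invr_gt0.
by rewrite !divr_gt0// exprn_gt0// divr_gt0.
Qed.

Lemma nz_ccU (f : R -> R) (a b c : R) : finite_set [set u | f u = 0] ->
  (nz `[a, c] f <= nz `[a, b] f + nz `[b, c] f)%N.
Proof.
move=> fin; rewrite /nz.
pose FA := fset_set (`[a, b] `&` [set u | f u = 0]).
pose FB := fset_set (`[b, c] `&` [set u | f u = 0]).
apply: (@leq_trans #|` (FA `|` FB)%fset|).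
  rewrite /FA /FB.
  apply: fsubset_leq_card; rewrite -fset_setU; try exact: finite_setIr.
  rewrite -fset_set_sub; try exact: finite_setIr; last first.
    by rewrite finite_setU; split; exact: finite_setIr.
  move=> t [/=]; rewrite in_itv/= => /andP[t1 t2] ft.
  have [tb|tb] := leP t b; [left|right]; split => //=; rewrite in_itv/=.
    by rewrite t1.
  by rewrite (ltW tb).
by rewrite cardfsU leq_subr.
Qed.

Lemma outer_sum (f : R -> R) m : finite_set [set u | f u = 0] ->
  (nz `[opt 0, opt m.+1] f <= \sum_(a < m.+1) nz `[opt a, (opt a + olen a)%R] f)%N.
Proof.
move=> fin; elim: m => [|m IH].
  by rewrite big_ord_recr big_ord0 /= add0n optS.
rewrite big_ord_recr /=.
apply: leq_trans (nz_ccU _ (opt m.+1) _ fin) _.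
by rewrite leq_add// [opt m.+2]optS.
Qed.

Lemma outer_block w a (Mo : R) : coef_bounded n (x w) ->
  expR (- Mo) < `|gh n (x w) (opt a)| ->
  (nz `[opt a, opt a + olen a] (gw n (x w)))%:R <= Mo + 3 * La%:R.
Proof.
move=> hx h; apply: (nz_block hx (olen_gt0 a) _ _ h).
  by move=> t /=; rewrite in_itv.
rewrite /opt /olen; case: a h => [|a] h.
  apply: gbound_le => //; first by rewrite mulr_ge0// invr_ge0 ltW.
apply: gbound_outer => //.
  by rewrite divr_ge0 ?(ltW sq_gt0)// exprn_ge0// divr_ge0.
by rewrite le_eqVlt; apply/orP; left; apply/eqP; field; rewrite gt_eqF.
Qed.

Lemma sum_classes (F : nat -> R) :
  \sum_(k < Lb * q) F k = \sum_(r < Lb) \sum_(i < q) F (cls r i).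
Proof.
rewrite exchange_big /= mulnC.
elim: q => [|m IH]; first by rewrite !big_ord0.
rewrite big_ord_recr /= -IH mulSn addnC big_split_ord /=; congr (_ + _).
by apply: eq_bigr => r _; rewrite /cls addnC.
Qed.

Let mtot : R := \sum_(r < Lb) \sum_(i < q) mu r i.

Lemma mtot_ge0 : 0 <= mtot.
Proof.
apply: sumr_ge0 => r _; apply: sumr_ge0 => i _; apply: sumr_ge0 => v _.
by rewrite mulr_ge0 ?pr_ge0.
Qed.

Lemma mtot_le : mtot <= (Lb * q * (27 * La))%:R.
Proof.
apply: (@le_trans _ _ (\sum_(r < Lb) \sum_(i < q) (27 * La)%:R)); last first.
  by rewrite !sumr_const !card_ord -!mulrnA ler_nat [leqRHS]mulnC [(Lb * q)%N]mulnC !mulnA.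
apply: ler_sum => r _; apply: ler_sum => i _.
rewrite /mu; apply: (@le_trans _ _ (\sum_(v < (27 * La).+1)
    pr P [set w | zc r i w = v] * (27 * La)%:R)).
  apply: ler_sum => v _; apply: ler_wpM2l; first exact: pr_ge0.
  by rewrite ler_nat -ltnS.
rewrite -mulr_suml (pr_partition P (@zc_le r i)) ?mul1r// => v.
have h := @zc_coord_sig r i v; have := coord_sig_measurable mX h; exact.
Qed.

Let Ntot (w : T) : R := (nz `[umin, (ln n%:R / 2 + ln C)%R] (gw n (x w)))%:R.

Lemma deviation_bound w (Mb Mz Mo : R) : coef_bounded n (x w) ->
  (forall r, (r < Lb)%N -> \sum_(i < q) (ycount r i w)%:R < Mb) ->
  (forall r, (r < Lb)%N -> `|\sum_(i < q) ((zc r i w)%:R - mu r i)| < Mz) ->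
  (forall a, (a <= Q)%N -> expR (- Mo) < `|gh n (x w) (opt a)|) ->
  `|Ntot w - mtot| < Lb%:R * (2 * Mb + Mz) + Q.+1%:R * (Mo + 3 * La%:R).
Proof.
move=> hx hy hz ho.
(* The lower bound at the first outer point already excludes the zero polynomial. *)
have x0 : exists2 j, (j <= n)%N & x w j != 0.
  apply: (@nonzero_coef R n (x w) (opt 0)); rewrite -normr_gt0.
  exact: lt_trans (expR_gt0 _) (ho 0%N (leq0n _)).
have [fin _] := finite_zeros x0.
pose NI := nz `[umin, (ln n%:R / 2)%R[ (gw n (x w)).
pose NO := nz `[(ln n%:R / 2)%R, (ln n%:R / 2 + ln C)%R] (gw n (x w)).
have NE : Ntot w = NI%:R + NO%:R.
  rewrite /Ntot -natrD /NI /NO -nz_setU//.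
    congr (_%:R); congr nz; apply/seteqP; split => t /=; rewrite !in_itv/=.
      move=> /andP[t1 t2]; have [h|h] := ltP t (ln n%:R / 2).
        by left; rewrite t1.
      by right.
    move=> [|] /andP[t1 t2]; apply/andP; split => //.
      by apply: le_trans (ltW t2) _; rewrite lerDl ltW.
    by apply: le_trans t1; rewrite lerBlDr lerDl ltW.
  rewrite -subset0 => t /=; rewrite !in_itv/= => -[/andP[_ h1] /andP[h2 _]].
  by have := lt_le_trans h1 h2; rewrite ltxx.
have NIE : NI%:R = \sum_(r < Lb) \sum_(i < q)
    (nz `[blk (cls r i), blk (cls r i) + G%:R * s[ (gw n (x w)))%:R :> R.
  rewrite -(sum_classes (fun k => (nz `[blk k, blk k + G%:R * s[ (gw n (x w)))%:R)).
  rewrite -natr_sum; congr (_%:R).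
  rewrite /NI -blk_end.
  have := @nz_itv_sum R (gw n (x w)) umin l (Lb * q) fin (ltW l0).
  move=> ->; apply: eq_bigr => k _.
  by rewrite Gs -blkS.
have NOb : NO%:R <= Q.+1%:R * (Mo + 3 * La%:R).
  apply: (@le_trans _ _ (\sum_(a < Q.+1) (nz `[opt a, opt a + olen a] (gw n (x w)))%:R)).
    rewrite -natr_sum ler_nat; apply: leq_trans (outer_sum Q fin).
    have fi A : finite_set (A `&` [set u | gw n (x w) u = 0]) by exact: finite_setIr.
    apply: fsubset_leq_card; rewrite -fset_set_sub// => t /=.
    rewrite !in_itv/= => -[/andP[t1 t2] ft]; split => //.
    rewrite /opt addr0 t1 /=; apply: le_trans t2 _.
    by rewrite lerD2l ler_pdivlMr.
  apply: (@le_trans _ _ (\sum_(a < Q.+1) (Mo + 3 * La%:R))).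
    by apply: ler_sum => a _; apply: outer_block => //; apply: ho; rewrite -ltnS.
  by rewrite sumr_const card_ord -[leLHS]mulr_natl.
have err (r i : nat) : (r < Lb)%N -> (i < q)%N ->
   `|(nz `[blk (cls r i), (blk (cls r i) + G%:R * s)%R[ (gw n (x w)))%:R - (zc r i w)%:R|
   <= 2 * (ycount r i w)%:R :> R.
  move=> rL iq; rewrite /zc /ycount.
  have H := (@block_error R n La n0 La40 nLa (x w) (win n La (blk (cls r i)) l)
    (blk (cls r i)) s G hx x0 Lan G0 s0 _ small_step).
  have Gsq : G%:R * s <= (Num.sqrt n%:R)^-1 by rewrite Gs.
  have HW : (forall i0 j : nat, (i0 <= G)%N -> (j <= n)%N ->
     ~~ win n La (blk (cls r i)) l j ->
     rho n (blk (cls r i) + i0%:R * s) j <= expR (- (27 * La%:R))).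
    move=> k j kG jn; apply: rho_off_win => //; first exact: pt_itv.
    by apply: pt_le => //; exact: cls_lt.
  have {}H := H Gsq HW.
  exact: H.
have dI : `|NI%:R - mtot| < Lb%:R * (2 * Mb + Mz).
  rewrite NIE /mtot -sumrB.
  apply: (@le_lt_trans _ _ (\sum_(r < Lb) (2 * (\sum_(i < q) (ycount r i w)%:R) +
     `|\sum_(i < q) ((zc r i w)%:R - mu r i)|))).
    apply: le_trans (ler_norm_sum _ _ _) _; apply: ler_sum => r _.
    rewrite -sumrB.
    rewrite (eq_bigr (fun i : 'I_q => ((nz `[blk (cls r i), blk (cls r i) + G%:R * s[ (gw n (x w)))%:R
      - (zc r i w)%:R) + ((zc r i w)%:R - mu r i))); last by move=> i _; ring.
    rewrite big_split /=; apply: le_trans (ler_normD _ _) _; rewrite lerD2r.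
    apply: le_trans (ler_norm_sum _ _ _) _; rewrite mulr_sumr.
    by apply: ler_sum => i _; apply: err.
  have -> : Lb%:R * (2 * Mb + Mz) = \sum_(r < Lb) (2 * Mb + Mz).
    by rewrite sumr_const card_ord -[RHS]mulr_natl.
  apply: ltr_sum.
    by apply/hasP; exists (Ordinal Lb0) => //; rewrite mem_index_enum.
  move=> r _; have := hy r (ltn_ord r); have := hz r (ltn_ord r); lra.
rewrite NE.
have -> : NI%:R + NO%:R - mtot = NI%:R - mtot + NO%:R by ring.
apply: le_lt_trans (ler_normD _ _) _.
by rewrite (ger0_norm (ler0n R NO)) ltr_leD.
Qed.

(** The four terms bound the probabilities of a large coefficient, of too many zeros in bad blocks,
    of a Hoeffding deviation in some class, and of a tiny value at some outer point. *)
Lemma fixed_degree_bound (la Mb Mz Mo : R) : 0 <= la -> la * (27 * La)%:R <= 2^-1 ->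
  exists m : R, [/\ 0 <= m, m <= (Lb * q * (27 * La))%:R &
  pr P [set w | Lb%:R * (2 * Mb + Mz) + Q.+1%:R * (Mo + 3 * La%:R) <=
    `|(nz `[ln n%:R / 2 - ln C, (ln n%:R / 2 + ln C)%R]
        (gw n (fun j => X j w)))%:R - m|] <=
  n.+1%:R * tau + Lb%:R * (4 * expR (- (Mb / 4))) +
  Lb%:R * (2 * expR (- (la * Mz) + q%:R * (2 * la ^+ 2 * (27 * La)%:R ^+ 2))) +
  Q.+1%:R * (18 * K * expR (- Mo))].
Proof.
move=> la0 la1; exists mtot; split; [exact: mtot_ge0|exact: mtot_le|].
pose B1 := [set w | exists2 j : 'I_n.+1, true & n%:R < `|X j w|].
pose B2 := [set w | exists2 r : 'I_Lb, true & Mb <= \sum_(i < q) (ycount r i w)%:R].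
pose B3 := [set w | exists2 r : 'I_Lb, true &
   Mz <= `|\sum_(i < q) ((zc r i w)%:R - mu r i)|].
pose B4 := [set w | exists2 a : 'I_Q.+1, true & `|gh n (x w) (opt a)| <= expR (- Mo)].
have sumE (m : nat) (z : R) : m%:R * z = \sum_(i < m) z.
  by rewrite sumr_const card_ord -[RHS]mulr_natl.
have b1 : pr P B1 <= n.+1%:R * tau.
  by apply: le_trans (pr_exists _ _ _) _; rewrite sumE; apply: ler_sum => j _; exact: htau.
have b2 : pr P B2 <= Lb%:R * (4 * expR (- (Mb / 4))).
  apply: le_trans (pr_exists _ _ _) _; rewrite sumE; apply: ler_sum => r _.
  exact: ycount_tail.
have b3 : pr P B3 <=
  Lb%:R * (2 * expR (- (la * Mz) + q%:R * (2 * la ^+ 2 * (27 * La)%:R ^+ 2))).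
  apply: le_trans (pr_exists _ _ _) _; rewrite sumE; apply: ler_sum => r _.
  exact: zc_tail.
have b4 : pr P B4 <= Q.+1%:R * (18 * K * expR (- Mo)).
  apply: le_trans (pr_exists _ _ _) _; rewrite sumE; apply: ler_sum => a _.
  exact: one_point (expR_gt0 _).
apply: (@le_trans _ _ (pr P (B1 `|` B2 `|` B3 `|` B4))); last first.
  apply: le_trans (prU _ _ _) _; apply: lerD => //.
  apply: le_trans (prU _ _ _) _; apply: lerD => //.
  by apply: le_trans (prU _ _ _) _; apply: lerD.
apply: pr_le => w /=; apply: contraPP => h.
have [h1 h2 h3 h4] : [/\ ~ B1 w, ~ B2 w, ~ B3 w & ~ B4 w].
  by split => H; apply: h; [left; left; left|left; left; right|left; right|right].
apply/negP; rewrite -ltNge; apply: deviation_bound.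
- move=> j jn; rewrite leNgt; apply/negP => hj; apply: h1.
  by exists (Ordinal (jn : (j < n.+1)%N)).
- move=> r rL; rewrite ltNge; apply/negP => hr; apply: h2.
  by exists (Ordinal rL).
- move=> r rL; rewrite ltNge; apply/negP => hr; apply: h3.
  by exists (Ordinal rL).
- move=> a aQ; rewrite ltNge; apply/negP => ha; apply: h4.
  by exists (Ordinal (aQ : (a < Q.+1)%N)).
Qed.

End fixed_degree.

(** * Tails from the logarithmic Sobolev inequality *)

Section bump.
Context (R : realType).
Implicit Types (w q : {poly R}) (x : R) (m : nat).

(* This family is closed under differentiation, whence smoothness. *)
Definition bump w q m x : R :=
  if 0 < w.[x] then q.[x] * (w.[x])^-1 ^+ m * expR (- (w.[x])^-1) else 0.

(** The numerator of the derivative once it is written over the power [m + 2] of [w]. *)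
Definition bump_deriv w q m : {poly R} :=
  q^`() * w ^+ 2 - (q * w * w^`()) *+ m + q * w^`().

(** With [v] the inverse of [w.[x]], the power [v ^+ m.+2] is at most a factorial times [expR v].
    The second-order vanishing in [w] is what differentiability at the edge of the support
    requires. *)
Lemma bump_le w q m x : `|bump w q m x| <= `|q.[x]| * (m.+2)`!%:R * w.[x] ^+ 2.
Proof.
rewrite /bump; case: ifPn => [w0|_]; last first.
  by rewrite normr0 mulr_ge0 ?sqr_ge0// mulr_ge0.
rewrite -!mulrA normrM ler_wpM2l//.
set v := (w.[x])^-1; have v0 : 0 < v by rewrite invr_gt0.
rewrite ger0_norm ?mulr_ge0 ?expR_ge0 ?exprn_ge0 ?(ltW v0)//.
have h := @expR_ge_Xn R v m.+2 (ltW v0).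
rewrite expRN; have e0 := expR_gt0 v.
rewrite ler_pdivrMr// ; rewrite ler_pdivrMr ?ltr0n ?fact_gt0// in h.
have wv : w.[x] = v^-1 by rewrite invrK.
rewrite wv.
have -> : v ^+ m = v ^+ m.+2 / v ^+ 2.
  by rewrite -addn2 exprD mulfK// expf_neq0// gt_eqF.
have -> : (m.+2)`!%:R * v^-1 ^+ 2 * expR v = expR v * (m.+2)`!%:R / v ^+ 2.
  by rewrite exprVn; ring.
by rewrite ler_pM2r ?invr_gt0 ?exprn_gt0.
Qed.

Lemma bump_deriv_eq (a a' b b' e : R) m : b != 0 ->
  a * b^-1 ^+ m * (e * - (- b ^- 2 * b')) +
  e * (a * (m%:R * b^-1 ^+ m.-1 * (- b ^- 2 * b')) + b^-1 ^+ m * a') =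
  (a' * b * b - (a * b * b') *+ m + a * b') * b^-1 ^+ m.+2 * e.
Proof.
move=> b0; case: m => [|m]; first by rewrite !exprS !expr0 mulr0n; field.
by rewrite -mulr_natl !exprS /=; field.
Qed.

Lemma near_gt0_poly w x : 0 < w.[x] -> \forall y \near x, 0 < w.[y].
Proof.
move=> w0; have := @continuous_horner R w x.
move=> /cvgrPdist_lt /(_ _ w0); apply: filterS => y h.
by move: h; rewrite ltr_norml => /andP[_ h]; lra.
Qed.

Lemma is_derive_bump w q m x :
  is_derive x (1 : R) (bump w q m) (bump w (bump_deriv w q m) m.+2 x).
Proof.
have [w0|w0|w0] := ltgtP 0 w.[x].
- pose g y := q.[y] * (w.[y])^-1 ^+ m * expR (- (w.[y])^-1).
  apply: (@near_eq_is_derive R R R g).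
    by apply: filterS (near_gt0_poly w0) => y wy; rewrite /bump wy.
  have dw := @is_derive_poly R w x.
  have dq := @is_derive_poly R q x.
  have w1 : w.[x] != 0 by rewrite gt_eqF.
  have dv : is_derive x (1 : R) (fun y => (w.[y])^-1) (- (w.[x]) ^- 2 * (w^`()).[x]).
    exact: (@is_deriveV R _ x _ _ w1 dw).
  have dvm := @is_deriveX R R _ m x 1 _ dv.
  have dnv := @is_deriveN R R R _ x 1 _ dv.
  have de := @is_derive1_comp R expR (fun y => - (w.[y])^-1) x _ _ (is_derive_expR _) dnv.
  have d1 := @is_deriveM R R _ _ x 1 _ _ dq dvm.
  have d2 := @is_deriveM R R _ _ x 1 _ _ d1 de.
  have eg : (horner q * (fun y => (w.[y])^-1) ^+ m) *
      (expR \o (fun y => - (w.[y])^-1)) = g.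
    by apply/funext => y; rewrite /g /= !fctE.
  have ex : ((fun y => (w.[y])^-1) ^+ m) x = (w.[x])^-1 ^+ m by rewrite fctE.
  have eqx : (horner q * (fun y => (w.[y])^-1) ^+ m) x = q.[x] * (w.[x])^-1 ^+ m.
    by rewrite -ex.
  rewrite -eg; apply: trigger_derive d2 _; rewrite eqx ex /=.
  have -> : bump w (bump_deriv w q m) m.+2 x =
    (q^`().[x] * w.[x] * w.[x] - (q.[x] * w.[x] * w^`().[x]) *+ m +
     q.[x] * w^`().[x]) * (w.[x])^-1 ^+ m.+2 * expR (- (w.[x])^-1).
    by rewrite /bump w0 /bump_deriv !(hornerE, hornerMn).
  exact: bump_deriv_eq.
- apply: (@near_eq_is_derive R R R (cst 0)).
    have := @near_gt0_poly (- w) x; rewrite hornerN oppr_gt0 => /(_ w0).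
    apply: filterS => y; rewrite hornerN oppr_gt0 => wy.
    by rewrite /bump ltNge (ltW wy).
  by rewrite /bump ltNge (ltW w0)/=; exact: is_derive_cst.
have bx : bump w q m x = 0 by rewrite /bump -w0 ltxx.
rewrite {2}/bump -w0 ltxx.
(* At a zero of [w] one factor [y - x] bounds the increment and a second one is left in [p], so the
   difference quotient tends to [p.[x] = 0]. *)
have [r wr] : exists r, w = r * ('X - x%:P) by apply/factor_theorem/eqP.
pose p := q * r ^+ 2 * ('X - x%:P) *+ (m.+2)`!.
have key y : `|bump w q m y| <= `|y - x| * `|p.[y]|.
  apply: le_trans (bump_le w q m y) _.
  have pe : p.[y] = (m.+2)`!%:R * (q.[y] * r.[y] ^+ 2 * (y - x)).
    by rewrite /p hornerMn -[LHS]mulr_natl !hornerE.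
  have we : w.[y] ^+ 2 = `|r.[y]| ^+ 2 * `|y - x| ^+ 2.
    by rewrite wr hornerM hornerXsubC -exprMn -normrM real_normK ?num_real.
  rewrite pe we !normrM (ger0_norm (ler0n _ _)).
  by rewrite le_eqVlt; apply/orP; left; apply/eqP; ring.
have px : p.[x] = 0 by rewrite /p hornerMn !hornerE subrr mulr0 mul0rn.
have lim : h^-1 *: (bump w q m (h *: (1:R) + x) - bump w q m x) @[h --> (0:R)^'] --> (0 : R).
  have c1 : {for (0 : R), continuous (fun h : R => h + x)}.
    by apply: cvgD; [exact: cvg_id|exact: cvg_cst].
  have cp : p.[h + x] @[h --> (0 : R)] --> (horner p \o (fun h : R => h + x)) 0.
    exact: (@continuous_comp R R R (fun h => h + x) (horner p) 0 c1
      (@continuous_horner R p (0 + x))).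
  rewrite /= add0r px in cp.
  apply/cvgr0Pnorm_lt => e e0; move/cvgr0Pnorm_lt: cp => /(_ e e0) cp.
  near=> h.
  have h0 : h != 0 by near: h; exact: nbhs_dnbhs_neq.
  apply: (@le_lt_trans _ _ `|p.[h + x]|); last by near: h; exact: nbhs_dnbhs cp.
  rewrite bx subr0 /GRing.scale /= mulr1 normrM normfV.
  rewrite ler_pdivrMl ?normr_gt0//.
  by have := key (h + x); rewrite addrK.
apply: DeriveDef; first by apply/cvg_ex; exists 0.
exact/cvg_lim.
Unshelve. all: by end_near. Qed.

Lemma bump_continuous w q m : continuous (bump w q m).
Proof.
move=> x; have [d _] := is_derive_bump w q m x.
exact/differentiable_continuous/derivable1_diffP.
Qed.

Lemma bump_smooth w q m : smooth (bump w q m).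
Proof.
have H k : exists q' m', derive1n k (bump w q m) = bump w q' m'.
  elim: k => [|k [q' [m' IH]]]; first by exists q, m; rewrite derive1n0.
  exists (bump_deriv w q' m'), m'.+2; rewrite derive1nS IH; apply/funext => x.
  by rewrite derive1E; have [_ ->] := is_derive_bump w q' m' x.
by move=> k x; have [q' [m' ->]] := H k; have [] := is_derive_bump w q' m' x.
Qed.

Lemma bump_derive1 w q m : derive1 (bump w q m) = bump w (bump_deriv w q m) m.+2.
Proof.
apply/funext => x; rewrite derive1E.
by have [_ ->] := is_derive_bump w q m x.
Qed.

End bump.

(** * Expectations compared with probabilities *)

Section expectation_bounds.
Context (R : realType) (d : measure_display) (T : measurableType d)
  (P : probability T R).

Lemma indic_le1 (A : set T) w : 0 <= (\1_A w : R) <= 1.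
Proof. by rewrite indicE; case: (_ \in _); rewrite ?ler01 ?lexx. Qed.

Lemma integrable_affine_indic (c k : R) (A : set T) : measurable A ->
  P.-integrable setT (fun w => (c + k * \1_A w)%:E).
Proof.
move=> mA.
have h := @integrableD _ _ _ P setT measurableT (EFin \o cst c)
  (fun w => k%:E * (\1_A w)%:E)%E (finite_measure_integrable_cst P c measurableT)
  (integrableZl measurableT k (integrable_indic P mA)).
exact: h.
Qed.

Lemma integral_affine_indic (c k : R) (A : set T) : measurable A ->
  (\int[P]_w (c + k * \1_A w)%:E)%E = (c + k * pr P A)%:E.
Proof.
move=> mA.
have i1 := finite_measure_integrable_cst P c measurableT.
have i2 := integrable_indic P mA.
have := @integralD _ _ _ P setT measurableT (EFin \o cst c)
  (fun w => k%:E * (\1_A w)%:E)%E i1 (integrableZl measurableT k i2).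
have e2 : (\int[P]_w (\1_A w)%:E)%E = (pr P A)%:E.
  transitivity (P (A `&` setT)); first exact: integral_indic.
  by rewrite setIT (prE P mA).
have e1 : (\int[P]_x (EFin \o cst c) x)%E = c%:E.
  transitivity (c%:E * P setT)%E; first exact: (integral_cst P measurableT c%:E).
  by rewrite probability_setT mule1.
by rewrite (integralZl measurableT i2) e1 e2 -EFinM -EFinD.
Qed.

(** Serves both the three expectations in the logarithmic Sobolev inequality and the mean of the
    root count: the same indicator bounds give finiteness and the numerical estimate. *)
Lemma expectation_bounds (Y : T -> R) (A B : set T) (c1 k1 c2 k2 : R) :
  measurable_fun setT Y -> measurable A -> measurable B ->
  (forall w, c1 + k1 * \1_B w <= Y w <= c2 + k2 * \1_A w) ->
  exists2 e, ('E_P[Y] = e%:E)%E & c1 + k1 * pr P B <= e <= c2 + k2 * pr P A.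
Proof.
move=> mY mA mB hY.
have iY : P.-integrable setT (EFin \o Y).
  have PT : (P setT < +oo)%E by rewrite probability_setT ltry.
  apply: (measurable_bounded_integrable measurableT PT mY).
  exists (`|c1| + `|k1| + `|c2| + `|k2|); split; first exact: num_real.
  move=> M hM w _ /=; apply: le_trans (ltW hM).
  have /andP[h1 h2] := hY w.
  have /andP[a1 a2] := indic_le1 A w; have /andP[b1 b2] := indic_le1 B w.
  have ka : k2 * \1_A w <= `|k2|.
    apply: le_trans (ler_norm _) _; rewrite normrM (ger0_norm a1).
    by rewrite ler_piMr.
  have kb : - `|k1| <= k1 * \1_B w.
    rewrite lerNl; apply: le_trans (ler_norm _) _; rewrite normrN normrM (ger0_norm b1).
    by rewrite ler_piMr.
  have := ler_norm c2; have := ler_norm (- c1); rewrite normrN.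
  have := normr_ge0 c2; have := normr_ge0 c1; have := normr_ge0 k1; have := normr_ge0 k2.
  by move=> *; rewrite ler_norml; apply/andP; split; lra.
have EY : ('E_P[Y] = \int[P]_w (Y w)%:E)%E by rewrite unlock.
have fY : ('E_P[Y] \is a fin_num)%E by rewrite EY; exact: integrable_fin_num.
exists (fine ('E_P[Y])%E); first by rewrite fineK.
rewrite -!lee_fin fineK// EY -!integral_affine_indic//; apply/andP; split.
- apply: (le_integral measurableT (integrable_affine_indic _ _ mB) iY) => w _ /=.
  by rewrite lee_fin; have /andP[] := hY w.
- apply: (le_integral measurableT iY (integrable_affine_indic _ _ mA)) => w _ /=.
  by rewrite lee_fin; have /andP[] := hY w.
Qed.

End expectation_bounds.

Section log_sobolev_tails.
Context (R : realType) (d : measure_display) (T : measurableType d)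
  (P : probability T R) (X : {RV P >-> R}) (C0 : R).
Hypothesis C0_gt0 : 0 < C0.
Hypothesis LS : log_sobolev C0 X.

(** [expR 4] comes from the lower bound of the squared bump on the inner interval, [4 * C0] from its
    squared derivative, 1 from [y * ln y >= -1]; the leading 4 produces the gain [4^-1]. *)
Let kappa : R := 4 * expR 4 * (4 * C0 + 1).

(** Scaled so that the slope on the interval is at most 1 whatever its length, which makes the later
    bounds uniform in [b]. *)
Definition tent (a b : R) : {poly R} := (b - a)^-1 *: (('X - a%:P) * (b%:P - 'X)).

Lemma tentE a b x : (tent a b).[x] = (x - a) * (b - x) / (b - a).
Proof.
by rewrite /tent hornerZ hornerM hornerXsubC hornerD hornerN hornerC hornerX mulrC.
Qed.

Lemma tent_gt0 a b x : a < b -> (0 < (tent a b).[x]) = (a < x < b).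
Proof.
move=> ab; rewrite tentE pmulr_lgt0 ?invr_gt0 ?subr_gt0//.
apply/idP/idP => [h|/andP[h1 h2]]; last by rewrite mulr_gt0// subr_gt0.
have [xa|xa] := leP x a.
  by have : (x - a) * (b - x) <= 0; [apply: mulr_le0_ge0; lra|lra].
have [xb|xb] := leP b x; last by [].
by have : (x - a) * (b - x) <= 0; [apply: mulr_ge0_le0; lra|lra].
Qed.

Lemma tent_ge_half a b x : a + 2 < b -> a + 1 <= x <= b - 1 -> 2^-1 <= (tent a b).[x].
Proof.
move=> ab /andP[h1 h2]; rewrite tentE ler_pdivlMr; last by lra.
have : 0 <= (x - (a + 1)) * (b - 1 - x) by apply: mulr_ge0; lra.
by nra.
Qed.

Lemma tent_deriv a b x : a < b -> a < x < b -> `|(tent a b)^`().[x]| <= 1.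
Proof.
move=> ab /andP[h1 h2].
have -> : (tent a b)^`().[x] = (a + b - 2 * x) / (b - a).
  by rewrite /tent derivZ derivM derivB derivX derivC derivB derivX derivC !hornerE; field; lra.
rewrite normrM normfV ler_pdivrMr ?normr_gt0; last by rewrite subr_eq0 gt_eqF.
by rewrite mul1r [leRHS]ger0_norm ?ler_norml; [apply/andP; split|]; lra.
Qed.

(** A small mass improves itself. For [f = exp (- 1 / tent)], the mean of [f ^ 2] is at most the
    mass of the interval, hence at most [exp (- kappa)], and the entropy is at least [kappa] times
    this mean minus the mass. The inequality then bounds the mean by the mass times
    [(4 * C0 + 1) / kappa]. *)
Lemma log_sobolev_interval a b : a + 2 < b ->
  pr P [set w | a < X w < b] <= expR (- kappa) ->
  pr P [set w | a + 1 <= X w <= b - 1] <= 4^-1 * pr P [set w | a < X w < b].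
Proof.
move=> ab2 hA.
have C00 := C0_gt0.
have ab : a < b by lra.
pose w := tent a b; pose f := bump w 1 0.
set A := [set w | a < X w < b] in hA *; set B := [set w | _ <= _ <= _].
have mA : measurable A.
  rewrite (_ : A = X @^-1` `]a, b[%classic); last first.
    by apply/seteqP; split => t /=; rewrite in_itv.
  by rewrite -[_ @^-1` _]setTI; exact: measurable_funP.
have mB : measurable B.
  rewrite (_ : B = X @^-1` `[a + 1, b - 1]%classic); last first.
    by apply/seteqP; split => t /=; rewrite in_itv.
  by rewrite -[_ @^-1` _]setTI; exact: measurable_funP.
have fE x : f x = if a < x < b then expR (- (w.[x])^-1) else 0.
  by rewrite /f /bump tent_gt0// hornerC expr0 !mul1r.
have f01 x : 0 <= f x <= 1.
  rewrite fE; case: ifP => h; last by rewrite lexx ler01.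
  rewrite expR_ge0 -[leRHS]expR0 ler_expR oppr_le0 invr_ge0 ltW//.
  by rewrite tent_gt0.
have fB x : a + 1 <= x <= b - 1 -> expR (- 4) <= f x ^+ 2.
  move=> hx; have h2 := tent_ge_half ab2 hx.
  have hx' : a < x < b by case/andP: hx => *; apply/andP; split; lra.
  rewrite fE hx' -expRM_natl ler_expR.
  have : (w.[x])^-1 <= 2.
    by rewrite -[leRHS]invrK lef_pV2 ?posrE ?invr_gt0//; rewrite tent_gt0.
  lra.
have cf : continuous f by exact: bump_continuous.
have mf : measurable_fun setT (fun t => f (X t)).
  by apply: measurableT_comp; [exact: continuous_measurable_fun|exact: measurable_funP].
have inA t : (t \in A) = (a < X t < b) by apply/idP/idP; rewrite inE.
have inB t : (t \in B) = (a + 1 <= X t <= b - 1) by apply/idP/idP; rewrite inE.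
have sqle1 t : 0 <= f (X t) ^+ 2 <= 1.
  have /andP[h0 h1] := f01 (X t); rewrite sqr_ge0 -[leRHS](expr1n _ 2).
  by rewrite lerXn2r ?nnegrE.
have f0 t : t \notin A -> f (X t) = 0.
  by rewrite inA fE => /negbTE ->.
have df t : derive1 f t = bump w w^`() 2 t.
  rewrite /f bump_derive1 /bump_deriv; congr (bump w _ _ _).
  by rewrite derivC mul0r mulr0n subr0 add0r mul1r.
have dfle t : derive1 f (X t) ^+ 2 <= 4 * \1_A t.
  rewrite df /bump tent_gt0//; have [hx|/negbTE hx] := boolP (a < X t < b) => /=; last first.
    by rewrite expr0n /= mulr_ge0 ?indicE.
  have -> : \1_A t = 1 :> R by rewrite indicE inA hx.
  have w0 : 0 < w.[X t] by rewrite tent_gt0.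
  set v := (w.[X t])^-1; have v0 : 0 < v by rewrite invr_gt0.
  have h := @expR_ge_Xn R v 2 (ltW v0).
  have h2 : v ^+ 2 * expR (- v) <= 2.
    rewrite expRN ler_pdivrMr ?expR_gt0//.
    by move: h; rewrite ler_pdivrMr ?ltr0n ?fact_gt0// (_ : 2`! = 2)%N// mulrC.
  have h3 : 0 <= v ^+ 2 * expR (- v) by rewrite mulr_ge0 ?sqr_ge0 ?expR_ge0.
  rewrite -mulrA exprMn -[_ ^+ 2 as Z in Z * _]real_normK ?num_real//.
  have h4 : `|w^`().[X t]| ^+ 2 <= 1.
    by rewrite -[leRHS](expr1n _ 2) lerXn2r ?nnegrE//; exact: tent_deriv.
  rewrite mulr1 -[leRHS]mul1r ler_pM ?sqr_ge0//.
  by rewrite (_ : 4 = 2 ^+ 2 :> R); [rewrite lerXn2r ?nnegrE|ring].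
have [e1 E1 /andP[e1l e1u]] : exists2 e, ('E_P[(fun t => f (X t) ^+ 2)%R] = e%:E)%E &
    0 + expR (- 4) * pr P B <= e <= 0 + 1 * pr P A.
  apply: expectation_bounds => //; first exact: measurable_funX.
  move=> t; rewrite !add0r mul1r; apply/andP; split.
    rewrite indicE inB; have [hx|hx] := boolP (a + 1 <= X t <= b - 1) => /=;
      last by rewrite mulr0 sqr_ge0.
    by rewrite mulr1 fB.
  rewrite indicE; have [//|/f0 ->] := boolP (t \in A); last by rewrite expr0n.
  by have /andP[] := sqle1 t.
have [e2 E2 /andP[e2l _]] : exists2 e,
    ('E_P[(fun t => f (X t) ^+ 2 * ln (f (X t) ^+ 2))%R] = e%:E)%E &
    0 + -1 * pr P A <= e <= 0 + 0 * pr P A.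
  apply: expectation_bounds => //.
    apply: measurable_funM; first exact: measurable_funX.
    by apply: measurableT_comp; [exact: measurable_ln|exact: measurable_funX].
  move=> t; rewrite !add0r mul0r mulN1r.
  have [tA|/f0 ->] := boolP (t \in A); last first.
    by rewrite expr0n /= mul0r lexx andbT oppr_le0 indicE.
  rewrite indicE tA /=.
  have p0 : 0 < f (X t) ^+ 2.
    by move: tA; rewrite inA fE => ->; rewrite exprn_gt0 ?expR_gt0.
  have /andP[_ p1] := sqle1 t; set y := f (X t) ^+ 2 in p0 p1 *.
  apply/andP; split; last by rewrite mulr_ge0_le0 ?ln_le0// ltW.
  have : ln (y^-1) <= y^-1 - 1.
    have e : 1 + (y^-1 - 1) = y^-1 by rewrite addrC subrK.
    have := @le_ln1Dx R (y^-1 - 1); rewrite e; apply.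
    by rewrite ltrBrDr addNr invr_gt0.
  rewrite lnV ?posrE// => h.
  have := ler_wpM2l (ltW p0) h; rewrite mulrBr mulfV ?gt_eqF// mulr1 mulrN; lra.
have [e3 E3 /andP[_ e3u]] : exists2 e,
    ('E_P[(fun t => derive1 f (X t) ^+ 2)%R] = e%:E)%E & 0 + 0 * pr P A <= e <= 0 + 4 * pr P A.
  apply: expectation_bounds => //.
    apply: measurable_funX; apply: measurableT_comp; last exact: measurable_funP.
    rewrite (_ : derive1 f = bump w w^`() 2); last by apply/funext.
    by apply: continuous_measurable_fun; exact: bump_continuous.
  by move=> t; rewrite !add0r mul0r sqr_ge0 dfle.
have bf : bounded_fun f.
  exists 1; split; first exact: num_real.
  move=> M M1 t _ /=; have /andP[h0 h1] := f01 t.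
  by rewrite ger0_norm// (le_trans h1)// ltW.
have cs : compactly_supported f.
  have sub : closure [set x | f x != 0] `<=` `[a, b].
    have -> : (`[a, b]%classic : set R) = closure `[a, b]%classic.
      by rewrite -closure_id; exact: itv_closed.
    apply: closureS => t /=; rewrite fE.
    have [/andP[/ltW h1 /ltW h2] _|_] := boolP (a < t < b); last by rewrite eqxx.
    by rewrite in_itv/= h1.
  exact: subclosed_compact (@closed_closure _ _) (@segment_compact R a b) sub.
have := LS (@bump_smooth R w 1 0) bf cs.
rewrite -/f /entropy E1 E2 E3 => LSf.
have prA0 := pr_ge0 P A; have prB0 := pr_ge0 P B.
have K1 : 1 <= expR 4 :> R by rewrite -[leLHS]expR0 ler_expR.
have [e10|e10] := leP e1 0.
  have : expR (- 4) * pr P B <= 0 by lra.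
  rewrite pmulr_rle0 ?expR_gt0// => ?; lra.
have LSr : e2 - e1 * ln e1 <= C0 * e3.
  by move: LSf; rewrite lne_EFin// -!EFinM -EFinB lee_fin.
have lne1 : ln e1 <= - kappa.
  rewrite -[leRHS]expRK ler_ln ?posrE ?expR_gt0//.
  by apply: le_trans hA; lra.
have : e1 * kappa <= (4 * C0 + 1) * pr P A.
  have h1 := ler_wpM2l (ltW e10) lne1.
  have h2 : C0 * e3 <= C0 * (4 * pr P A) by rewrite ler_pM2l//; lra.
  lra.
have e1B : pr P B <= expR 4 * e1.
  rewrite -(@ler_pM2l _ (expR (- 4))) ?expR_gt0// mulrA -expRD addNr expR0 mul1r; lra.
have D0 : 0 < 4 * C0 + 1 by lra.
rewrite /kappa => h.
have : (4 * C0 + 1) * (4 * (expR 4 * e1)) <= (4 * C0 + 1) * pr P A by lra.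
rewrite ler_pM2l//; lra.
Qed.

Hypothesis cheb : forall t, 0 < t -> pr P [set w | t <= `|X w|] <= t ^- 2.

(** Test functions have compact support, so the two half-lines are cut at a far point [b], beyond
    which Chebyshev's inequality leaves at most [e]. Each side contributes a quarter of the tail. *)
Lemma tail_step t : 0 <= t -> pr P [set w | t < `|X w|] <= expR (- kappa) ->
  pr P [set w | t + 1 < `|X w|] <= 2^-1 * pr P [set w | t < `|X w|].
Proof.
move=> t0 hp; apply/ler_addgt0Pr => e e0.
pose k := Num.truncn (e^-1).
have k0 : e^-1 < k.+1%:R by exact: truncnS_gt.
have k1 : 0 <= k%:R :> R by [].
pose b := t + 3 + k%:R.
have ab1 : t + 2 < b by rewrite /b; lra.
have ab2 : - b + 2 < - t by rewrite /b; lra.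
set p := pr P [set w | t < `|X w|] in hp *.
have s1 : pr P [set w | t < X w < b] <= p.
  by apply: pr_le => w /= /andP[h _]; exact: lt_le_trans h (ler_norm _).
have s2 : pr P [set w | - b < X w < - t] <= p.
  apply: pr_le => w /= /andP[_ h]; rewrite -normrN.
  by apply: lt_le_trans (ler_norm _); rewrite ltrNr.
have h1 := log_sobolev_interval ab1 (le_trans s1 hp).
have h2 := log_sobolev_interval ab2 (le_trans s2 hp).
have bt : 0 < b - 1 by lra.
have h3 : (b - 1) ^- 2 <= e.
  rewrite -[leRHS]invrK lef_pV2 ?posrE ?exprn_gt0 ?invr_gt0//.
  have hb : k.+1%:R <= b - 1 by rewrite /b -natr1; lra.
  have h1k : 1 <= k.+1%:R :> R by rewrite ler1n.
  by apply: le_trans (ltW k0) _; rewrite expr2; nra.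
apply: (@le_trans _ _ (pr P (([set w | t + 1 <= X w <= b - 1] `|`
    [set w | - b + 1 <= X w <= - t - 1]) `|` [set w | b - 1 <= `|X w|]))).
  apply: pr_le => w /= hw; have [hb|hb] := leP (b - 1) `|X w|; first by right.
  left; move: hw hb; have [x0|x0] := ger0P (X w) => hw hb; [left|right];
    by apply/andP; split; lra.
apply: le_trans (prU _ _ _) _; apply: (@le_trans _ _ (2^-1 * p + (b - 1) ^- 2)).
  apply: lerD; last exact: cheb.
  by apply: le_trans (prU _ _ _) _; lra.
by rewrite lerD2l.
Qed.

Lemma exponential_tail : exists t0 : nat,
  forall k, pr P [set w | (t0 + k)%:R < `|X w|] <= 2^-1 ^+ k.
Proof.
(* Chebyshev's inequality at this point brings the tail below [exp (- kappa)], the smallness that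
   starts the halving. *)
pose t0 := (Num.truncn (expR kappa)).+1.
have h0 : expR kappa < t0%:R by exact: truncnS_gt.
have C00 := C0_gt0.
have ka0 : 0 <= kappa by rewrite /kappa mulr_ge0 ?mulr_ge0 ?expR_ge0//; lra.
have e1 : 1 <= expR kappa by rewrite -[leLHS]expR0 ler_expR.
have init : pr P [set w | t0%:R < `|X w|] <= expR (- kappa).
  apply: (@le_trans _ _ (pr P [set w | t0%:R <= `|X w|])).
    by apply: pr_le => w /=; exact: ltW.
  apply: le_trans (cheb _) _; first by rewrite ltr0n.
  rewrite expRN lef_pV2 ?posrE ?expR_gt0 ?exprn_gt0 ?ltr0n//.
  by apply: le_trans (ltW h0) _; rewrite expr2 ler_peMl// ?ler1n.
exists t0 => k.
have [//] : pr P [set w | (t0 + k)%:R < `|X w|] <= 2^-1 ^+ k /\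
    pr P [set w | (t0 + k)%:R < `|X w|] <= expR (- kappa).
elim: k => [|k [IH1 IH2]]; first by rewrite addn0 expr0 pr_le1.
have := tail_step (ler0n _ _) IH2.
have -> : (t0 + k)%:R + 1 = (t0 + k.+1)%:R :> R by rewrite natr1 addnS.
move=> h; split.
  by apply: le_trans h _; rewrite exprS ler_wpM2l.
apply: le_trans h _; apply: le_trans IH2.
by rewrite ler_piMl ?pr_ge0//; lra.
Qed.

End log_sobolev_tails.

(** * Measurability of the number of roots *)

Section root_counts.
Context (R : realType).
Implicit Types (x : nat -> R) (a b : R).

Lemma card_fset_set_inj (f : R -> R) (A : set R) : injective f ->
  #|` fset_set (f @` A)|%fset = #|` fset_set A|%fset.
Proof.
move=> fi; have [fA|nA] := pselect (finite_set A).
  by rewrite fset_set_image// card_imfset.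
rewrite !fset_set_infinite// => fA; apply: nA.
by rewrite -(eq_finite_set (inj_card_eq (in2W fi))).
Qed.

Lemma weyl_poly_expR n x u : (weyl_poly n x).[expR u] = gw n x u.
Proof.
rewrite horner_poly /gw; apply: eq_bigr => i _.
by rewrite /wt mulrA mulrAC -expRM_natl.
Qed.

Lemma num_roots_nz n x (u v : R) :
  num_roots `[expR u, expR v] (weyl_poly n x) = nz `[u, v] (gw n x).
Proof.
rewrite /nz -[RHS](@card_fset_set_inj expR); last exact: expR_inj.
rewrite /num_roots; congr #|` fset_set _|%fset.
apply/seteqP; split => y /=.
  rewrite in_itv/= => -[/andP[h1 h2] /rootP ry].
  have y0 : 0 < y by apply: lt_le_trans h1; exact: expR_gt0.
  exists (ln y); last by rewrite lnK.
  rewrite -weyl_poly_expR lnK// ry; split => //.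
  by rewrite in_itv/= -ler_expR lnK// h1 -ler_expR lnK.
move=> [t [+ gt] <-]; rewrite in_itv/= => /andP[h1 h2]; split.
  by rewrite in_itv/= !ler_expR h1.
by apply/rootP; rewrite weyl_poly_expR.
Qed.

Lemma num_roots_opp n x a b :
  num_roots `[- b, - a] (weyl_poly n x) =
  num_roots `[a, b] (weyl_poly n (fun j => (-1) ^+ j * x j)).
Proof.
have e y : (weyl_poly n (fun j => (-1) ^+ j * x j)).[y] = (weyl_poly n x).[- y].
  rewrite !horner_poly; apply: eq_bigr => i _.
  by rewrite [(- y) ^+ i]exprNn; ring.
rewrite /num_roots -[RHS](@card_fset_set_inj -%R); last exact: oppr_inj.
congr #|` fset_set _|%fset; apply/seteqP; split => y /=.
  rewrite in_itv/= => -[/andP[h1 h2] /rootP ry].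
  exists (- y) => /=; last by rewrite opprK.
  by rewrite in_itv/= lerNr h2 lerNl h1; split => //; apply/rootP; rewrite e opprK.
move=> [t [+ /rootP rt] <-]; rewrite in_itv/= => /andP[h1 h2].
by rewrite in_itv/= !lerN2 h1 h2; split => //; apply/rootP; rewrite -e.
Qed.

End root_counts.

Section root_measurability.
Context (R : realType) (d : measure_display) (T : measurableType d)
  (X : nat -> T -> R) (n : nat).
Hypothesis mX : forall j, measurable_fun setT (X j).

Let F (w : T) : {poly R} := weyl_poly n (fun j => X j w).

Lemma measurable_horner_weyl y : measurable_fun setT (fun w => (F w).[y]).
Proof.
have -> : (fun w => (F w).[y]) =
    (fun w => \sum_(j < n.+1) X j w / Num.sqrt j`!%:R * y ^+ j).
  by apply/funext => w; rewrite horner_poly.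
apply: measurable_sum => j; apply: measurable_funM => //.
by apply: measurable_funM.
Qed.

Let hit (p q : R) : set T := [set w | exists2 y, p <= y <= q & (F w).[y] = 0].

(** By compactness, a zero exists as soon as the modulus takes arbitrarily small values at the
    points [pnt r]. Parametrising by rationals in [[0, 1]] covers [p = q], where the interval need
    not contain a rational. *)
Lemma measurable_hit p q : measurable (hit p q).
Proof.
have q1 (r : rat) : (ratr r <= 1 :> R) = (r <= 1).
  by rewrite -(ler_rat R) rmorph1.
have [pq|pq] := leP p q; last first.
  rewrite (_ : hit p q = set0)//; rewrite -subset0 => w [y] /andP[h1 h2] _.
  by have := le_trans h1 h2; rewrite leNgt pq.
pose pnt (r : rat) := p + (q - p) * ratr r.
pose B (k : nat) (r : rat) := if 0 <= r <= 1 then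
   [set w | `|(F w).[pnt r]| < k.+1%:R^-1] else set0.
rewrite (_ : hit p q = \bigcap_k \bigcup_r B k r).
  apply: bigcap_measurable => // k _.
  apply: bigcupT_measurable_rat => r; rewrite /B; case: ifP => _ //.
  rewrite (_ : [set w | _] = (fun w => `|(F w).[pnt r]|) @^-1` `]-oo, k.+1%:R^-1[%classic).
    rewrite -[_ @^-1` _]setTI.
    apply: (measurableT_comp (@normr_measurable R setT) (measurable_horner_weyl _)) => //.
  by apply/seteqP; split => w /=; rewrite in_itv.
apply/seteqP; split => w /=.
  move=> [y /andP[h1 h2] Fy] k _.
  have cF := @continuous_horner R (F w) y.
  have k0 : 0 < k.+1%:R^-1 :> R by rewrite invr_gt0.
  move/cvgrPdist_lt: cF => /(_ _ k0); rewrite Fy.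
  move=> /nbhs_ballP[e /= e0 he].
  have [pq0|pq0] := eqVneq p q.
    exists 0 => //; rewrite /B lexx ler01 /=.
    have -> : pnt 0 = y by rewrite /pnt raddf0 mulr0 addr0; lra.
    by rewrite Fy normr0.
  have qp : 0 < q - p by rewrite subr_gt0 lt_neqAle pq0.
  pose t := (y - p) / (q - p).
  have t0 : 0 <= t by rewrite divr_ge0//; lra.
  have t1 : t <= 1 by rewrite ler_pdivrMr//; lra.
  (* The clip at 1/2 keeps the rational inside [[0, 1]]: it is sought to the right of [t] if
     [t <= 1/2] and to the left otherwise. *)
  pose dl := Num.min (e / (q - p)) 2^-1.
  have dl0 : 0 < dl by rewrite lt_min invr_gt0 ltr0n andbT divr_gt0.
  have [r r0 hr] : exists2 r : rat, 0 <= r <= 1 & `|t - ratr r| < e / (q - p).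
    have [th|th] := leP t 2^-1.
      have : t < t + dl by rewrite ltrDl.
      move=> /rat_in_itvoo[r]; rewrite in_itv/= => /andP[r1 r2].
      have dle : dl <= e / (q - p) by rewrite ge_min lexx.
      have dlh : dl <= 2^-1 by rewrite ge_min lexx orbT.
      exists r; last by rewrite ltr_distlC; apply/andP; split; lra.
      suff : (0 : R) <= (ratr r : R) <= 1 by rewrite ler0q q1.
      by apply/andP; split; lra.
    have : t - dl < t by rewrite ltrBlDr ltrDl.
    move=> /rat_in_itvoo[r]; rewrite in_itv/= => /andP[r1 r2].
    have dle : dl <= e / (q - p) by rewrite ge_min lexx.
    have dlh : dl <= 2^-1 by rewrite ge_min lexx orbT.
    exists r; last by rewrite ltr_distlC; apply/andP; split; lra.
    suff : (0 : R) <= (ratr r : R) <= 1 by rewrite ler0q q1.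
    by apply/andP; split; lra.
  exists r => //; rewrite /B r0 /=.
  have := he (pnt r); rewrite sub0r normrN; apply.
  rewrite /ball /= /pnt.
  have -> : y - (p + (q - p) * ratr r) = (q - p) * (t - ratr r).
    by rewrite /t; field; lra.
  rewrite normrM (ger0_norm (ltW qp)) mulrC -ltr_pdivlMr//.
move=> h.
have cF : {within `[p, q], continuous (fun y => `|(F w).[y]|)}.
  apply: continuous_subspaceT => y.
  by apply: continuous_comp; [exact: continuous_horner|exact: norm_continuous].
have [y + hy] := EVT_min pq cF.
rewrite in_itv/= => yi; exists y => //; apply/eqP; rewrite -normr_le0.
apply/ler_addgt0Pr => e e0; rewrite add0r.
have [r _] := h (Num.truncn e^-1) I; rewrite /B; case: ifP => // /andP[r0 r1] /= hr.
have ri : pnt r \in `[p, q].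
  have : (0 : R) <= (ratr r : R) <= 1 by rewrite ler0q q1 r0.
  by rewrite in_itv/= /pnt => /andP[? ?]; apply/andP; split; nra.
apply: le_trans (hy _ ri) _; apply: le_trans (ltW hr) _.
rewrite -[leRHS]invrK lef_pV2 ?posrE ?invr_gt0//.
exact/ltW/truncnS_gt.
Qed.

Variables (a b : R).

Let many (m : nat) (p : R) : set T := [set w | exists s : seq R,
  [/\ size s = m.+1, sorted <%R s, all (fun y => p <= y <= b) s &
      all (fun y => (F w).[y] == 0) s]].

(* Rational numbers separate the smallest root from the others. *)
Lemma measurable_many m p : measurable (many m p).
Proof.
elim: m p => [|m IH] p.
  rewrite (_ : many 0 p = hit p b); first exact: measurable_hit.
  apply/seteqP; split => w /=.
    move=> [[|y [|z s]]]; case=> //= _ _; rewrite !andbT => h /eqP h'.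
    by exists y.
  by move=> [y h1 h2]; exists [:: y]; split => //=; rewrite ?h1 ?h2 ?eqxx.
pose B (c c' : rat) := if c < c' then hit p (ratr c) `&` many m (ratr c') else set0.
rewrite (_ : many m.+1 p = \bigcup_c \bigcup_c' B c c').
  apply: bigcupT_measurable_rat => c; apply: bigcupT_measurable_rat => c'.
  rewrite /B; case: ifP => _ //; apply: measurableI => //; exact: measurable_hit.
apply/seteqP; split => w /=.
  move=> [[|y [|z s]]]; case=> //= -[ss] /andP[yz ps] /andP[/andP[py yb] hs] /andP[/eqP Fy Fs].
  have [c] := rat_in_itvoo yz; rewrite in_itv/= => /andP[yc cz].
  have [c'] := rat_in_itvoo cz; rewrite in_itv/= => /andP[cc' cz'].
  exists c => //; exists c' => //; rewrite /B -(ltr_rat R) cc'; split.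
    by exists y => //; rewrite py ltW.
  exists (z :: s); split => //=; first by rewrite ss.
  have /allP hz := order_path_min (@lt_trans _ _) ps.
  move: hs => /andP[/andP[pz zb] hs]; rewrite (ltW cz') zb /=.
  apply/allP => t ts; have /allP/(_ t ts)/andP[_ ->] := hs.
  by rewrite (le_trans (ltW cz'))// ltW// hz.
move=> [c _ [c' _]]; rewrite /B; case: ifP => // cc' [[y /andP[py yc] Fy]].
move=> [s [ss ps hs Fs]].
have cc'R : ratr c < ratr c' :> R by rewrite ltr_rat.
have hys z : z \in s -> y < z.
  move=> zs; have /allP/(_ z zs)/andP[h _] := hs.
  by apply: le_lt_trans yc _; exact: lt_le_trans h.
exists (y :: s); split => /=; first by rewrite ss.
- rewrite path_sortedE; last exact: lt_trans.
  by rewrite ps andbT; apply/allP.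
- case: s ss ps hs Fs hys => // z s ss ps hs Fs hys.
  have yz := hys z (mem_head _ _).
  apply/andP; split.
    rewrite py /=; apply: le_trans (ltW yz) _.
    by have /andP[/andP[]] := hs.
  apply/allP => t ts; have /allP/(_ t ts)/andP[_ ->] := hs.
  by rewrite andbT (le_trans py)// ltW// hys.
- by rewrite Fy eqxx.
Qed.

Lemma measurable_num_roots :
  measurable_fun setT (fun w => (num_roots `[a, b] (F w))%:R : R).
Proof.
pose N w := num_roots `[a, b] (F w).
(* For the zero polynomial [many] need not agree with the count, so this event is treated apart. *)
pose Z := [set w | F w = 0].
have mZ : measurable Z.
  rewrite (_ : Z = \bigcap_(j in [set j | (j <= n)%N]) (X j @^-1` [set 0])).
    apply: bigcap_measurableType => // j _.
    by rewrite -[_ @^-1` _]setTI; exact: mX.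
  have sne j : Num.sqrt (j`!%:R : R) != 0.
    by rewrite gt_eqF// sqrtr_gt0 ltr0n fact_gt0.
  apply/seteqP; split => w /=.
    move=> Fw j jn /=; move/polyP: Fw => /(_ j).
    rewrite coef_poly ltnS jn coef0 => /eqP.
    by rewrite mulf_eq0 invr_eq0 (negbTE (sne j)) orbF => /eqP.
  move=> h; apply/polyP => j; rewrite coef_poly coef0 ltnS.
  by case: ifP => // jn; rewrite (h j jn) mul0r.
pose c := num_roots `[a, b] (0 : {poly R}).
have ge_m m : measurable [set w | (m < N w)%N].
  rewrite (_ : [set w | _] = (Z `&` (if (m < c)%N then setT else set0)) `|`
     (~` Z `&` many m a)).
    apply: measurableU; apply: measurableI => //.
    - by case: ifP.
    - exact: measurableC.
    - exact: measurable_many.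
  have key w : F w != 0 -> (m < N w)%N <-> many m a w.
    move=> Fw.
    have fin : finite_set (`[a, b] `&` [set y | root (F w) y]).
      apply: finite_setIr; apply: contrapT => /(infinite_set_fset (size (F w))).
      move=> [B BA Bn].
      have rB : all (root (F w)) B by apply/allP => y yB; exact: (BA y yB).
      by have := max_poly_roots Fw rB (fset_uniq B); rewrite ltnNge Bn.
    split => [mN|[s [ss ps hs Fs]]].
      pose s := sort <=%R (fset_set (`[a, b] `&` [set y | root (F w) y])).
      have us : sorted <%R s.
        by rewrite sort_lt_sorted fset_uniq.
      have sN : size s = N w by rewrite size_sort.
      exists (take m.+1 s); split.
      - by rewrite size_takel// sN.
      - exact: take_sorted.
      - apply/allP => y /mem_take; rewrite mem_sort in_fset_set// inE => -[+ _].
        by rewrite /= in_itv.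
      - apply/allP => y /mem_take; rewrite mem_sort in_fset_set// inE => -[_].
        exact.
    rewrite -ss /N /num_roots.
    apply: uniq_leq_size; first exact: lt_sorted_uniq.
    move=> y ys; rewrite in_fset_set// inE /= in_itv /=.
    by split; [exact: (allP hs)|exact: (allP Fs)].
  apply/seteqP; split => w /=.
    move=> h; have [Fw|Fw] := eqVneq (F w) 0.
      by left; split => //; move: h; rewrite /N Fw -/c => ->.
    by right; split; [exact/eqP|exact/key].
  move=> [[Fw]|[/eqP Fw /key h]]; last exact: h.
  by rewrite /N Fw -/c; case: ifP.
move=> _ B mB; rewrite setTI.
rewrite (_ : _ @^-1` B = \bigcup_m (if m%:R \in B then
    [set w | N w = m] else set0)).
  apply: bigcup_measurable => m _; case: ifP => // _.
  case: m => [|m].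
    rewrite (_ : [set w | _] = ~` [set w | (0 < N w)%N]).
      exact: measurableC.
    by apply/seteqP; split => w /=; [move=> ->|case: (N w)].
  rewrite (_ : [set w | _] = [set w | (m < N w)%N] `\` [set w | (m.+1 < N w)%N]).
    exact: measurableD.
  apply/seteqP; split => w /=; first by move=> ->; rewrite ltnn ltnSn.
  by move=> [h1 /negP]; rewrite -leqNgt => h2; apply/eqP; rewrite eqn_leq h2.
apply/seteqP; split => w /=.
  by move=> h; exists (N w) => //; rewrite ifT// inE.
by move=> [m _]; case: ifPn => // + Nm; rewrite inE -Nm.
Qed.

End root_measurability.

(** * Large degree *)

Section asymptotics.
Context (R : realType) (C K : R).
Hypotheses (C1 : 1 < C) (K1 : 1 <= K).

(** Exceeds [28 * C ^+ 2 + 1], so that [block_const * La] classes have disjoint windows within each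
    class. *)
Definition block_const : nat := (Num.truncn (28 * C ^+ 2 + 1)).+1.
(* 400 ^ 3 exceeds 8 * 24 ^ 2 * 2 * 54 ^ 2 * 2, the constant of the Hoeffding
   exponent in [central_estimate]; numerals above 5000 are split into products
   because [lra] unfolds larger ones in unary. *)
Definition rate_const : R :=
  400 * 400 * 400 * (block_const%:R * ln C) + 192 * block_const%:R + 288.
(** One positive summand for each of the seven lower bounds in [size_const_bounds]. *)
Definition size_const : R := 2 * block_const%:R / ln C + (ln C)^-1 +
  108 * (K * ln C) + 324 * K + 1728 + 8 * block_const%:R + 4 * rate_const.

Lemma lnC_gt0 : 0 < ln C. Proof. exact: ln_gt0. Qed.

Lemma block_const_ge1 : 1 <= block_const%:R :> R.
Proof. by rewrite ler1n. Qed.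

Lemma rate_const_bounds : [/\ 288 <= rate_const,
  192 * block_const%:R <= rate_const &
  400 * 400 * 400 * (block_const%:R * ln C) <= rate_const].
Proof.
have h := block_const_ge1; have l0 := lnC_gt0.
have h1 : 0 <= block_const%:R * ln C by rewrite mulr_ge0// ltW.
by rewrite /rate_const; split; lra.
Qed.

Lemma size_const_bounds :
  [/\ 2 * block_const%:R <= size_const * ln C, 1 <= size_const * ln C,
      108 * (K * ln C) <= size_const & 324 * K <= size_const] /\
  [/\ 1728 <= size_const, 8 * block_const%:R <= size_const &
      4 * rate_const <= size_const].
Proof.
have h := block_const_ge1; have l0 := lnC_gt0; have [h2 _ _] := rate_const_bounds.
have k1 := K1.
have h1 : 0 <= K * ln C by rewrite mulr_ge0//; lra.
have h3 : 0 < (ln C)^-1 by rewrite invr_gt0.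
have h4 : 0 <= 2 * block_const%:R / ln C by rewrite mulr_ge0 ?ltW//; lra.
split; last by rewrite /size_const; split; lra.
split; try by rewrite /size_const; lra.
  by rewrite -ler_pdivrMr// /size_const; lra.
by rewrite -ler_pdivrMr// div1r /size_const; lra.
Qed.

(** The fifth-order term of the exponential series at [L / 4]: [480 * 256] is [4 ^ 5] times the
    factorial of 5. *)
Lemma size_const_growth (L : R) : 480 * 256 * size_const <= L ->
  size_const * L ^+ 4 <= expR (L / 8) ^+ 2.
Proof.
move=> hL; have [_ [h _ _]] := size_const_bounds.
have L0 : 0 <= L by lra.
have -> : expR (L / 8) ^+ 2 = expR (L / 4).
  by rewrite -expRM_natl; congr expR; field.
have L4 : 0 <= L ^+ 4 by rewrite exprn_ge0.
have q0 : 0 <= L / 4 by lra.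
have := expR_ge1Dxn 4 q0.
have -> : (5)`!%:R = 120 :> R by [].
have -> : (L / 4) ^+ 5 / 120 = L / (480 * 256) * L ^+ 4 by field.
have : size_const * L ^+ 4 <= L / (480 * 256) * L ^+ 4.
  by rewrite ler_wpM2r// ler_pdivlMr; lra.
by lra.
Qed.

(** A common rate must lie below all exponents of the union bound. Hoeffding's is quadratic in
    [e * s] and is treated here; the others are compared with linear ones in [rate_le_linear]. *)
Lemma rate_le_quotient (e s D L : R) : 0 <= e -> 0 < s -> 0 < D -> 0 < L ->
  D <= rate_const * L ^+ 3 * s ->
  e ^+ 2 * s / (rate_const * L ^+ 3) <= (e * s) ^+ 2 / D.
Proof.
move=> e0 s0 D0 L0 h; have [h1 _ _] := rate_const_bounds.
have c0 : 0 < rate_const * L ^+ 3 by rewrite mulr_gt0 ?exprn_gt0//; lra.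
rewrite ler_pdivrMr// [leRHS]mulrAC ler_pdivlMr//.
rewrite (_ : (e * s) ^+ 2 * _ = e ^+ 2 * s * (rate_const * L ^+ 3 * s)); last by ring.
by rewrite ler_wpM2l// mulr_ge0 ?sqr_ge0// ltW.
Qed.

Lemma rate_le_linear (e s D L : R) : 0 <= e <= 1 -> 0 < s -> 0 < D -> 1 <= L ->
  D <= rate_const * L ->
  e ^+ 2 * s / (rate_const * L ^+ 3) <= e * s / D.
Proof.
move=> /andP[e0 e1] s0 D0 L1 h; have [h1 _ _] := rate_const_bounds.
have L0 : 0 < L by lra.
have c0 : 0 < rate_const * L ^+ 3 by rewrite mulr_gt0 ?exprn_gt0//; lra.
rewrite ler_pdivrMr// [leRHS]mulrAC ler_pdivlMr//.
apply: ler_pM.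
- by rewrite mulr_ge0 ?sqr_ge0// ltW.
- exact: ltW.
- by rewrite ler_pM2r// expr2 ler_piMl.
apply: le_trans h _; rewrite ler_wpM2l//; first by lra.
by rewrite -[leLHS]expr1 ler_weXn2l.
Qed.

End asymptotics.

Tactic Notation "linear_from" ne_hyp_list(hs) := revert hs; clear; intros; lra.

(** With [r] the eighth root of [n], all sizes are integer powers of [r]. For [e >= r^-1] the
    product [e ^+ 2 * s] is at least [r ^+ 2], which dominates [L ^+ 4]. *)
Lemma large_degree_facts (R : realType) (C K : R) (n : nat) (L s r : R) :
  1 < C -> 1 <= K -> 480 * 256 * size_const C K <= L ->
  L = ln n%:R -> s = Num.sqrt n%:R -> r = expR (L / 8) ->
  [/\ (0 < n)%N, n%:R = r ^+ 8, s = r ^+ 4,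
    1 <= r & size_const C K * L ^+ 4 <= r ^+ 2] /\
  [/\ 1000 * 1000 <= L, size_const C K <= L & 1728 <= size_const C K].
Proof.
move=> C1 K1 hl LE sE rE.
have [_ [h1 _ _]] := size_const_bounds C1 K1.
have L1 : 480 * 256 * 1728 <= L by lra.
have n0 : (0 < n)%N.
  rewrite lt0n; apply/eqP => n0; move: L1; rewrite LE n0 ln0// => h.
  by lra.
have xE : n%:R = r ^+ 8.
  rewrite rE -expRM_natl (_ : 8 * _ = L); last by field.
  by rewrite LE lnK ?posrE ?ltr0n.
have r0 : 0 <= r by rewrite rE expR_ge0.
split; split => //.
- rewrite sE xE (_ : r ^+ 8 = (r ^+ 4) ^+ 2); last by rewrite -exprM.
  by rewrite sqrtr_sqr ger0_norm// exprn_ge0.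
- by rewrite rE -[leLHS]expR0 ler_expR; lra.
- by rewrite rE; exact: size_const_growth.
- by lra.
- by lra.
Qed.

Lemma central_estimate (R : realType) (d : measure_display)
    (T : measurableType d) (P : probability T R) (X : nat -> T -> R)
    (C K : R) (n : nat) (L s r e : R) :
  (forall j, measurable_fun setT (X j)) -> indep_seq P X ->
  1 < C -> 1 <= K ->
  (forall j a b, a <= b -> pr P [set w | a <= X j w <= b] <= K * (b - a)) ->
  (forall j, pr P [set w | n%:R < `|X j w|] <= expR (- (n%:R / 4))) ->
  480 * 256 * size_const C K <= L ->
  L = ln n%:R -> s = Num.sqrt n%:R -> r = expR (L / 8) -> r^-1 <= e <= 1 ->
  exists m, [/\ 0 <= m, m <= n%:R & pr P [set w | e * s / 4 <=
      `|(nz `[L / 2 - ln C, L / 2 + ln C] (gw n (fun j => X j w)))%:R - m|] <=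
    expR (2 * L - e ^+ 2 * s / (rate_const C * L ^+ 3))].
Proof.
move=> mX iX C1 k1 sb tail large LE sE0 rE /andP[er e1].
have [[n0 xE sE r1 kr] [Lbig kL k17]] := large_degree_facts C1 k1 large LE sE0 rE.
have [[b1 b2 b3 b4] [b5 b6 b7]] := size_const_bounds C1 k1.
have [c1 c2 c3] := rate_const_bounds C1.
set kk := size_const C K in kr kL k17 b1 b2 b3 b4 b5 b6 b7 large.
set k0 := rate_const C in c1 c2 c3 b7 *.
have lC0 := lnC_gt0 C1; have B1 := block_const_ge1 C.
have expL : expR L = n%:R by rewrite LE lnK// posrE ltr0n.
clearbody kk.
have L1 : 1 <= L by linear_from Lbig.
have L0 : 0 < L by linear_from L1.
have r0 : 0 < r by linear_from r1.
have s0 : 0 < s by rewrite sE exprn_gt0.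
have s1 : 1 <= s by rewrite sE exprn_ege1.
have xs : n%:R = s ^+ 2 by rewrite xE sE -exprM.
have kL1 : kk * L <= r ^+ 2.
  by apply: le_trans kr; rewrite ler_wpM2l//; [linear_from k17|rewrite -[leLHS]expr1 ler_weXn2l].
have kL2 : kk * L ^+ 2 <= r ^+ 2.
  by apply: le_trans kr; rewrite ler_wpM2l//; [linear_from k17|rewrite ler_weXn2l].
have r23 : r ^+ 2 <= r ^+ 3 by rewrite ler_weXn2l.
have r24 : r ^+ 2 <= s by rewrite sE ler_weXn2l.
have hs : kk * L <= s by exact: le_trans r24.
have kLk : kk <= kk * L by rewrite ler_peMr//; linear_from k17.
have sx : s <= n%:R by rewrite xs expr2 ler_peMl// ltW.
pose La := (Num.truncn L).+1.
have La1 : L <= La%:R by exact/ltW/truncnS_gt.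
have La2 : La%:R <= 2 * L.
  have t : (Num.truncn L)%:R <= L by rewrite truncn_le// ltW.
  by rewrite /La -natr1; linear_from t L1.
pose Lb := (block_const C * La)%N.
have LbE : Lb%:R = (block_const C)%:R * La%:R :> R by rewrite natrM.
have Lb1 : 1 <= Lb%:R :> R by rewrite ler1n muln_gt0.
have Lbs : Lb%:R <= s * ln C.
  apply: (@le_trans _ _ (L * (kk * ln C))); last first.
    by rewrite mulrA ler_pM2r// (mulrC L).
  apply: (@le_trans _ _ (L * (2 * (block_const C)%:R))); last by rewrite ler_pM2l.
  by rewrite LbE [leRHS]mulrCA [leRHS]mulrA mulrC ler_pM2r// (lt_le_trans ltr01).
(* Rounding [y] up at most doubles it, so [Lb * q] lies between [s * ln C] and twice that, and the
   block length between [1 / (2 * s)] and [1 / s]. *)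
pose y := s * ln C / Lb%:R.
have Lb0 : 0 < Lb%:R :> R by exact: lt_le_trans Lb1.
have y1 : 1 <= y by rewrite ler_pdivlMr// mul1r.
pose q := (Num.truncn y).+1.
have q1 : y <= q%:R by exact/ltW/truncnS_gt.
have q2 : q%:R <= 2 * y.
  have t : (Num.truncn y)%:R <= y by rewrite truncn_le// (le_trans ler01).
  by rewrite /q -natr1; linear_from t y1.
have Lbq1 : s * ln C <= (Lb * q)%:R by rewrite natrM -ler_pdivrMl// mulrC.
have Lbq2 : (Lb * q)%:R <= 2 * (s * ln C).
  by rewrite natrM mulrC -ler_pdivlMr// -mulrA.
have Lbq0 : 0 < (Lb * q)%:R :> R by rewrite ltr0n !muln_gt0.
have x1 : 1 <= n%:R :> R by exact: le_trans sx.
have LaL : 1 <= La%:R :> R by exact: le_trans La1.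
have KlC : ln C <= K * ln C by rewrite ler_peMl// ltW.
have KlC0 : 0 <= K * ln C by linear_from KlC lC0.
have kks : kk <= s by exact: le_trans hs.
have xq : 48 * (K * ln C) * s <= n%:R.
  by rewrite xs expr2 ler_pM2r//; linear_from kks b3 KlC0.
have nLa : n%:R <= expR La%:R :> R by rewrite -expL ler_expR.
have y2 : y <= s * ln C.
  by rewrite /y ler_pdivrMr// ler_peMr// mulr_ge0// ltW.
have hq : 24 * K * q%:R <= expR La%:R :> R.
  apply: le_trans nLa; apply: le_trans xq.
  rewrite (_ : 48 * _ * s = 24 * K * (2 * (s * ln C))); last by ring.
  rewrite ler_pM2l; last by linear_from k1.
  by apply: le_trans q2 _; rewrite ler_pM2l.
have hq1 : q%:R <= expR La%:R :> R.
  by apply: le_trans hq; rewrite ler_peMl//; linear_from k1.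
pose z : R := expR (14 * La%:R).
have z1 : 1 <= z by rewrite -[leLHS]expR0 ler_expR; linear_from LaL.
pose G := (Num.truncn z).+1.
have hG1 : z <= G%:R by exact/ltW/truncnS_gt.
have hG2 : G.+1%:R <= expR (15 * La%:R) :> R.
  have t : (Num.truncn z)%:R <= z by rewrite truncn_le// (le_trans ler01).
  have e3 : 3 <= expR La%:R :> R by apply: le_trans (expR_ge1Dx _); linear_from La1 Lbig.
  have -> : expR (15 * La%:R) = z * expR La%:R by rewrite -expRD; congr expR; ring.
  have t' := ler_wpM2l (le_trans ler01 z1) e3.
  by rewrite -natr1 -[G%:R]natr1; linear_from t t' z1.
have hl1 : ln C / (Lb * q)%:R <= s^-1.
  by rewrite ler_pdivrMr// mulrC ler_pdivlMr// mulrC.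
have hl2 : (2 * s)^-1 <= ln C / (Lb * q)%:R.
  by rewrite ler_pdivlMr// [leLHS]mulrC ler_pdivrMr ?mulr_gt0// mulrCA (mulrC (ln C)).
have hLb : 28 * La%:R * C ^+ 2 < Lb%:R - 1.
  have t : 28 * C ^+ 2 + 1 < (block_const C)%:R by exact: truncnS_gt.
  have := ltr_pM2r (lt_le_trans ltr01 LaL) (28 * C ^+ 2 + 1) (block_const C)%:R.
  by rewrite t LbE => t'; linear_from t' La1 Lbig.
have La40 : (39 < La)%N by rewrite -(ltr_nat R); linear_from La1 Lbig.
have Lan : (24 * La < n)%N.
  rewrite -(ltr_nat R) natrM; have t : 1728 * L <= kk * L by rewrite ler_pM2r.
  by linear_from t hs sx La2 L1.
(* Since [(6 / 5) ^ 8 >= 4 >= exp 1], this many growth steps reach [exp La], hence [n]. *)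
pose Q := (8 * La)%N.
have hQ : ln C * s <= (6 / 5) ^+ Q.
  apply: (@le_trans _ _ n%:R).
    by rewrite xs expr2 ler_pM2r//; linear_from kks b3 KlC lC0.
  apply: le_trans nLa _; rewrite -[La%:R]mulr1 expRM_natl.
  apply: (@le_trans _ _ (4 ^+ La)).
    by rewrite lerXn2r ?nnegrE ?expR_ge0// expR1_le4.
  by rewrite /Q exprM lerXn2r ?nnegrE ?exprn_ge0//; clear; lra.
have lLC : 1 <= L * ln C.
  by apply: le_trans b2 _; rewrite ler_pM2r.
have e0 : 0 < e by apply: lt_le_trans er; rewrite invr_gt0.
have es3 : r ^+ 2 <= e * s.
  apply: le_trans r23 _; rewrite sE [r ^+ 4]exprS mulrA.
  by rewrite ler_peMl// ?exprn_ge0 ?(ltW r0)// -ler_pdivrMr// div1r.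
have es0 : 0 < e * s by rewrite mulr_gt0.
have ess : e * s <= s by rewrite ler_piMl// ltW.
have Q0 : 0 < Q.+1%:R :> R by [].
have Q18 : Q.+1%:R <= 18 * L by rewrite -natr1 natrM; linear_from LaL La2.
(* The deviation [e * s / 4] is shared out: an eighth of [e * s] for the classes, where [3 * Lb * M]
   is spent, and a sixteenth for each of the two outer terms. *)
pose M := e * s / (24 * Lb%:R).
pose Mo := e * s / (16 * Q.+1%:R).
(* The minimiser of the Hoeffding exponent. *)
pose la := M / (4 * (27 * La)%:R ^+ 2 * q%:R).
have bE : (27 * La)%:R = 27 * La%:R :> R by rewrite natrM.
have b0 : 0 < (27 * La)%:R :> R by rewrite ltr0n muln_gt0.
have q0 : 0 < q%:R :> R by rewrite ltr0n.
have M0 : 0 < M by rewrite divr_gt0// mulr_gt0.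
have la0 : 0 <= la by rewrite divr_ge0 ?ltW// mulr_gt0// mulr_gt0// exprn_gt0.
have hM : 24 * M <= (27 * La)%:R * q%:R.
  rewrite -(ler_pM2r Lb0) (_ : 24 * M * Lb%:R = e * s); last first.
    by rewrite /M; field; rewrite gt_eqF.
  apply: le_trans ess _; apply: (@le_trans _ _ (27 * L * (s * ln C))).
    rewrite (_ : 27 * L * _ = s * (27 * (L * ln C))); last by ring.
    by rewrite ler_peMr ?(ltW s0)//; linear_from lLC.
  rewrite -[leRHS]mulrA -natrM (mulnC q) bE.
  apply: ler_pM => //; first by linear_from L0.
    by rewrite mulr_ge0// ltW.
  by linear_from La1.
have hla : la * (27 * La)%:R <= 2^-1.
  rewrite (_ : la * _ = M / (4 * (27 * La)%:R * q%:R)); last first.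
    by rewrite /la; field; rewrite !gt_eqF.
  by rewrite ler_pdivrMr ?mulr_gt0//; linear_from hM M0.
have nsE := sE0.
have [m [m0 m1 hm]] : exists m, [/\ 0 <= m, m <= (Lb * q * (27 * La))%:R &
    pr P [set w | Lb%:R * (2 * M + M) + Q.+1%:R * (Mo + 3 * La%:R) <=
      `|(nz `[L / 2 - ln C, L / 2 + ln C] (gw n (fun j => X j w)))%:R - m|] <=
    n.+1%:R * expR (- (n%:R / 4)) + Lb%:R * (4 * expR (- (M / 4))) +
    Lb%:R * (2 * expR (- (la * M) + q%:R * (2 * la ^+ 2 * (27 * La)%:R ^+ 2))) +
    Q.+1%:R * (18 * K * expR (- Mo))].
  rewrite LE; apply: (@fixed_degree_bound _ _ _ P X mX iX K sb n La q Lb G Q C) => //;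
    by rewrite -nsE.
exists m; split => //.
  apply: le_trans m1 _; rewrite natrM bE.
  apply: (@le_trans _ _ (2 * (s * ln C) * (27 * (2 * L)))).
    by apply: ler_pM => //; rewrite ?ler_pM2l// mulr_ge0.
  rewrite (_ : _ * (27 * _) = s * (108 * ln C * L)); last by ring.
  rewrite xs expr2 ler_pM2l//; apply: le_trans hs; rewrite ler_pM2r//.
  by linear_from b3 KlC.
set H := e ^+ 2 * s / _.
apply: le_trans (le_trans (pr_le _ _) hm) _.
  move=> w /=; apply: le_trans.
  have -> : Lb%:R * (2 * M + M) = e * s / 8 by rewrite /M; field; rewrite gt_eqF.
  have -> : Q.+1%:R * (Mo + 3 * La%:R) = e * s / 16 + Q.+1%:R * (3 * La%:R).
    by rewrite mulrDr; congr (_ + _); rewrite /Mo; move: Q.+1%:R Q0 => Q1 Q10; field; rewrite gt_eqF.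
  suff : Q.+1%:R * (3 * La%:R) <= e * s / 16 by move=> h; linear_from h es0.
  have t1 : Q.+1%:R * (3 * La%:R) <= 18 * L * (3 * (2 * L)).
    by apply: ler_pM => //; rewrite ?mulr_ge0// ler_pM2l.
  have t2 : 1728 * L ^+ 2 <= e * s.
    apply: le_trans es3; apply: le_trans kL2.
    by rewrite ler_pM2r// exprn_gt0.
  by linear_from t1 t2.
have e01 : 0 <= e <= 1 by rewrite ltW.
have LbL : Lb%:R <= 2 * (block_const C)%:R * L.
  by rewrite LbE (mulrC 2) -mulrA ler_pM2l// (lt_le_trans ltr01).
have HM : H <= M / 4.
  have -> : M / 4 = e * s / (96 * Lb%:R) by rewrite /M; field; rewrite gt_eqF.
  apply: rate_le_linear => //; first by rewrite mulr_gt0.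
  apply: (@le_trans _ _ (192 * (block_const C)%:R * L)); last by rewrite ler_pM2r.
  by linear_from LbL.
have HMo : H <= Mo.
  apply: rate_le_linear => //.
  apply: (@le_trans _ _ (288 * L)); last by rewrite ler_pM2r.
  by linear_from Q18.
have Hx : H <= n%:R / 4.
  apply: (@le_trans _ _ (e * s / 288)); last by linear_from ess sx es0.
  by apply: rate_le_linear => //; apply: (le_trans c1); rewrite ler_peMr//; linear_from c1.
have Hl : H <= la * M - q%:R * (2 * la ^+ 2 * (27 * La)%:R ^+ 2).
  pose D := 8 * (24 * Lb%:R) ^+ 2 * (27 * La)%:R ^+ 2 * q%:R : R.
  have -> : la * M - q%:R * (2 * la ^+ 2 * (27 * La)%:R ^+ 2) = (e * s) ^+ 2 / D.
    by rewrite /D /la /M; move: (27 * La)%:R b0 => b b0; field; rewrite !gt_eqF.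
  apply: rate_le_quotient => //; first exact: ltW.
    by rewrite !mulr_gt0// exprn_gt0// mulr_gt0.
  apply: (@le_trans _ _ (8 * (24 * 24) * (2 * (block_const C)%:R * L) *
      (54 * L) ^+ 2 * (2 * (s * ln C)))).
    rewrite (_ : D = 8 * (24 * 24) * Lb%:R * (27 * La)%:R ^+ 2 * (Lb%:R * q%:R)); last first.
      by rewrite /D; move: (27 * La)%:R => b; ring.
    rewrite -[Lb%:R * _]natrM; apply: ler_pM => //.
    apply: ler_pM; rewrite ?sqr_ge0//.
      by rewrite ler_pM2l.
    by apply: lerXn2r; rewrite ?nnegrE ?bE; linear_from La2 LaL.
  rewrite (_ : _ * (2 * (s * ln C)) = 8 * (24 * 24) * 2 * (54 * 54) * 2 *
      ((block_const C)%:R * ln C) * (L ^+ 3 * s)); last by ring.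
  rewrite -[leRHS]mulrA ler_wpM2r//; first by rewrite mulr_ge0 ?exprn_ge0 ?ltW.
  apply: le_trans c3; rewrite ler_wpM2r//; last by clear; lra.
  by rewrite mulr_ge0// ltW.
have hH : expR (2 * L - H) = n%:R ^+ 2 * expR (- H).
  by rewrite expRD -expL -expRM_natl.
have h0 : 0 < expR (- H) by exact: expR_gt0.
have Lbx : 4 * Lb%:R <= n%:R :> R.
  apply: le_trans sx; apply: le_trans hs.
  apply: (@le_trans _ _ (8 * (block_const C)%:R * L)); last by rewrite ler_pM2r.
  by linear_from LbL.
have Qx : Q.+1%:R * (18 * K) <= n%:R.
  apply: le_trans sx; apply: le_trans hs.
  apply: (@le_trans _ _ (324 * K * L)); last by rewrite ler_pM2r.
  have K0 : 0 <= 18 * K by linear_from k1.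
  by have t := ler_wpM2r K0 Q18; linear_from t.
(* The terms contribute 2, 1, 1 and 1 times [n * exp (- H)], and [5 <= n]; this is where [exp (2 L)]
   comes from. *)
rewrite hH; apply: (@le_trans _ _ (5 * n%:R * expR (- H))); last first.
  rewrite ler_pM2r// expr2 ler_pM2r; last by linear_from x1.
  by linear_from sx kks k17.
have T1 : n.+1%:R * expR (- (n%:R / 4)) <= 2 * n%:R * expR (- H).
  by apply: ler_pM; rewrite ?expR_ge0 ?ler_expR ?lerN2// -natr1; linear_from x1.
have T2 : Lb%:R * (4 * expR (- (M / 4))) <= n%:R * expR (- H).
  by rewrite mulrA; apply: ler_pM; rewrite ?expR_ge0 ?mulr_ge0 ?ler_expR ?lerN2// mulrC.
have T3 : Lb%:R * (2 * expR (- (la * M) +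
    q%:R * (2 * la ^+ 2 * (27 * La)%:R ^+ 2))) <= n%:R * expR (- H).
  rewrite mulrA; apply: ler_pM; rewrite ?expR_ge0 ?mulr_ge0//.
    by linear_from Lbx Lb1.
  by rewrite ler_expR; linear_from Hl.
have T4 : Q.+1%:R * (18 * K * expR (- Mo)) <= n%:R * expR (- H).
  rewrite mulrA; apply: ler_pM; rewrite ?expR_ge0 ?ler_expR ?lerN2//.
  by rewrite mulr_ge0// mulr_ge0//; linear_from k1.
by linear_from T1 T2 T3 T4.
Qed.

Lemma num_roots_le (R : realType) (a b : R) (n : nat) (x : nat -> R) : a < b ->
  (num_roots `[a, b] (weyl_poly n x) <= n)%N.
Proof.
move=> ab; rewrite /num_roots; set F := weyl_poly n x.
have [F0|F0] := eqVneq F 0.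
  rewrite fset_set_infinite ?cardfs0// F0 => /finite_set_countable.
  rewrite (_ : _ `&` _ = `[a, b]%classic); last first.
    by apply/seteqP; split => [y []//|y yab]; split => //; exact: root0.
  move=> /countable_lebesgue_measure0; rewrite lebesgue_measure_itv /= lte_fin ab.
  by move=> /eqP; rewrite -EFinB eqe subr_eq0 gt_eqF.
have [fin|/fset_set_infinite ->] := pselect (finite_set (`[a, b] `&` [set y | root F y])); last first.
  by rewrite cardfs0.
have rF : all (root F) (fset_set (`[a, b] `&` [set y | root F y])).
  by apply/allP => y; rewrite in_fset_set// inE => -[].
have := max_poly_roots F0 rF (fset_uniq _).
by move=> /leq_trans/(_ (size_poly _ _)); rewrite ltnS.
Qed.

(** The mean differs from [m] by at most [e * s / 4] plus [n] times the probability of [Bad], which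
    is below [e * s / 4] too. The exponent [2 * L - H] is at most [- H / 2] because [H >= 4 * L],
    and the extra [L ^+ 3] in the final rate absorbs [rate_const] and the factor 2. *)
Lemma deviation_from_mean (R : realType) (d : measure_display)
    (T : measurableType d) (P : probability T R) (X : nat -> T -> R)
    (C K : R) (n : nat)
    (L s r e : R) (N : T -> R) :
  (forall j, measurable_fun setT (X j)) -> indep_seq P X ->
  1 < C -> 1 <= K ->
  (forall j a b, a <= b -> pr P [set w | a <= X j w <= b] <= K * (b - a)) ->
  (forall j, pr P [set w | n%:R < `|X j w|] <= expR (- (n%:R / 4))) ->
  480 * 256 * size_const C K <= L ->
  L = ln n%:R -> s = Num.sqrt n%:R -> r = expR (L / 8) -> r^-1 <= e <= 1 ->
  (forall w, N w =
    (num_roots `[C^-1 * s, C * s] (weyl_poly n (fun j => X j w)))%:R) ->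
  (P [set w | (e * s <= `|N w - fine 'E_P[N]|)%R] <=
    (expR (- (e ^+ 2 / L ^+ 6 * s)))%:E)%E.
Proof.
move=> mX iX C1 K1 sb tail large LE sE0 rE eb hN.
have [[n0 xE sE r1 kr] [Lbig kL k17]] := large_degree_facts C1 K1 large LE sE0 rE.
have [_ [_ _ b7]] := size_const_bounds C1 K1.
have [c1 _ _] := rate_const_bounds C1.
have [m [m0 mn hm]] := central_estimate mX iX C1 K1 sb tail large LE sE0 rE eb.
pose H := e ^+ 2 * s / (rate_const C * L ^+ 3); pose p0 := expR (2 * L - H).
have r0 : 0 < r by linear_from r1.
have s0 : 0 < s by rewrite sE exprn_gt0.
have L0 : 0 < L by linear_from Lbig.
have C0 : 0 < C by linear_from C1.
have es : expR (L / 2) = s.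
  by rewrite sE rE -expRM_natl; congr expR; field.
have NE w : N w = (nz `[L / 2 - ln C, L / 2 + ln C] (gw n (fun j => X j w)))%:R.
  rewrite -num_roots_nz hN !expRD expRN es lnK ?posrE//.
  by rewrite [C^-1 * s]mulrC [C * s]mulrC.
have Nn w : 0 <= N w <= n%:R.
  rewrite hN ler0n /= ler_nat num_roots_le// ltr_pM2r//.
  by apply: (lt_trans _ C1); rewrite invf_lt1.
have mN : measurable_fun setT N by move/funext: hN => ->; exact: measurable_num_roots.
pose Bad := [set w | e * s / 4 <= `|N w - m|].
have mdev c t : measurable [set w | t <= `|N w - c|].
  rewrite (_ : [set w | _] = (fun w => `|N w - c|) @^-1` `[t, +oo[%classic); last first.
    by apply/seteqP; split => w /=; rewrite in_itv/= andbT.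
  rewrite -[_ @^-1` _]setTI; apply: (measurableT_comp (@normr_measurable R setT)) => //.
  by apply: measurable_funB.
have hBad : pr P Bad <= p0.
  by apply: le_trans hm; apply: pr_le => w; rewrite /Bad /= NE.
have [e' EN /andP[he1 he2]] : exists2 e', ('E_P[N] = e'%:E)%E &
    m - e * s / 4 + - n%:R * pr P Bad <= e' <= m + e * s / 4 + n%:R * pr P Bad.
  apply: expectation_bounds => //; first exact: mdev.
    exact: mdev.
  move=> w; have /andP[N0 N1] := Nn w; rewrite indicE.
  have [wB|wB] := pselect (Bad w).
    rewrite mem_set//= !mulr1.
    have es0 : 0 < e * s by move: eb => /andP[h _]; rewrite mulr_gt0// (lt_le_trans _ h)// invr_gt0.
    by apply/andP; split; linear_from N0 N1 m0 mn es0.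
  rewrite memNset//= !mulr0 !addr0.
  by move: wB => /negP; rewrite -ltNge ltr_distlC => /andP[h1 h2]; apply/andP; split; linear_from h1 h2.
move: eb => /andP[er e1].
have e0 : 0 < e by apply: lt_le_trans er; rewrite invr_gt0.
have er1 : 1 <= e * r by rewrite -ler_pdivrMr// div1r.
have es2 : r ^+ 2 <= e ^+ 2 * s.
  rewrite (_ : e ^+ 2 * s = (e * r) ^+ 2 * r ^+ 2); last by rewrite sE; ring.
  by rewrite ler_peMl ?sqr_ge0// exprn_ege1.
have es1 : r ^+ 2 <= e * s.
  by apply: le_trans es2 _; rewrite ler_pM2r// expr2 ler_piMl// ltW.
have L3 : L <= L ^+ 3 by rewrite -[leLHS]expr1 ler_weXn2l//; linear_from Lbig.
have D0 : 0 < rate_const C * L ^+ 3.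
  by rewrite mulr_gt0 ?exprn_gt0//; linear_from c1.
have H4 : 4 * L <= H.
  rewrite ler_pdivlMr//; apply: le_trans es2; apply: le_trans kr.
  rewrite (_ : 4 * L * _ = 4 * rate_const C * L ^+ 4); last by ring.
  by rewrite ler_pM2r// exprn_gt0.
have h2H : e ^+ 2 / L ^+ 6 * s <= H / 2.
  rewrite (_ : e ^+ 2 / L ^+ 6 * s = H * (rate_const C / L ^+ 3)); last first.
    by rewrite /H; field; rewrite !gt_eqF//; linear_from c1.
  rewrite ler_pM2l; last by linear_from H4 L0.
  rewrite ler_pdivrMr ?exprn_gt0//.
  by linear_from b7 kL L3 L0.
have xp : n%:R * p0 <= 1.
  have -> : n%:R = expR L by rewrite LE lnK// posrE ltr0n.
  by rewrite -expRD -[leRHS]expR0 ler_expR; linear_from H4 L0.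
have xB : n%:R * pr P Bad <= e * s / 4.
  apply: le_trans (ler_wpM2l _ hBad) _; first exact: ler0n.
  apply: le_trans xp _; apply: (@le_trans _ _ (r ^+ 2 / 4)); last first.
    by rewrite ler_pM2r.
  have L4 : 1 <= L ^+ 4 by rewrite exprn_ege1//; linear_from Lbig.
  have t : 0 <= (size_const C K - 1728) * (L ^+ 4 - 1).
    by rewrite mulr_ge0 ?subr_ge0.
  by linear_from t kr k17 L4.
rewrite EN /= -(prE P (mdev e' (e * s))) lee_fin.
apply: (@le_trans _ _ (pr P Bad)).
  apply: pr_le => w /=; rewrite /Bad /= => h.
  have t : `|N w - e'| <= `|N w - m| + `|m - e'|.
    by rewrite (_ : N w - e' = (N w - m) + (m - e')); [exact: ler_normD|ring].
  have t' : `|m - e'| <= e * s / 2.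
    by rewrite ler_distl; apply/andP; split; linear_from he1 he2 xB.
  have t2 : 0 <= r ^+ 2 by exact: sqr_ge0.
  by linear_from h t t' es1 t2.
apply: le_trans hBad _; rewrite ler_expR.
by linear_from h2H H4.
Qed.

Lemma bounded_density_small_ball (R : realType) (d : measure_display)
    (T : measurableType d) (P : probability T R) (X : {RV P >-> R}) :
  has_bounded_density X ->
  exists2 K, 1 <= K & forall a b, a <= b ->
    (distribution P X `[a, b]%classic <= (K * (b - a))%:E)%E.
Proof.
move=> [p [K [mp hp hd]]]; exists (Num.max 1 K).
  by rewrite le_max lexx.
move=> a b ab; rewrite hd//.
apply: (@le_trans _ _ (\int[lebesgue_measure]_(x in `[a, b]) (cst K%:E x))%E).
  apply: ge0_le_integral => //=.
  - by move=> x _; rewrite lee_fin; case/andP: (hp x).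
  - by apply/measurable_EFinP; exact: measurable_funTS.
  - by move=> x _; rewrite lee_fin; case/andP: (hp x).
rewrite integral_cst// -[X in (_ * X)%E]/(@lebesgue_measure R `[a, b]%classic).
rewrite lebesgue_measure_itv /= lte_fin.
case: ifPn => [_|]; last first.
  by rewrite mule0 lee_fin mulr_ge0 ?subr_ge0// le_max ler01.
by rewrite -EFinB -EFinM lee_fin ler_wpM2r ?subr_ge0// le_max lexx orbT.
Qed.

Lemma half_pow_le_expR (R : realType) (t0 n : nat) : (2 * t0 <= n)%N ->
  2^-1 ^+ (n - t0) <= expR (- (n%:R / 4)) :> R.
Proof.
move=> h; have h2 : 2^-1 <= expR (- 2^-1) :> R.
  rewrite expRN lef_pV2 ?posrE ?expR_gt0//.
  have sq : expR 2^-1 ^+ 2 <= 4 :> R.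
    by rewrite -expRM_natl divff// expR1_le4.
  by have := expR_gt0 (2^-1 : R); nra.
apply: (@le_trans _ _ (expR (- 2^-1) ^+ (n - t0))).
  by rewrite lerXn2r ?nnegrE ?expR_ge0.
rewrite -expRM_natl ler_expR natrB; last by lia.
have : (2 * t0)%:R <= n%:R :> R by rewrite ler_nat.
by rewrite natrM; lra.
Qed.

(** * Signed coefficients, for the negative interval *)

Section signed_copies.
Context (R : realType) (d0 : measure_display) (T0 : measurableType d0)
  (P0 : probability T0 R) (X0 : {RV P0 >-> R}) (d : measure_display)
  (T : measurableType d) (P : probability T R) (X : nat -> {RV P >-> R}).
Hypothesis iid : iid_copies X0 X.
Variable g : nat -> R.
Hypothesis g1 : forall j, `|g j| = 1.

(** Reflecting the variable multiplies the [j]-th coefficient by [(-1) ^+ j]. The law of [xi] is not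
    assumed symmetric, so the new coefficients need not be identically distributed; the estimates
    above use only independence and uniform small-ball and tail bounds. *)
Let Y j w : R := g j * X j w.

Lemma signed_copies_measurable j : measurable_fun setT (Y j).
Proof. by apply: measurable_funM => //; exact: measurable_funP. Qed.

Lemma pr_copy j (A : set R) : measurable A ->
  (pr P (X j @^-1` A))%:E = distribution P0 X0 A.
Proof.
move=> mA; case: iid => _ /(_ j A mA) <-; rewrite prE// -[_ @^-1` _]setTI.
exact: measurable_funP.
Qed.

Lemma signed_copies_indep : indep_seq P Y.
Proof.
move=> J A mA.
pose B j := ( *%R (g j)) @^-1` A j.
have mB j : j \in J -> measurable (B j).
  move=> jJ; rewrite /B -[_ @^-1` _]setTI.
  by apply: mulrl_measurable => //; exact: mA.
exact: (proj1 iid J B mB).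
Qed.

Lemma signed_copies_small_ball (K : R) :
  (forall a b, a <= b -> (distribution P0 X0 `[a, b]%classic <= (K * (b - a))%:E)%E) ->
  forall j a b, a <= b -> pr P [set w | a <= Y j w <= b] <= K * (b - a).
Proof.
move=> hK j a b ab; have hj := g1 j.
have [gj|gj] : g j = 1 \/ g j = -1.
  by move: hj; have [g0|g0] := ger0P (g j) => e; [left|right; rewrite -e opprK].
  have := hK _ _ ab; rewrite -(pr_copy j)// lee_fin; apply: le_trans.
  by apply: pr_le => w /=; rewrite /Y gj mul1r in_itv.
have ab' : - b <= - a by rewrite lerN2.
have := hK _ _ ab'; rewrite -(pr_copy j)// lee_fin opprK (addrC (- a)); apply: le_trans.
apply: pr_le => w /=; rewrite /Y gj mulN1r in_itv/= => /andP[h1 h2].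
by rewrite lerNl h2 lerNr h1.
Qed.

Lemma signed_copies_tail (t : R) j :
  pr P [set w | t < `|Y j w|] = pr P0 [set w | t < `|X0 w|].
Proof.
pose A : set R := [set y | t < `|y|].
have mA : measurable A.
  rewrite (_ : A = (fun y : R => `|y|) @^-1` `]t, +oo[%classic); last first.
    by apply/seteqP; split => y /=; rewrite in_itv/= andbT.
  by rewrite -[_ @^-1` _]setTI; exact: normr_measurable.
apply: EFin_inj; rewrite (_ : [set w | _] = X j @^-1` A); last first.
  by apply/seteqP; split => w /=; rewrite /A /= /Y normrM g1 mul1r.
rewrite pr_copy// prE//.
rewrite (_ : [set w | _] = X0 @^-1` A)// -[_ @^-1` _]setTI.
exact: measurable_funP.
Qed.

End signed_copies.

Theorem theorem2p10 (R : realType) (C0 : R) (hC0 : 0 < C0)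
    (d0 : measure_display) (T0 : measurableType d0) (P0 : probability T0 R)
    (xi0 : {RV P0 >-> R})
    (hmean : ('E_P0[xi0] = 0)%E) (hvar : ('V_P0[xi0] = 1)%E)
    (hdens : has_bounded_density xi0) (hLS : log_sobolev C0 xi0)
    (CW : R) (hCW : 1 < CW) :
  exists c D1 D2 : R,
    [/\ 0 < c, 0 < D1, 0 < D2 &
      \forall n \near \oo,
        forall (d : measure_display) (T : measurableType d)
          (P : probability T R) (xi : nat -> {RV P >-> R}) (I : set R)
          (eps : R),
          iid_copies xi0 xi ->
          I = `[CW^-1 * Num.sqrt n%:R, CW * Num.sqrt n%:R]%classic \/
          I = `[- (CW * Num.sqrt n%:R), - (CW^-1 * Num.sqrt n%:R)]%classic ->
          n%:R `^ (- c) <= eps <= 1 ->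
          let N := num_weyl_roots xi n I in
          (P [set w | (eps * Num.sqrt n%:R <= `| N w - fine 'E_P[N] |)%R]
             <= (expR (- ((eps `^ D1 / (ln n%:R) `^ D2)
                          * Num.sqrt n%:R)))%:E)%E].
Proof.
have [K K1 hK] := bounded_density_small_ball hdens.
have cheb t : 0 < t -> pr P0 [set w | t <= `|xi0 w|] <= t ^- 2.
  move=> t0; have := chebyshev xi0 t0; rewrite hmean hvar mule1.
  under eq_set do rewrite subr0.
  rewrite -prE ?lee_fin//.
  rewrite (_ : [set w | _] = (fun w => `|xi0 w|) @^-1` `[t, +oo[%classic); last first.
    by apply/seteqP; split => w /=; rewrite in_itv/= andbT.
  rewrite -[_ @^-1` _]setTI; apply: (measurableT_comp (@normr_measurable R setT)) => //.
have [t0 ht0] := exponential_tail hC0 hLS cheb.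
(* [8^-1] makes [eps] at least the inverse of the eighth root of [n]; 2 and 6 are the exponents in
   [deviation_from_mean]. *)
exists 8^-1, 2, 6; split => //.
near=> n => d T P xi I eps iid hI heps.
set N := num_weyl_roots xi n I.
have [large ht] : 480 * 256 * size_const CW K <= ln n%:R /\ (2 * t0 <= n)%N.
  split; last by near: n; exact: nbhs_infty_ge.
  have : expR (480 * 256 * size_const CW K) <= n%:R.
    by near: n; exact: nbhs_infty_ger.
  move=> h; rewrite -ler_expR; apply: (le_trans h).
  rewrite lnK// posrE; apply: (lt_le_trans _ h); exact: expR_gt0.
have [[n0 _ _ _ _] [Lbig _ _]] := large_degree_facts hCW K1 large erefl erefl erefl.
have nR : 0 < n%:R :> R by rewrite ltr0n.
have hr : n%:R `^ (- 8^-1) = (expR (ln n%:R / 8))^-1 :> R.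
  by rewrite /powR gt_eqF// -expRN; congr expR; rewrite mulNr mulrC.
rewrite hr in heps.
have eps0 : 0 < eps.
  by case/andP: heps => h _; apply: lt_le_trans h; rewrite invr_gt0 expR_gt0.
rewrite !powR_mulrn ?(ltW eps0)//; last by lra.
have [g [g1 hN]] : exists g : nat -> R, (forall j, `|g j| = 1) /\ forall w, N w =
    (num_roots `[CW^-1 * Num.sqrt n%:R, CW * Num.sqrt n%:R]
      (weyl_poly n (fun j => g j * xi j w)))%:R.
  case: hI => hI.
    exists (fun=> 1); split=> [j|w]; first by rewrite normr1.
    rewrite /N /num_weyl_roots hI; congr (num_roots _ (weyl_poly _ _))%:R.
    by apply/funext => j; rewrite mul1r.
  exists (fun j => (-1) ^+ j); split=> [j|w]; first by rewrite normrX normrN1 expr1n.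
  by rewrite /N /num_weyl_roots hI num_roots_opp.
apply: (deviation_from_mean (signed_copies_measurable xi g) (signed_copies_indep iid g)
  hCW K1 (signed_copies_small_ball iid g1 hK) _ large erefl erefl erefl heps hN).
move=> j; rewrite (signed_copies_tail iid g1).
apply: le_trans (half_pow_le_expR R ht); apply: le_trans (ht0 (n - t0)%N).
by rewrite subnKC//; lia.
Unshelve. all: by end_near.
Qed.
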